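(* Let $T$ be a self-similar tiling with finite local complexity and with substitution $\omega$ having expansion factor $\lambda$, and suppose that $(G,S)$ is a recurrent pair for $T$ such that $S$ satisfies the injectivity conditions for $N$-subtiles for some $N\in\mathbb N$. Let $M^E$ be the edge substitution matrix, with largest eigenvalue $\lambda_E$. Then the Hausdorff dimension of $\partial T^{(\infty)}$ is $\dfrac{\ln\lambda_E}{\ln\lambda}$.
   Context: Tilings. A prototile $p$ is a closed set $\operatorname{supp}(p)\subset\mathbb R^2$ homeomorphic to a closed disk together with a label; a prototile set $\mathcal P$ is a finite set of prototiles. A tile is a translate $t=p+x$ ($p\in\mathcal P$, $x\in\mathbb R^2$), with support $\operatorname{supp}(p)+x$ and the label of $p$. Tiles, patches, tilings are equivalent if they are translates of each other. A tiling $T$ is a countable collection of tiles whose supports cover $\mathbb R^2$ and have pairwise disjoint interiors; $\partial T=\bigcup_{t\in T}\partial(\operatorname{supp}(t))$. A patch is a finite set of tiles with connected union of supports and pairwise disjoint interiors. $T$ has finite local complexity (FLC) if it has finitely many two-tile patches up to translation. For a patch or tiling $Q$ and $B\subset\mathbb R^2$, $[B]^Q=\{q\in Q:\operatorname{supp}(q)\cap B\ne\varnothing\}$, and $\operatorname{supp}$ of a patch is the union of the supports of its tiles. Self-similarity. $T$ is self-similar with expansion factor $\lambda>1$ if $\lambda\,\partial T\subset\partial T$ and whenever $t_1,t_2\in T$ are equivalent, the patches of $T$ enclosed by $\lambda\operatorname{supp}(t_1)$ and $\lambda\operatorname{supp}(t_2)$ are equivalent. It determines a substitution $\omega$: for $p\in\mathcal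 P$ choose $t=p+x\in T$; $\omega(p)$ is the patch of $T$ with support $\lambda\operatorname{supp}(t)$, translated by $-\lambda x$; $\omega(p+x)=\omega(p)+\lambda x$, extended tilewise to patches. Put $D_{pq}=\{d\in\mathbb R^2: q+d\in\omega(p)\}$ for $p,q\in\mathcal P$. The substitution matrix $(|D_{pq}|)_{p,q}$ is assumed primitive. Vertices and edges. On the disjoint union $\partial\mathcal P$ of the boundaries $\partial\operatorname{supp}(p)$ let $\sim_T$ be the equivalence relation generated by $a\sim_T b$ when $a\in\partial\operatorname{supp}(p)$, $b\in\partial\operatorname{supp}(q)$ and $p+x,q+y\in T$, $a+x=b+y$ for some $x,y$. A subset of $\partial\mathcal P$ is $T$-consistent if it is a union of classes. A natural vertex of $T$ is a point where three or more tiles meet; the vertex set of $\mathcal P$ is the smallest $T$-consistent set containing all representatives of natural vertices on prototiles; an edge of $p$ is a Jordan arc along $\partial\operatorname{supp}(p)$ joining neighbouring vertices. Geometric graphs. A geometric graph is the image of an embedding in the plane of the topological realization of a combinatorial graph (without degree-0 vertices); its vertices and edges are the images of those of the underlying combinatorial graph without degree-two vertices. Two geometric graphs are equivalent, $B\sim C$, if they are embeddings $\iota_B,\iota_C$ of the same combinatorial graph; this gives the homeomorphism $\iota_C\circ\iota_B^{-1}:B\to C$. A geometric graph $G$ on $\mathcal P$ is a disjoint union $\bigsqcup_{p\in\mathcal P}G_p$ of finite geometric graphs with $G_p\subset\operatorname{supp}(p)$; a vertex of $G_p$ on $\partial\operatorname{supp}(p)$ is a boundary vertex. $G$ is $T$-consistent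 if each $G_p$ meets $\partial\operatorname{supp}(p)$ only at boundary vertices and the boundary vertices of $G$ form a $T$-consistent set. The tiling $T_G$. $\Gamma(T,G)=\bigcup_{t=p+x\in T}(G_p+x)$. An empty Jordan curve in $\Gamma(T,G)$ is a Jordan curve in it containing no portion of $\Gamma(T,G)$ in its interior. When every arc of $\Gamma(T,G)$ is part of an empty Jordan curve (a standing assumption), $T_G$ is the tiling with boundary $\Gamma(T,G)$ whose tiles are the closed regions bounded by the empty Jordan curves $J$, labelled by the translation class of $[J]^T$. Recurrent pairs. For $B=\bigsqcup_p B_p$ with $B_p\subset\mathbb R^2$, $\mathcal R(B)_p=\bigcup_{q\in\mathcal P}\lambda^{-1}(B_q+D_{pq})$ (with $B_q+\varnothing=\varnothing$). $\mathcal R^n(\mathcal P)_p=\lambda^{-n}\omega^n(p)$ is a patch of tiles scaled by $\lambda^{-n}$ with support $\operatorname{supp}(p)$; its tiles are called $n$-subtiles. A pair $(G,S)$ of $T$-consistent geometric graphs on $\mathcal P$ is a recurrent pair if (i) $S\subset\mathcal R^N(G)$ for some $N\in\mathbb N$; (ii) $G_p\sim S_p$ for all $p$, with homeomorphism $\widetilde\psi_p:G_p\to S_p$; (iii) $v$ is a boundary vertex of $G_p$ iff $\widetilde\psi_p(v)$ is a boundary vertex of $S_p$, in which case both lie in the same edge of $p$. Convention: after replacing $\omega,\lambda,\mathcal R$ by powers, it is assumed that $S\subset\mathcal R(G)$. Write $\widetilde\psi$ for the collection of the $\widetilde\psi_p$. Edge substitution matrix. Let $E(G)=\bigcup_p E(G_p)$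 be the set of edges of $G$. For $e\in E(G_p)$, $\widetilde\psi(e)\subset\mathcal R(G)_p$ is a union of subedges $\lambda^{-1}(f+d)$ with $f\in E(G_q)$ and $d\in D_{pq}$. For $e\in E(G_p)$ and $f\in E(G_q)$, $M^E_{ef}$ is the number of $d\in D_{pq}$ with $\lambda^{-1}(f+d)\subset\widetilde\psi(e)$; $M^E=(M^E_{ef})_{e,f\in E(G)}$, and $\lambda_E$ is its largest eigenvalue (its spectral radius). The limit. $T^{(0)}=T_G$. Define $\psi:\partial T^{(0)}\to\mathbb R^2$ by $\psi(z)=\widetilde\psi_p(z-x)+x$ when $z\in\operatorname{supp}(t)$, $t=p+x\in T$. Then $\lambda\psi(\partial T^{(0)})\subset\partial T^{(0)}$; put $\psi^{(n)}(z)=\lambda^{-n}(\lambda\psi)^n(z)$, and let $\psi^{(\infty)}$ be the pointwise limit of $\psi^{(n)}$ (it exists and is continuous). $\partial T^{(\infty)}=\psi^{(\infty)}(\partial T^{(0)})$. Injectivity conditions. A geometric graph $S$ on $\mathcal P$ satisfies the injectivity conditions for $N$-subtiles if: (I1) for any $p\in\mathcal P$ and edges $e\ne f$ in $S_p$, the patches $[e]^{\mathcal R^N(\mathcal P)_p}$ and $[f]^{\mathcal R^N(\mathcal P)_p}$ have intersecting interiors iff $e$ and $f$ share a common vertex; (I2) if edges $e\neq f$ of $S_p$ share a common vertex $v$, then $[e]^{\mathcal R^N(\mathcal P)_p}\cap[f]^{\mathcal R^N(\mathcal P)_p}=[v]^{\mathcal R^N(\mathcal P)_p}$, the single subtile containing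 $v$, and this subtile is contained in the interior of $\operatorname{supp}(p)$; (I3) for each $p$, $[S_p]^{\mathcal R^N(\mathcal P)_p}$ does not contain any vertex of $p$ in its support; (I4) for each edge $e$ of $S_p$, the support of $[e]^{\mathcal R^N(\mathcal P)_p}$ intersects the boundary of $p$ iff $e$ does, in which case $\operatorname{supp}[e]^{\mathcal R^N(\mathcal P)_p}\cap\partial p$ is connected. *)

(* Defs.v *)
From Stdlib Require Import Relation_Operators.
From HB Require Import structures.
From mathcomp Require Import all_boot all_order all_algebra finmap.
From mathcomp Require Import complex.
From mathcomp Require Import all_classical all_reals all_analysis.

Set Implicit Arguments.
Unset Strict Implicit.
Unset Printing Implicit Defensive.

Import Order.TTheory GRing.Theory Num.Theory.
Import numFieldNormedType.Exports.

Local Open Scope classical_set_scope.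
Local Open Scope ring_scope.

(* The topology on row vectors is the product topology; the library norm on
   them is the sup norm, so the Euclidean distance is defined explicitly below
   where metric quantities matter. *)
Notation plane R := 'rV[R]_2.

Section Plane.
Context {R : realType}.
Implicit Types (A B : set (plane R)) (s d : R).

Definition scale (a : R) A : set (plane R) := [set a *: z | z in A].
Definition translate A (x : plane R) : set (plane R) := [set z + x | z in A].
Definition frontier A : set (plane R) := closure A `\` A°.

Definition closed_disk : set (plane R) :=
  [set z | z ord0 ord0 ^+ 2 + z ord0 ord_max ^+ 2 <= 1].

Definition homeomorphic A B := exists f g : plane R -> plane R,
  [/\ {within A, continuous f}, {within B, continuous g}, f @` A = B &
      (forall z, A z -> g (f z) = z) /\ (forall z, B z -> f (g z) = z)].

Definition jordan_curve (J : set (plane R)) := exists f : R -> plane R,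
  [/\ {within `[0, 1], continuous f}, f 0 = f 1,
      (forall s t, 0 <= s < 1 -> 0 <= t < 1 -> f s = f t -> s = t) &
      J = f @` `[0, 1]%classic].

Definition jordan_interior (J : set (plane R)) : set (plane R) :=
  [set z | ~ J z /\ bounded_set (connected_component (~` J) z)].

Definition edist (x y : plane R) : R :=
  Num.sqrt (\sum_(i < 2) (x ord0 i - y ord0 i) ^+ 2).

Definition ediam A : R := sup [set edist x y | x in A & y in A].

Definition diam_le d A := forall x y, A x -> A y -> edist x y <= d.

Definition hausdorff_premeasure s d A : \bar R :=
  ereal_inf [set (\sum_(0 <= i <oo) (ediam (U i) `^ s)%:E)%E |
             U in [set U : nat -> set (plane R) |
                   A `<=` \bigcup_i U i /\ forall i, diam_le d (U i)]].

Definition hausdorff_measure s A : \bar R :=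
  ereal_sup [set hausdorff_premeasure s d A | d in [set d : R | 0 < d]].

(* Leaving s = 0 out does not change the infimum, and it avoids a convention
   for the 0-th power of the diameter of the empty set. *)
Definition hausdorff_dim A : \bar R :=
  ereal_inf [set s%:E | s in [set s : R | 0 < s /\
                              hausdorff_measure s A = 0%E]].

End Plane.

Section Tilings.
Context {R : realType} {P : finType}.
Variable supp : P -> set (plane R).

(* Prototiles are indexed by a finite type, and the index serves as the label:
   distinct prototiles are never equivalent, although they may have the same
   support.  The tile p + x is encoded as the pair (p, x). *)
Definition tile : Type := (P * plane R)%type.

Definition prototile_set :=
  forall p, closed (supp p) /\ homeomorphic (supp p) closed_disk.

Definition tsupp (t : tile) : set (plane R) := translate (supp t.1) t.2.
Definition tshift (t : tile) (x : plane R) : tile := (t.1, t.2 + x).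

Implicit Types (Q T : set tile).

Definition psupp Q : set (plane R) := \bigcup_(t in Q) tsupp t.
Definition pshift Q (x : plane R) : set tile := [set tshift t x | t in Q].

Definition disjoint_interiors Q := forall t u, Q t -> Q u -> t <> u ->
  (tsupp t)° `&` (tsupp u)° = set0.

Definition patch Q :=
  [/\ finite_set Q, connected (psupp Q) & disjoint_interiors Q].

(* The last condition makes it possible to choose, for each prototile, a tile
   of T that is a translate of it. *)
Definition tiling T :=
  [/\ countable T, psupp T = setT, disjoint_interiors T &
      forall p, exists x, T (p, x)].

Definition tboundary T : set (plane R) := \bigcup_(t in T) frontier (tsupp t).

Definition two_tile_patch T Q :=
  [/\ patch Q, Q `<=` T & exists t u, t <> u /\ Q = [set t; u]].

Definition finite_local_complexity T := exists F : set (set tile),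
  finite_set F /\
  forall Q, two_tile_patch T Q -> exists Q0 x, F Q0 /\ Q = pshift Q0 x.

Definition enclosed T (B : set (plane R)) : set tile :=
  [set t | T t /\ tsupp t `<=` B].

Definition self_similar T (lam : R) :=
  [/\ 1 < lam, scale lam (tboundary T) `<=` tboundary T &
      forall p x y, T (p, x) -> T (p, y) -> exists v,
        enclosed T (scale lam (tsupp (p, y))) =
        pshift (enclosed T (scale lam (tsupp (p, x)))) v].

Section Substitution.
Variables (T : set tile) (lam : R).

Definition subst_proto (p : P) : set tile :=
  let x := xget 0 [set x | T (p, x)] in
  pshift (enclosed T (scale lam (tsupp (p, x)))) (- (lam *: x)).

Definition subst Q : set tile :=
  \bigcup_(t in Q) pshift (subst_proto t.1) (lam *: t.2).

Definition digits (p q : P) : set (plane R) :=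
  [set d | subst_proto p (q, d)].

(* fset_set A is the finite set A, or the empty one when A is infinite; the
   sets of digits are finite since supports are bounded and have non-empty
   interiors. *)
Definition subst_matrix : 'M[nat]_#|P| :=
  \matrix_(i, j) #|` fset_set (digits (enum_val i) (enum_val j)) |.

Definition primitive_mx n (M : 'M[nat]_n) :=
  exists2 k : nat, (0 < k)%N & forall i j, (0 < (M ^+ k) i j)%N.

(* The n-subtiles of p are the sets subtile n t for t a tile in the n-fold
   substitution of p; they are referred to through t. *)
Definition subtiles (n : nat) (p : P) : set tile :=
  iter n subst [set (p, 0)].

Definition subtile (n : nat) (t : tile) : set (plane R) :=
  scale (lam ^- n) (tsupp t).

Definition touching (n : nat) (p : P) (B : set (plane R)) : set tile :=
  [set t | subtiles n p t /\ subtile n t `&` B !=set0].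

Definition subtiles_supp (n : nat) Q : set (plane R) :=
  \bigcup_(t in Q) subtile n t.

Definition recur (B : P -> set (plane R)) (p : P) : set (plane R) :=
  \bigcup_(q in setT) \bigcup_(d in digits p q)
    scale lam^-1 (translate (B q) d).

End Substitution.

(* A pair (p, a) with a on the boundary of the support of p is a point of the
   disjoint union of the boundaries of the prototiles. *)
Definition proto_boundary : set tile := [set a | frontier (supp a.1) a.2].

Definition meet_in T (a b : tile) :=
  [/\ proto_boundary a, proto_boundary b &
      exists x y, [/\ T (a.1, x), T (b.1, y) & a.2 + x = b.2 + y]].

Definition consistent T (A : set tile) := A `<=` proto_boundary /\
  forall a b, clos_refl_sym_trans tile (meet_in T) a b -> A a -> A b.

Definition natural_vertex T (z : plane R) := exists t u v,
  [/\ T t, T u & T v] /\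
  [/\ t <> u, t <> v & u <> v] /\
  [/\ tsupp t z, tsupp u z & tsupp v z].

Definition proto_vertices T : set tile :=
  smallest (consistent T)
    [set a | proto_boundary a /\
             exists2 x, T (a.1, x) & natural_vertex T (a.2 + x)].

Definition proto_edge T (p : P) (a : set (plane R)) := exists f : R -> plane R,
  [/\ {within `[0, 1], continuous f},
      (forall s t, 0 <= s <= 1 -> 0 <= t <= 1 -> f s = f t -> s = t),
      a = f @` `[0, 1]%classic & a `<=` frontier (supp p)] /\
  [/\ proto_vertices T (p, f 0), proto_vertices T (p, f 1) &
      forall t, 0 < t < 1 -> ~ proto_vertices T (p, f t)].

End Tilings.

(* Finite combinatorial graphs in which degree-two vertices have been
   suppressed.  Suppressing them may create loops and multiple edges, so these
   are multigraphs; a loop contributes 2 to the degree of its vertex. *)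
Definition degree (V E : finType) (s t : E -> V) (v : V) : nat :=
  (#|[pred e | s e == v]| + #|[pred e | t e == v]|)%N.

Record cgraph := CGraph {
  vert : finType;
  edge : finType;
  src : edge -> vert;
  tgt : edge -> vert;
  degree_neq0 : forall v, degree src tgt v != 0%N;
  degree_neq2 : forall v, degree src tgt v != 2%N }.

Definition incident (K : cgraph) (e : edge K) (v : vert K) :=
  src e = v \/ tgt e = v.

(* A geometric graph with underlying combinatorial graph K, given by an
   embedding of the topological realization of K: an arc for each edge, with
   the prescribed end points and no identification other than at these. *)
Record geom_graph (R : realType) (K : cgraph) := GeomGraph {
  vpos : vert K -> plane R;
  epath : edge K -> R -> plane R;
  epath_continuous : forall e, {within `[0, 1], continuous (epath e)};
  epath0 : forall e, epath e 0 = vpos (src e);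
  epath1 : forall e, epath e 1 = vpos (tgt e);
  vpos_inj : injective vpos;
  epath_inj : forall e f s t, 0 < s < 1 -> 0 <= t <= 1 ->
    epath e s = epath f t -> e = f /\ s = t }.

Definition earc (R : realType) (K : cgraph) (B : geom_graph R K) (e : edge K) :
  set (plane R) := epath B e @` `[0, 1]%classic.

Definition gsupp (R : realType) (K : cgraph) (B : geom_graph R K) :
  set (plane R) := \bigcup_(e in setT) earc B e.

(* Two geometric graphs over the same K are equivalent; this is the resulting
   homeomorphism from (the image of) B to (the image of) C. *)
Definition gg_map (R : realType) (K : cgraph) (B C : geom_graph R K)
    (z : plane R) : plane R :=
  xget z [set w | exists e t,
    [/\ 0 <= t <= 1, z = epath B e t & w = epath C e t]].

Section GraphsOnPrototiles.
Context {R : realType} {P : finType}.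
Variables (supp : P -> set (plane R)) (T : set (@tile R P)) (lam : R).
Variable K : P -> cgraph.
Implicit Types G S : forall p, geom_graph R (K p).

Definition graph_on G := forall p, gsupp (G p) `<=` supp p.

Definition boundary_vertex G (p : P) (v : vert (K p)) :=
  frontier (supp p) (vpos (G p) v).

Definition graph_consistent G :=
  (forall p z, gsupp (G p) z -> frontier (supp p) z ->
     exists2 v, boundary_vertex G v & z = vpos (G p) v) /\
  consistent supp T
    [set a | exists2 v : vert (K a.1),
               boundary_vertex G v & a.2 = vpos (G a.1) v].

(* G_p ~ S_p is built in: both are embeddings of K p.  The inclusion is in
   the first iterate of recur. *)
Definition recurrent_pair G S :=
  [/\ graph_on G /\ graph_consistent G,
      graph_on S /\ graph_consistent S,
      (forall p, gsupp (S p) `<=` recur supp T lam (fun q => gsupp (G q)) p) &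
      forall p (v : vert (K p)),
        (boundary_vertex G v <-> boundary_vertex S v) /\
        (boundary_vertex G v -> exists a, [/\ proto_edge supp T p a,
           a (vpos (G p) v) & a (vpos (S p) v)])].

Definition Gamma G : set (plane R) :=
  \bigcup_(t in T) translate (gsupp (G t.1)) t.2.

Definition empty_jordan_curve G (J : set (plane R)) :=
  [/\ jordan_curve J, J `<=` Gamma G & jordan_interior J `&` Gamma G = set0].

(* Condition for Gamma to be the boundary of a tiling T_G, whose tiles are the
   closed regions bounded by the empty Jordan curves.  An arc means a
   (translated) edge: a longer arc may run along several such curves. *)
Definition bounds_tiling G := forall t, T t -> forall e : edge (K t.1),
  exists2 J, empty_jordan_curve G J & translate (earc (G t.1) e) t.2 `<=` J.

Section Injectivity.
Variables (S : forall p, geom_graph R (K p)) (N : nat).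
Let near p B := touching supp T lam N p B.
Let near_supp p B := subtiles_supp supp lam N (near p B).

Definition injectivity1 := forall p (e f : edge (K p)), e <> f ->
  ((near_supp p (earc (S p) e))° `&` (near_supp p (earc (S p) f))° !=set0 <->
   exists v, incident e v /\ incident f v).

Definition injectivity2 := forall p (e f : edge (K p)) (v : vert (K p)),
  e <> f -> incident e v -> incident f v ->
  exists t, [/\ near p [set vpos (S p) v] = [set t],
    near p (earc (S p) e) `&` near p (earc (S p) f) =
      near p [set vpos (S p) v] &
    subtile supp lam N t `<=` (supp p)°].

Definition injectivity3 := forall p a,
  proto_vertices supp T (p, a) -> ~ near_supp p (gsupp (S p)) a.

Definition injectivity4 := forall p (e : edge (K p)),
  let A := near_supp p (earc (S p) e) `&` frontier (supp p) in
  (A !=set0 <-> earc (S p) e `&` frontier (supp p) !=set0) /\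
  (A !=set0 -> connected A).

Definition injectivity_conditions :=
  [/\ injectivity1, injectivity2, injectivity3 & injectivity4].

End Injectivity.

Definition gedge : finType := {p : P & edge (K p)}.

(* The image of the edge e under the homeomorphism G_p -> S_p is the
   corresponding edge of S_p. *)
Definition edge_count G S (e f : gedge) : nat :=
  #|` fset_set [set d | digits supp T lam (tag e) (tag f) d /\
        scale lam^-1 (translate (earc (G (tag f)) (tagged f)) d) `<=`
        gg_map (G (tag e)) (S (tag e)) @` earc (G (tag e)) (tagged e)] |.

Definition edge_subst_matrix G S : 'M[nat]_#|gedge| :=
  \matrix_(i, j) edge_count G S (enum_val i) (enum_val j).

(* The map psi on Gamma; the overlapping prescriptions on boundary points of
   tiles agree.  Values outside Gamma are irrelevant. *)
Definition induced_map G S (psi : plane R -> plane R) :=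
  forall t z, T t -> Gamma G z -> tsupp supp t z ->
    psi z = gg_map (G t.1) (S t.1) (z - t.2) + t.2.

Definition psi_iter (psi : plane R -> plane R) (n : nat) (z : plane R) :
  plane R := lam ^- n *: iter n (fun w => lam *: psi w) z.

Definition psi_limit (psi : plane R -> plane R) (z : plane R) : plane R :=
  lim (psi_iter psi n z @[n --> \oo]).

Definition limit_boundary G (psi : plane R -> plane R) : set (plane R) :=
  psi_limit psi @` Gamma G.

End GraphsOnPrototiles.

Definition largest_eigenvalue (R : realType) n (M : 'M[nat]_n) (a : R) :=
  eigenvalue (map_mx (fun k : nat => k%:R : R) M) a /\
  forall z : complex R,
    eigenvalue (map_mx (fun k : nat => k%:R : complex R) M) z ->
    `|z| <= real_complex R a.

(* Main.v *)
(* A prototile is a closed disk, so by invariance of domain (proved with square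
   roots of planar loops) it is the closure of its connected interior.  Hence
   the tiles enclosed by an inflated tile fill it, and the substitution commutes
   with translations.  Every vertex of S_p is a vertex of R(G)_p: a vertex of
   degree at least three cannot lie inside an edge, and a vertex of degree one
   lies on the boundary of p, since an interior vertex of G_p of degree one would
   lie on a Jordan curve.  So each edge of S_p is a union of whole edges of
   R(G)_p, and the image under psi^(oo) of an edge e is the union of the
   lam^-n-scaled images of the (M^n)_ef edges of type f which descend from e.

   Upper bound: these images are covers, and (M^n)_ef = O(r^n) for all
   r > lamE by the Cayley-Hamilton theorem.

   Lower bound: distinct descendants of the same level lie in tiles with disjoint
   interiors, or are distinct edges of one tile, so that a set of diameter
   lam^-n meets a bounded number of images of level n.  Give the descendants of
   level n the weights lamE^-n u, where u >= 0 and M u >= lamE u (the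
   absolute values of an eigenvector); if a cover had too small a Hausdorff sum,
   some infinite line of descent would avoid it. *)
From Pilot Require Import Defs.
From mathcomp Require Import all_boot all_order all_algebra finmap.
From mathcomp Require Import complex ring lra.
From mathcomp Require Import all_classical all_reals all_analysis.
Set Implicit Arguments.
Unset Strict Implicit.
Unset Printing Implicit Defensive.
Import Order.TTheory GRing.Theory Num.Theory.
Import numFieldNormedType.Exports.
Local Open Scope classical_set_scope.
Local Open Scope ring_scope.

(** * Powers of non-negative integer matrices *)

(** The lower bound builds no measure on the limit set. Everything is counted on copies of edges in
    tiles of T, before passing to the limit: the limit image of a copy stays within a fixed distance
    of it, because the displacements form a geometric series, and only boundedly many copies come
    near a given point, because translates of one prototile in T cannot be closer than the radius of
    a ball inside it. An infinite line of descent is turned back into a point by nested compact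
    sets.

    Both growth estimates allow a matrix that is reducible or not diagonalizable. Passing to r >
    lamE absorbs polynomial factors in the powers, and since weights may vanish on some edges, the
    lower bound starts from an edge of positive weight. That lamE >= 1 reflects the fact that no
    copy of an edge is ever without descendants.

    The link between geometry and matrix, that an edge of S_p is a union of whole edges of R(G)_p,
    rests on one fact about arcs: connected sets inside an arc can leave an inner point of it in
    only two directions. *)

Section MatrixGrowth.

(** Used to strip one factor M - z off the characteristic polynomial; the gap r - |z| absorbs the
    homogeneous part z v. *)
Lemma linear_recurrence_bound (C : numFieldType) (v : nat -> C) (z r c : C) :
  `|z| < r -> (forall k, `|v k.+1 - z * v k| <= c * r ^+ k) ->
  exists2 d, 0 <= d & forall k, `|v k| <= d * r ^+ k.
Proof.
move=> zr hv.
have r0 : 0 < r by rewrite (le_lt_trans _ zr).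
have rz0 : 0 < r - `|z| by rewrite subr_gt0.
have c0 : 0 <= c.
  by have := hv 0%N; rewrite expr0 mulr1; apply: le_trans.
(* This d satisfies c + |z| d <= r d, which is exactly the induction step. *)
exists (`|v 0%N| + c / (r - `|z|)).
  by rewrite addr_ge0// divr_ge0// ltW.
elim=> [|k ih]; first by rewrite expr0 mulr1 lerDl divr_ge0// ltW.
have -> : v k.+1 = (v k.+1 - z * v k) + z * v k by rewrite subrK.
rewrite (le_trans (ler_normD _ _))// normrM.
set d := _ + c / _ in ih *.
have : `|v k.+1 - z * v k| + `|z| * `|v k| <= c * r ^+ k + `|z| * (d * r ^+ k).
  by rewrite lerD// ler_wpM2l.
move/le_trans; apply.
have -> : c * r ^+ k + `|z| * (d * r ^+ k) = (c + `|z| * d) * r ^+ k by ring.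
rewrite exprS mulrA; apply: ler_wpM2r; first by rewrite exprn_ge0// ltW.
rewrite -lerBrDr (mulrC `|z| d) -mulrBr mulrDl divfK ?gt_eqF//.
by rewrite lerDr mulr_ge0// ltW.
Qed.

Lemma fin_bound (C : numFieldType) (I : finType) (P : I -> C -> Prop) :
  (forall i c d, 0 <= c -> c <= d -> P i c -> P i d) ->
  (forall i, exists2 c, 0 <= c & P i c) ->
  exists2 c, 0 <= c & forall i, P i c.
Proof.
move=> mono /fin_all_exists2[F F0 FP].
exists (\sum_i F i); first by rewrite sumr_ge0.
move=> i; apply: (mono i (F i)) => //.
by rewrite (bigD1 i)//= lerDl sumr_ge0.
Qed.

(** The characteristic polynomial splits, so Cayley-Hamilton makes the product of the M - z vanish.
    A bound on A (M - z) M^k is a first-order recurrence for A M^k, so the factors can be removed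
    one at a time, without a Jordan form. *)
Lemma mxpow_bound (C : numClosedFieldType) n (M : 'M[C]_n.+1) (r : C) :
  (forall z, eigenvalue M z -> `|z| < r) ->
  exists2 c, 0 <= c & forall k i j, `|(M ^+ k) i j| <= c * r ^+ k.
Proof.
move=> hM.
have [s ps] := closed_field_poly_normal (char_poly M).
have hs z : z \in s -> `|z| < r.
  move=> zs; apply: hM; rewrite eigenvalue_root_char ps rootZ.
    by rewrite root_prod_XsubC.
  by rewrite lead_coef_eq0 monic_neq0// char_poly_monic.
have hs0 : \prod_(z <- s) (M - z%:M) = 0.
  have := Cayley_Hamilton M; rewrite ps (monicP (char_poly_monic M)) scale1r.
  rewrite rmorph_prod => <-; apply: eq_bigr => z _.
  by rewrite rmorphB/= horner_mx_X horner_mx_C.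
suff: forall A : 'M[C]_n.+1, A * \prod_(z <- s) (M - z%:M) = 0 ->
    forall ij : 'I_n.+1 * 'I_n.+1, exists2 c, 0 <= c &
      forall k, `|(A * M ^+ k) ij.1 ij.2| <= c * r ^+ k.
  move=> /(_ 1); rewrite mul1r => /(_ hs0) h.
  have r0 : 0 <= r.
    have [z zM] : exists z, eigenvalue M z.
      have : size (char_poly M) != 1 by rewrite size_char_poly.
      by move=> /closed_rootP[z]; rewrite -eigenvalue_root_char; exists z.
    by rewrite ltW// (le_lt_trans _ (hM z zM)).
  have [|c c0 hc] := fin_bound _ h.
    move=> ij c d c0 cd hc k; rewrite (le_trans (hc k))//.
    by rewrite ler_wpM2r// exprn_ge0.
  by exists c => // k i j; have := hc (i, j) k; rewrite mul1r.
elim: s hs {ps hs0} => [_ A|z s ih hs A].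
  rewrite big_nil mulr1 => -> ij; exists 0 => // k.
  by rewrite mul0r mxE normr0 mul0r.
rewrite big_cons mulrA => /ih h ij.
have [|d d0 hd] := h _ ij; first by move=> y ys; apply: hs; rewrite inE ys orbT.
apply: (@linear_recurrence_bound _ _ z _ d); first by apply: hs; rewrite inE eqxx.
move=> k; apply: le_trans (hd k); rewrite le_eqVlt; apply/orP; left.
apply/eqP; congr (`| _ |); rewrite mulrBr mulrBl exprS mulrA.
rewrite -[A * z%:M]/(A *m z%:M) mul_mx_scalar -scalerAl.
by rewrite !mxE.
Qed.

(** These are the row sums of M^k, written with the recursion that the numbers of descendants
    satisfy. *)
Fixpoint path_count n (M : 'M[nat]_n) (k : nat) (i : 'I_n) : nat :=
  if k is k'.+1 then (\sum_j M i j * path_count M k' j)%N else 1%N.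

Lemma path_countE (A : pzSemiRingType) n (M : 'M[nat]_n) k i :
  (path_count M k i)%:R =
  \sum_j ((map_mx (fun m : nat => m%:R : A) M) ^+ k) i j :> A.
Proof.
elim: k i => [|k ih] i /=.
  rewrite expr0 (bigD1 i)//= mxE eqxx big1 ?addr0// => j ji.
  by rewrite mxE eq_sym (negbTE ji).
rewrite natr_sum; under eq_bigr do rewrite natrM ih.
under [RHS]eq_bigr do rewrite exprS mxE.
rewrite exchange_big/=; apply: eq_bigr => j _; rewrite mulr_sumr.
by apply: eq_bigr => l _; rewrite mxE.
Qed.

Variables (R : realType) (n : nat) (M : 'M[nat]_n) (a : R).
Hypothesis Ma : largest_eigenvalue M a.

(** The number a is itself one of the complex eigenvalues that it dominates, so |a| <= a. *)
Lemma largest_eigenvalue_ge0 : 0 <= a.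
Proof.
case: Ma => Ma1 Ma2.
suff /Ma2 : eigenvalue (map_mx (fun k : nat => k%:R : complex R) M)
    (real_complex R a).
  by move=> h; rewrite -(lecR 0 a); apply: le_trans h; apply: normr_ge0.
rewrite eigenvalue_root_char in Ma1; rewrite eigenvalue_root_char.
have -> : map_mx (fun k : nat => k%:R : complex R) M =
    map_mx (real_complex R) (map_mx (fun k : nat => k%:R : R) M).
  by apply/matrixP => i j; rewrite !mxE rmorph_nat.
by rewrite -map_char_poly rmorph_root.
Qed.

Lemma path_count_bound (r : R) : a < r ->
  exists2 c, 0 <= c & forall k i, (path_count M k i)%:R <= c * r ^+ k.
Proof.
case: n M Ma => [|m] N Na ar; first by exists 0 => // k [].
have [|c c0 hc] := @mxpow_bound _ m
    (map_mx (fun k : nat => k%:R : complex R) N) (real_complex R r).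
  by move=> z /(proj2 Na)/le_lt_trans; apply; rewrite ltcR.
pose d := complex.Re c.
have cE : c = real_complex R d by rewrite /d RRe_real// ger0_real.
exists (d *+ m.+1) => [|k i].
  by rewrite mulrn_wge0// -(lecR 0 d) -cE.
rewrite -(lecR) rmorphM rmorphXn/= rmorph_nat path_countE.
have r0 : 0 <= r by rewrite (le_trans largest_eigenvalue_ge0)// ltW.
have : `|\sum_j (map_mx (fun m0 : nat => m0%:R : complex R) N ^+ k) i j| <=
    \sum_(j < m.+1) c * real_complex R r ^+ k.
  by rewrite (le_trans (ler_norm_sum _ _ _))// ler_sum.
rewrite sumr_const card_ord -mulrnAl cE => h.
rewrite -path_countE ger0_norm ?ler0n// in h.
by rewrite -path_countE (le_trans h)// rmorphMn.
Qed.

Lemma subeigenvector : exists2 u : 'I_n -> R,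
  (forall i, 0 <= u i /\ a * u i <= \sum_j (M i j)%:R * u j) &
  exists i, 0 < u i.
Proof.
have Ma1 := proj1 Ma; rewrite eigenvalue_root_char in Ma1.
set N := map_mx _ M in Ma1.
(* [eigenvalue] concerns row vectors; the transpose, which has the same characteristic polynomial,
   turns v into a column vector. Its absolute values then satisfy the inequality by the triangle
   inequality. *)
have : eigenvalue N^T a.
  rewrite eigenvalue_root_char; suff -> : char_poly N^T = char_poly N by [].
  rewrite /char_poly -det_tr; congr (\det _); apply/matrixP => i j.
  by rewrite !mxE eq_sym.
case/eigenvalueP => v vN v0.
exists (fun i => `|v ord0 i|) => [i|].
  split => //.
  have := congr1 (fun x : 'rV[R]_n => `| x ord0 i |) vN; rewrite !mxE normrM.
  rewrite (ger0_norm largest_eigenvalue_ge0) => <-.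
  rewrite (le_trans (ler_norm_sum _ _ _))// ler_sum// => j _.
  by rewrite !mxE normrM mulrC normr_nat.
have /rV0Pn[i vi] := v0; exists i.
by rewrite normr_gt0.
Qed.

End MatrixGrowth.

(** * Invariance of domain in the plane *)

Section PlaneTopology.
Context {R : realType}.
Implicit Types (z w : plane R).

Definition point2 (a b : R) : plane R := \row_i (if i == ord0 then a else b).

Lemma forall_ord2 (Q : 'I_2 -> Prop) : (forall i, Q i) <-> Q ord0 /\ Q ord_max.
Proof.
split=> [h|[h0 h1] i]; first by split.
by case: i => -[|[|//]] hi; [move: h0|move: h1]; congr (Q _); apply: val_inj.
Qed.

Lemma plane_eqP z w :
  z ord0 ord0 = w ord0 ord0 -> z ord0 ord_max = w ord0 ord_max -> z = w.
Proof.
move=> h0 h1; apply/rowP.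
by apply/forall_ord2.
Qed.

Lemma plane_norm_ltP z (e : R) : 0 < e ->
  `|z| < e <-> `|z ord0 ord0| < e /\ `|z ord0 ord_max| < e.
Proof.
move=> e0; have := @mx_norm_ball R 1 2 => /predeq3P /(_ 0 e (- z)).
rewrite /ball_ /= sub0r opprK => h; split.
  move=> /(proj2 h)[_ /= hz]; split.
    by have := hz ord0 ord0; rewrite /ball/= !mxE sub0r opprK.
  by have := hz ord0 ord_max; rewrite /ball/= !mxE sub0r opprK.
move=> [h0 h1]; apply/(proj1 h); split => // i; rewrite (ord1 i).
by apply/forall_ord2; rewrite /ball/= !mxE !sub0r !opprK.
Qed.

Lemma plane_norm_leP z (e : R) :
  `|z| <= e <-> `|z ord0 ord0| <= e /\ `|z ord0 ord_max| <= e.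
Proof.
split=> [h|[h0 h1]].
  split; apply/ler_addgt0Pr => d d0; apply/ltW;
    have ed : 0 < e + d by rewrite ltr_wpDl// (le_trans _ h).
    by apply: (proj1 ((plane_norm_ltP z ed).1 _)); rewrite (le_lt_trans h)// ltrDl.
  by apply: (proj2 ((plane_norm_ltP z ed).1 _)); rewrite (le_lt_trans h)// ltrDl.
apply/ler_addgt0Pr => d d0; apply/ltW/plane_norm_ltP.
  by rewrite ltr_wpDl// (le_trans _ h0).
by rewrite (le_lt_trans h0) ?(le_lt_trans h1)// ltrDl.
Qed.

Lemma cvg_planeP {U : Type} (F : set_system U) {FF : Filter F}
    (f : U -> plane R) z :
  (fun x => f x ord0 ord0) @ F --> z ord0 ord0 ->
  (fun x => f x ord0 ord_max) @ F --> z ord0 ord_max -> f @ F --> z.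
Proof.
move=> /cvgrPdist_lt h0 /cvgrPdist_lt h1; apply/cvgrPdist_lt => e e0.
near=> x; apply/(plane_norm_ltP _ e0); rewrite !mxE; split; near: x.
  exact: h0.
exact: h1.
Unshelve. all: by end_near. Qed.

(* The principal square root of x + iy, for x > 0. *)
Lemma principal_sqrt : exists p q : R * R -> R, forall x y : R, 0 < x ->
  [/\ {for (x, y), continuous p}, {for (x, y), continuous q},
      p (x, y) ^+ 2 - q (x, y) ^+ 2 = x & 2 * p (x, y) * q (x, y) = y].
Proof.
pose m (u : R * R) := Num.sqrt (u.1 ^+ 2 + u.2 ^+ 2).
pose d (u : R * R) := Num.sqrt (2 * (m u + u.1)).
(* For a complex number u = x + iy of modulus m one has (u + m)^2 = 2 (m + x) u, so (u + m) / sqrt(2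
   (m + x)) is a square root of u. *)
exists (fun u => (u.1 + m u) / d u), (fun u => u.2 / d u) => x y x0.
have c1 : {for (x, y), continuous (fun u : R * R => u.1)} by exact: cvg_fst.
have c2 : {for (x, y), continuous (fun u : R * R => u.2)} by exact: cvg_snd.
have cm : {for (x, y), continuous m}.
  apply: (@continuous_comp _ _ _ (fun u : R * R => u.1 ^+ 2 + u.2 ^+ 2)).
    by apply: cvgD; [apply: (cvgM c1 c1)|apply: (cvgM c2 c2)].
  exact: sqrt_continuous.
have cd : {for (x, y), continuous d}.
  apply: (@continuous_comp _ _ _ (fun u : R * R => 2 * (m u + u.1))).
    by apply: cvgM; [apply: cvg_cst|apply: cvgD].
  exact: sqrt_continuous.
have m2 : m (x, y) ^+ 2 = x ^+ 2 + y ^+ 2.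
  by rewrite /m/= sqr_sqrtr// addr_ge0// sqr_ge0.
have m0 : 0 <= m (x, y) by apply: sqrtr_ge0.
have d2 : d (x, y) ^+ 2 = 2 * (m (x, y) + x).
  by rewrite /d/= sqr_sqrtr//; nra.
have d0 : d (x, y) != 0.
  rewrite -sqrf_eq0 d2; apply/negP => /eqP; nra.
have d20 : 2 * (m (x, y) + x) != 0 by rewrite -d2 sqrf_eq0.
split => /=.
- by apply: cvgM; [apply: cvgD|apply: cvgV].
- by apply: cvgM => //; apply: cvgV.
- rewrite !exprMn !exprVn d2 -mulrBl.
  have -> : (x + m (x, y)) ^+ 2 - y ^+ 2 = x * (2 * (m (x, y) + x)).
    have -> : (x + m (x, y)) ^+ 2 - y ^+ 2 =
      x ^+ 2 + 2 * x * m (x, y) + m (x, y) ^+ 2 - y ^+ 2 by ring.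
    by rewrite m2; ring.
  by rewrite mulfK.
- have -> : 2 * ((x + m (x, y)) / d (x, y)) * (y / d (x, y)) =
     y * (2 * (m (x, y) + x)) / d (x, y) ^+ 2 by field.
  by rewrite d2 mulfK.
Qed.

End PlaneTopology.

Lemma continuous_for_pair (T U V : topologicalType) (f : T -> U) (g : T -> V) t :
  {for t, continuous f} -> {for t, continuous g} ->
  {for t, continuous (fun t => (f t, g t))}.
Proof. by move=> cf cg; exact: (cvg_pair cf cg). Qed.

(** * Square roots along a homotopy of planar loops *)

Section SquareRootLift.
Context {R : realType}.
Variables (k1 k2 : R * R -> R) (l b : R).
Hypotheses (ck1 : continuous k1) (ck2 : continuous k2).
Hypothesis k_neq0 : forall s t, 0 <= s <= l -> 0 <= t <= b ->
  0 < k1 (s, t) ^+ 2 + k2 (s, t) ^+ 2.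
Hypothesis k_cst : forall t, k1 (0, t) = k1 (0, 0) /\ k2 (0, t) = k2 (0, 0).

(** The expression is the real part of k(s', t) times the conjugate of k(s, t). It is positive on
    the diagonal, and compactness makes the neighbourhood uniform. Positivity keeps the quotient of
    the two values in the half-plane where the principal root is continuous. *)
Lemma sqrt_lift_uniform : exists2 d : R, 0 < d &
  forall s s' t, 0 <= s <= l -> `|s - s'| < d -> 0 <= t <= b ->
  0 < k1 (s, t) * k1 (s', t) + k2 (s, t) * k2 (s', t).
Proof.
have cpt : compact (`[0, l]%classic `*` `[0, b]%classic).
  by apply: compact_setX; apply: segment_compact.
suff : \forall d \near (0 : R)^'+, (`[0, l]%classic `*` `[0, b]%classic) `<=`
    (fun x => forall s', `|x.1 - s'| < d ->
     0 < k1 x * k1 (s', x.2) + k2 x * k2 (s', x.2)).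
  move=> h; have [d [d0 hd]] : exists d : R, 0 < d /\ forall x,
      (`[0, l]%classic `*` `[0, b]%classic) x -> forall s', `|x.1 - s'| < d ->
     0 < k1 x * k1 (s', x.2) + k2 x * k2 (s', x.2).
    near (0 : R)^'+ => d; exists d; split => //; near: d; exact: h.
  exists d => // s s' t sl ssd tb; apply: (hd (s, t)) => //.
have /compact_near_coveringP nc := cpt.
apply: (nc _ _ (fun d (x : R * R) => forall s', `|x.1 - s'| < d ->
     0 < k1 x * k1 (s', x.2) + k2 x * k2 (s', x.2))) => x [x1 x2].

  have cf : continuous (fun u : (R * R) * (R * R) =>
      k1 u.1 * k1 u.2 + k2 u.1 * k2 u.2).
    move=> u; have c1 : {for u, continuous (fun u : (R * R) * (R * R) => u.1)}.
      exact: cvg_fst.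
    have c2 : {for u, continuous (fun u : (R * R) * (R * R) => u.2)}.
      exact: cvg_snd.
    by apply: cvgD; apply: cvgM;
      (apply: continuous_comp; [|by [apply: ck1|apply: ck2]]).
  have : 0 < k1 x * k1 x + k2 x * k2 x.
    by rewrite -!expr2; case: x x1 x2 => s t /=; rewrite !in_itv/=; apply: k_neq0.
  move=> /(cvgr_gt _ (cf (x, x)) _)/=.
  move=> [[U V] /= [/nbhs_ballP[e /= e0 eU] /nbhs_ballP[f /= f0 fV]] UV].
  exists (ball x (Num.min e f / 2), [set d | d < Num.min e f / 2]) => /=.
    split; first by apply: nbhsx_ballx; rewrite divr_gt0// lt_min e0.
    by apply: nbhs_right_lt; rewrite divr_gt0// lt_min e0.
  move=> [y d]/= [xy dlt] s' ys.
  apply: (UV (y, (s', y.2))); split => /=.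
    apply: eU; apply: le_ball xy.
    by rewrite ler_pdivrMr// (le_trans (_ : _ <= e)) ?ge_min ?lexx//; nra.
  apply: fV; case: xy => xy1 xy2.
  have mf : Num.min e f <= f by rewrite ge_min lexx orbT.
  split; rewrite /ball/=.
    have -> : x.1 - s' = (x.1 - y.1) + (y.1 - s') by ring.
    rewrite (le_lt_trans (ler_normD _ _))// (lt_le_trans _ mf)//.
    rewrite [ltRHS]splitr ltrD//.
    exact: lt_trans dlt.
  apply: lt_le_trans xy2 _; rewrite (le_trans _ mf)// ler_pdivrMr//.
  have : 0 < Num.min e f by rewrite lt_min e0.
  by nra.
Unshelve. all: by end_near. Qed.


(* A continuous choice of r with r^2 = c k(s, .) up to positive factors, where
   c is the conjugate of the constant k(0, .). *)
Let lifted (s : R) := exists r1 r2 : R -> R,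
  (forall t t', (forall s, 0 <= s -> k1 (s, t) = k1 (s, t') /\ k2 (s, t) = k2 (s, t')) ->
     r1 t = r1 t' /\ r2 t = r2 t') /\
  forall t, 0 <= t <= b ->
    [/\ {for t, continuous r1}, {for t, continuous r2} &
    exists2 g, 0 < g &
      r1 t ^+ 2 - r2 t ^+ 2 =
        g * (k1 (0, 0) * k1 (s, t) + k2 (0, 0) * k2 (s, t)) /\
      2 * r1 t * r2 t =
        g * (k1 (0, 0) * k2 (s, t) - k2 (0, 0) * k1 (s, t))].

(** Multiply the root found at s by the principal square root of k(s', t) times the conjugate of
    k(s, t), namely x + iy below. *)
Lemma lifted_step s s' d : 0 <= s <= l -> 0 <= s' -> `|s - s'| < d ->
  (forall t, 0 <= t <= b -> 0 < k1 (s, t) * k1 (s', t) + k2 (s, t) * k2 (s', t)) ->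
  lifted s -> lifted s'.
Proof.
move=> sl s'0 ss pos [r1 [r2 [per hr]]].
have [p [q pq]] := @principal_sqrt R.
pose x t := k1 (s, t) * k1 (s', t) + k2 (s, t) * k2 (s', t).
pose y t := k1 (s, t) * k2 (s', t) - k2 (s, t) * k1 (s', t).
exists (fun t => r1 t * p (x t, y t) - r2 t * q (x t, y t)).
exists (fun t => r1 t * q (x t, y t) + r2 t * p (x t, y t)).
have sw u t : {for t, continuous (fun t => k1 (u, t))} /\
              {for t, continuous (fun t => k2 (u, t))}.
  have cu : {for t, continuous (fun t : R => (u, t))}.
    by apply: continuous_for_pair; [apply: cvg_cst|apply: cvg_id].
  split; first by apply: (@continuous_comp _ _ _ _ k1 t cu); apply: ck1.
  by apply: (@continuous_comp _ _ _ _ k2 t cu); apply: ck2.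
split=> [t t' tt'|t tb].
  have s0 : 0 <= s by case/andP: sl.
  have [-> ->] := per _ _ tt'; rewrite /x /y.
  by have [-> ->] := tt' s s0; have [-> ->] := tt' s' s'0.
have [c1 c2 [g g0 [gx gy]]] := hr t tb.
have [cp cq px qy] := pq _ (y t) (pos t tb).
have [a1 a2] := sw s t; have [a1' a2'] := sw s' t.
have cxy : {for t, continuous (fun t => (x t, y t))}.
  by apply: continuous_for_pair; [apply: cvgD; apply: cvgM|apply: cvgB; apply: cvgM].
have cp' : {for t, continuous (fun t => p (x t, y t))}.
  exact: (@continuous_comp _ _ _ _ p t cxy cp).
have cq' : {for t, continuous (fun t => q (x t, y t))}.
  exact: (@continuous_comp _ _ _ _ q t cxy cq).
split; [by apply: cvgB; apply: cvgM|by apply: cvgD; apply: cvgM|].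
have k0 := k_neq0 sl tb.
(* Multiplying the two quantities under the roots produces the factor k(s, t) times its conjugate, a
   positive number that goes into g. *)
exists (g * (k1 (s, t) ^+ 2 + k2 (s, t) ^+ 2)); first by rewrite mulr_gt0.
rewrite -/(x t) in px cp qy.
set A := r1 t in gx gy *; set B := r2 t in gx gy *.
set p' := p _ in px qy *; set q' := q _ in px qy *.
split.
  transitivity ((A ^+ 2 - B ^+ 2) * (p' ^+ 2 - q' ^+ 2) -
    (2 * A * B) * (2 * p' * q')); first by ring.
  by rewrite gx gy px qy /x /y; ring.
transitivity ((A ^+ 2 - B ^+ 2) * (2 * p' * q') +
    (2 * A * B) * (p' ^+ 2 - q' ^+ 2)); first by ring.
by rewrite gx gy px qy /x /y; ring.
Qed.

(** At s = 0 the constant root |k(0, 0)| works; then [0, l] is crossed in n steps of length l / n,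
    shorter than the uniform d. *)
Lemma sqrt_lift : 0 < l -> lifted l.
Proof.
move=> l0; have [d d0 hd] := sqrt_lift_uniform.
have h0 : lifted 0.
  exists (fun=> Num.sqrt (k1 (0, 0) ^+ 2 + k2 (0, 0) ^+ 2)), (fun=> 0).
  split=> // t tb; split; [exact: cvg_cst|exact: cvg_cst|].
  exists 1 => //; have [-> ->] := k_cst t.
  rewrite sqr_sqrtr ?addr_ge0 ?sqr_ge0//; split; ring.
pose n := (Num.truncn (l / d)).+1.
have n0 : 0 < n%:R :> R by rewrite ltr0n.
have hn : l / n%:R < d.
  by rewrite ltr_pdivrMr// mulrC -ltr_pdivrMr//; apply: truncnS_gt.
have sj j : (j <= n)%N -> 0 <= j%:R * (l / n%:R) <= l.
  move=> jn; have ln : 0 <= l / n%:R by apply/ltW/divr_gt0.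
  rewrite mulr_ge0 ?ler0n//=.
  by rewrite mulrA ler_pdivrMr// mulrC ler_pM2l// ler_nat.
suff h j : (j <= n)%N -> lifted (j%:R * (l / n%:R)).
  by have := h n (leqnn n); rewrite mulrC divfK// gt_eqF.
elim: j => [_|j ih jn]; first by rewrite mul0r.
have st : `|j%:R * (l / n%:R) - j.+1%:R * (l / n%:R)| < d.
  rewrite -mulrBl -natr1 opprD addNKr mulN1r normrN ger0_norm//.
  by rewrite divr_ge0// ltW.
apply: (lifted_step (sj j (ltnW jn)) _ st _ (ih (ltnW jn))).
  by case/andP: (sj _ jn).
by move=> t tb; apply: (hd _ _ _ (sj j (ltnW jn)) st tb).
Qed.

End SquareRootLift.

(* An odd loop in the punctured plane has no continuous square root, whereas
   every loop homotopic to a constant has one. *)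
Lemma odd_loop_not_nullhomotopic (R : realType) (k1 k2 : R * R -> R) (l : R) :
  0 < l -> continuous k1 -> continuous k2 ->
  (forall s t, 0 <= s <= l -> 0 <= t <= 2 * pi ->
     0 < k1 (s, t) ^+ 2 + k2 (s, t) ^+ 2) ->
  (forall t, k1 (0, t) = k1 (0, 0) /\ k2 (0, t) = k2 (0, 0)) ->
  (forall s, k1 (s, 2 * pi) = k1 (s, 0) /\ k2 (s, 2 * pi) = k2 (s, 0)) ->
  (forall t, k1 (l, t + pi) = - k1 (l, t) /\ k2 (l, t + pi) = - k2 (l, t)) ->
  False.
Proof.
move=> l0 ck1 ck2 k_neq0 k_cst k_per k_odd.
have [r1 [r2 [per hr]]] := sqrt_lift ck1 ck2 k_neq0 k_cst l0.
have pi0 : 0 < pi :> R := pi_gt0 R.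
(* X is the imaginary part of r(t + pi) times the conjugate of r(t). As r(2 pi) = r(0), it takes
   opposite values at 0 and pi. At a zero of X the two roots are parallel, whereas oddness of the
   loop makes their squares point in opposite directions. *)
pose X t := r1 t * r2 (t + pi) - r2 t * r1 (t + pi).
have Xpi : X pi = - X 0.
  rewrite /X add0r -mulr2n -mulr_natl.
  have [-> ->] := per (2 * pi) 0 (fun s _ => k_per s).
  by ring.
have cX : {within `[0, pi], continuous X}.
  apply: continuous_in_subspaceT => t; rewrite inE/= in_itv/= => /andP[t0 tpi].
  have cs : {for t, continuous (fun t => t + pi)}.
    by apply: cvgD; [apply: cvg_id|apply: cvg_cst].
  have [|c1 c2 _] := hr t; first by apply/andP; split; lra.
  have [|c1' c2' _] := hr (t + pi).
    by apply/andP; split; lra.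
  apply: cvgB; apply: cvgM => //.
    exact: (@continuous_comp _ _ _ _ r2 t cs c2').
  exact: (@continuous_comp _ _ _ _ r1 t cs c1').
have [t tpi X0] : exists2 t, t \in `[0, pi] & X t = 0.
  apply: IVT => //; first exact: ltW.
  rewrite Xpi ge_min le_max; apply/andP.
  have [X0|X0] := leP (X 0) 0; first by split => //; rewrite lerNr oppr0 X0 orbT.
  by rewrite lerNl oppr0 ltW// orbT.
move: tpi; rewrite in_itv/= => /andP[t0 tpi].
have tb : 0 <= t <= 2 * pi by rewrite t0/=; lra.
have tb' : 0 <= t + pi <= 2 * pi by apply/andP; split; lra.
case: (hr t tb) => _ _ [g g0 [gx gy]].
case: (hr (t + pi) tb') => _ _ [g' g'0 [gx' gy']].
have [kN1 kN2] := k_odd t; rewrite kN1 kN2 in gx' gy'.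
have kl0 : 0 < k1 (l, t) ^+ 2 + k2 (l, t) ^+ 2.
  by apply: k_neq0 => //; apply/andP; split; lra.
have k00 : 0 < k1 (0, 0) ^+ 2 + k2 (0, 0) ^+ 2.
  by apply: k_neq0; apply/andP; split; lra.
move: X0; rewrite /X.
set A := r1 t in gx gy *; set B := r2 t in gx gy *.
set A' := r1 _ in gx' gy' *; set B' := r2 _ in gx' gy' *.
set u := _ + _ * k2 (l, t) in gx; set v := _ - _ in gy.
have gx2 : A' ^+ 2 - B' ^+ 2 = - (g' * u) by rewrite gx' /u; ring.
have gy2 : 2 * A' * B' = - (g' * v) by rewrite gy' /v; ring.
have uv0 : 0 < u ^+ 2 + v ^+ 2.
  have -> : u ^+ 2 + v ^+ 2 = (k1 (0, 0) ^+ 2 + k2 (0, 0) ^+ 2) *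
     (k1 (l, t) ^+ 2 + k2 (l, t) ^+ 2) by rewrite /u /v; ring.
  exact: mulr_gt0.
move=> X0.
(* r * conj r' is real, hence its square is nonnegative *)
have : 0 <= (A * A' + B * B') ^+ 2 - (B * A' - A * B') ^+ 2.
  have -> : B * A' - A * B' = 0 by rewrite -oppr0 -X0; ring.
  by rewrite expr0n/= subr0 sqr_ge0.
have -> : (A * A' + B * B') ^+ 2 - (B * A' - A * B') ^+ 2 =
  (A ^+ 2 - B ^+ 2) * (A' ^+ 2 - B' ^+ 2) + (2 * A * B) * (2 * A' * B').
  by ring.
rewrite gx gy gx2 gy2.
have -> : g * u * - (g' * u) + g * v * - (g' * v) = - (g * g' * (u ^+ 2 + v ^+ 2)).
  by ring.
by rewrite oppr_ge0 leNgt !mulr_gt0.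
Qed.

(** * Injective images of the disk are neighbourhoods of the image of its centre *)

Section InvarianceOfDomain.
Context {R : realType}.
Implicit Types (z w : plane R).

Definition circle_point (t : R) : plane R := point2 (cos t) (sin t).

(** The radial retraction onto the closed disk; composing with it turns a map continuous within the
    disk into a continuous map of the whole plane. *)
Definition disk_retraction z : plane R :=
  (Num.max 1 (Num.sqrt (z ord0 ord0 ^+ 2 + z ord0 ord_max ^+ 2)))^-1 *: z.

Lemma plane_continuousP (U : topologicalType) (f : U -> plane R) t :
  {for t, continuous (fun x => f x ord0 ord0)} ->
  {for t, continuous (fun x => f x ord0 ord_max)} -> {for t, continuous f}.
Proof. by move=> c0 c1; apply: cvg_planeP. Qed.

Lemma circle_point_continuous : continuous circle_point.
Proof.
move=> t; apply: plane_continuousP.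
  rewrite (_ : (fun x => _) = cos); first exact: continuous_cos.
  by apply/funext => x; rewrite mxE.
rewrite (_ : (fun x => _) = sin); first exact: continuous_sin.
by apply/funext => x; rewrite mxE.
Qed.

Lemma disk_retraction_continuous : continuous disk_retraction.
Proof.
pose m (z : plane R) := Num.max 1 (Num.sqrt (z ord0 ord0 ^+ 2 + z ord0 ord_max ^+ 2)).
move=> z; have cm : {for z, continuous m}.
  apply: (@continuous_comp _ _ _ (fun z : plane R =>
     z ord0 ord0 ^+ 2 + z ord0 ord_max ^+ 2) (fun x => Num.max 1 (Num.sqrt x))).
    have c i : {for z, continuous (fun z : plane R => z ord0 i)}.
      exact: coord_continuous.
    apply: (@continuousD _ _ _ (fun z : plane R => z ord0 ord0 ^+ 2)).
      exact: (continuousM (c ord0) (c ord0)).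
    exact: (continuousM (c ord_max) (c ord_max)).
  apply: (@continuous_max _ _ (fun=> 1) Num.sqrt); first exact: cst_continuous.
  exact: sqrt_continuous.
have cV : {for z, continuous (fun z => (m z)^-1)}.
  by apply: continuousV cm; apply/lt0r_neq0; rewrite lt_max ltr01.
by apply: (continuousZ cV); exact: cvg_id.
Qed.

Lemma disk_retraction_in z : closed_disk (disk_retraction z).
Proof.
rewrite /closed_disk/= !mxE !exprMn -mulrDr exprVn.
set e := _ + _; have e0 : 0 <= e by rewrite addr_ge0// sqr_ge0.
rewrite mulrC ler_pdivrMr ?mul1r; last by rewrite exprn_gt0// lt_max ltr01.
rewrite -{1}(sqr_sqrtr e0) lerXn2r// ?nnegrE ?sqrtr_ge0//.
by rewrite le_max lexx orbT.
Qed.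

Lemma disk_retraction_id z : closed_disk z -> disk_retraction z = z.
Proof.
rewrite /closed_disk/= => zD; rewrite /disk_retraction max_l ?invr1 ?scale1r//.
by rewrite -(sqrtr1 R) ler_wsqrtr.
Qed.

Lemma within_comp_continuous (U V W : topologicalType) (A : set V) (g : U -> V)
    (f : V -> W) :
  {within A, continuous f} -> continuous g -> (forall x, A (g x)) ->
  continuous (f \o g).
Proof.
move=> /subspace_continuousP cf cg gA x.
move=> Q hQ; have := cf _ (gA x) _ hQ; rewrite /fmap/= /within/= => h.
have h' : nbhs x (fun y => A (g y) -> Q (f (g y))) := cg x _ h.
by apply: (@filterS _ (nbhs x) _ _ _ _ h') => y; apply.
Qed.


Lemma circle_point_disk (t a : R) : 0 <= a <= 1 -> closed_disk (a *: circle_point t).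
Proof.
move=> /andP[a0 a1]; rewrite /closed_disk/= !mxE/= !exprMn -mulrDr cos2Dsin2.
by rewrite mulr1 expr_le1.
Qed.

Lemma circle_point_neq0 t : circle_point t != 0.
Proof.
apply/eqP => h; have := cos2Dsin2 t.
have := congr1 (fun z : plane R => z ord0 ord0) h.
have := congr1 (fun z : plane R => z ord0 ord_max) h.
rewrite !mxE/= => -> ->; rewrite expr0n/= addr0 => /eqP.
by rewrite eq_sym oner_eq0.
Qed.

Lemma disk_symmetric z : closed_disk z -> closed_disk (- z).
Proof. by rewrite /closed_disk/= !mxE !sqrrN. Qed.

(* The homotopy runs from a constant loop to t |-> h(c(t)/2) - h(-c(t)/2),
   which is odd. *)
Lemma disk_image_center (h : plane R -> plane R) :
  {within closed_disk, continuous h} ->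
  (forall z w, closed_disk z -> closed_disk w -> h z = h w -> z = w) ->
  nbhs (h 0) (h @` closed_disk).
Proof.
move=> ch injh; pose H := h \o disk_retraction.
have cH : continuous H.
  by apply: within_comp_continuous ch disk_retraction_continuous disk_retraction_in.
have HE z : closed_disk z -> H z = h z by move=> /disk_retraction_id; rewrite /H/= => ->.
have D0 : closed_disk (0 : plane R) by rewrite /closed_disk/= !mxE expr0n/= addr0 ler01.
have injH z w : closed_disk z -> closed_disk w -> H z = H w -> z = w.
  by move=> zD wD; rewrite !HE//; apply: injh.
have pi0 : 0 < pi :> R := pi_gt0 R.
(* The ball to be found in the image has as radius the least distance from H(0) to the image of the
   unit circle. *)
have [t0 t0pi t0min] : exists2 t0, t0 \in `[0, 2 * pi] &
    forall t, t \in `[0, 2 * pi] ->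
      `|H (circle_point t0) - H 0| <= `|H (circle_point t) - H 0|.
  apply: (@EVT_min _ (fun t => `|H (circle_point t) - H 0|)).
    by rewrite mulr_ge0// ltW.
  apply: continuous_subspaceT => t.
  apply: (@continuous_comp _ _ _ (fun t => H (circle_point t) - H 0)).
    apply: cvgB; last exact: cvg_cst.
    apply: (@continuous_comp _ _ _ circle_point H).
      exact: circle_point_continuous.
    exact: cH.
  exact: norm_continuous.
have D1 t : closed_disk (circle_point t).
  by rewrite -(scale1r (circle_point t)); apply: circle_point_disk; rewrite ler01 lexx.
have m0 : 0 < `|H (circle_point t0) - H 0|.
  rewrite normr_gt0 subr_eq0; apply/eqP => /injH; move=> /(_ (D1 _) D0)/eqP.
  by rewrite (negbTE (circle_point_neq0 _)).
rewrite -(HE _ D0); apply/nbhs_ballP; exists `|H (circle_point t0) - H 0| => //= w.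
rewrite -ball_normE/= => wm; apply: contrapT => wN.
have {}wN z : closed_disk z -> H z != w.
  move=> zD; apply/eqP => zw; apply: wN; exists z => //.
  by rewrite -HE.
(* The homotopy has three stages, with c a point of the circle. On [0, 1] it is H(s c) - w, nonzero
   because w is not a value. On [1, 2] the point w moves along a segment to H(0), staying closer to
   H(0) than any H(c). On [2, 3] the pair (c, 0) slides to (c/2, -c/2), and injectivity keeps the
   difference nonzero. *)
pose al (s : R) := Num.min (Num.min ((4 - s) / 2) 1) s.
pose be (s : R) := Num.max ((s - 2) / 2) 0.
pose mu (s : R) := Num.min 1 (Num.max 0 (2 - s)).
pose K (u : R * R) : plane R := H (al u.1 *: circle_point u.2) -
  ((1 - mu u.1) *: H (- be u.1 *: circle_point u.2) + mu u.1 *: w).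
have cst (a : R) : continuous (fun _ : R => a) by exact: cst_continuous.
have cid : continuous (fun a : R => a) by move=> a; exact: cvg_id.
have cal : continuous al.
  move=> s; apply: (@continuous_min R R (fun s : R => Num.min ((4 - s) / 2) 1) id).
    apply: (@continuous_min R R (fun s : R => (4 - s) / 2) (fun=> 1)); last exact: cst.
    by apply: cvgM; [apply: cvgB; [exact: cvg_cst|exact: cvg_id]|exact: cvg_cst].
  exact: cid.
have cbe : continuous be.
  move=> s; apply: (@continuous_max R R (fun s : R => (s - 2) / 2) (fun=> 0)).
    by apply: cvgM; [apply: cvgB; [exact: cvg_id|exact: cvg_cst]|exact: cvg_cst].
  exact: cst.
have cmu : continuous mu.
  move=> s; apply: (@continuous_min R R (fun=> 1) (fun s : R => Num.max 0 (2 - s))).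
    exact: cst.
  apply: (@continuous_max R R (fun=> 0) (fun s : R => 2 - s)); first exact: cst.
  by apply: cvgB; [exact: cvg_cst|exact: cvg_id].
have cfst (f : R -> R) : continuous f -> continuous (fun u : R * R => f u.1).
  move=> cf u; apply: (@continuous_comp _ _ _ fst f); first exact: cvg_fst.
  exact: cf.
have csnd : continuous (fun u : R * R => circle_point u.2).
  move=> u; apply: (@continuous_comp _ _ _ snd circle_point); first exact: cvg_snd.
  exact: circle_point_continuous.
have cHs (f : R -> R) : continuous f ->
    continuous (fun u : R * R => H (f u.1 *: circle_point u.2)).
  move=> cf u; apply: (@continuous_comp _ _ _ (fun u : R * R => f u.1 *: circle_point u.2) H).
    by apply: cvgZ; [exact: cfst|exact: csnd].
  exact: cH.
have cK : continuous K.
  move=> u; apply: cvgB; first exact: cHs.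
  apply: cvgD; apply: cvgZ.
  - by apply: cvgB; [exact: cvg_cst|exact: cfst].
  - by apply: (cHs (fun s => - be s)) => s; apply: cvgN; exact: cbe.
  - exact: cfst.
  - exact: cvg_cst.
have alE s : [/\ s <= 1 -> al s = s, 1 <= s <= 2 -> al s = 1 & 2 <= s -> al s = (4 - s) / 2].
  rewrite /al; case: (ltP ((4 - s) / 2) 1) => h1.
    by case: (ltP ((4 - s) / 2) s) => h2; split => [?|/andP[? ?]|?]; lra.
  by case: (ltP 1 s) => h2; split => [?|/andP[? ?]|?]; lra.
have beE s : [/\ s <= 2 -> be s = 0 & 2 <= s -> be s = (s - 2) / 2].
  by rewrite /be; case: (ltP ((s - 2) / 2) 0) => h1; split=> ?; lra.
have muE s : [/\ s <= 1 -> mu s = 1, 1 <= s <= 2 -> mu s = 2 - s & 2 <= s -> mu s = 0].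
  rewrite /mu; case: (ltP 0 (2 - s)) => h1.
    by case: (ltP 1 (2 - s)) => h2; split => [?|/andP[? ?]|?]; lra.
  by case: (ltP 1 0) => h2; split => [?|/andP[? ?]|?]; lra.
apply: (@odd_loop_not_nullhomotopic R (fun u => K u ord0 ord0)
  (fun u => K u ord0 ord_max) 3).
- exact: ltr0n.
- move=> u; apply: (@continuous_comp _ _ _ K (fun z => z ord0 ord0)).
    exact: cK.
  exact: coord_continuous.
- move=> u; apply: (@continuous_comp _ _ _ K (fun z => z ord0 ord_max)).
    exact: cK.
  exact: coord_continuous.
- move=> s t /andP[s0 s3] t2.
  suff : K (s, t) != 0.
    apply: contra_neqT; rewrite -leNgt /= => k0.
    have : K (s, t) ord0 ord0 ^+ 2 + K (s, t) ord0 ord_max ^+ 2 == 0.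
      by rewrite eq_le k0 addr_ge0// sqr_ge0.
    rewrite paddr_eq0 ?sqr_ge0// !sqrf_eq0 => /andP[/eqP K0 /eqP K1].
    by apply: plane_eqP; rewrite ?K0 ?K1 mxE.
  rewrite /K/= subr_eq0.
  have [al1 al2 al3] := alE s; have [be1 be2] := beE s; have [mu1 mu2 mu3] := muE s.
  have [s1|s1] := leP s 1.
    rewrite mu1// subrr scale0r add0r scale1r al1//.
    by apply: wN; apply: circle_point_disk; rewrite s0.
  have [s2|s2] := leP s 2.
    rewrite al2 ?be1 ?mu2 ?(ltW s1)//.
    rewrite scale1r oppr0 scale0r; apply/negP => /eqP E.
    have := t0min t; rewrite in_itv/= => /(_ t2).
    have -> : H (circle_point t) - H 0 = (2 - s) *: (w - H 0).
      rewrite E; apply/rowP => i; rewrite !mxE; ring.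
    apply/negP; rewrite -ltNge normrZ ger0_norm; last by lra.
    rewrite distrC; apply: le_lt_trans wm.
    rewrite -{2}(mul1r `|H 0 - w|) ler_wpM2r//; lra.
  rewrite al3 ?be2 ?mu3 ?(ltW s2)//.
  rewrite subr0 scale1r scale0r addr0; apply/eqP => /injH E.
  have : ((4 - s) / 2) *: circle_point t = - ((s - 2) / 2) *: circle_point t.
    apply: E; first by apply: circle_point_disk; apply/andP; split; lra.
    by rewrite scaleNr; apply/disk_symmetric/circle_point_disk; apply/andP; split; lra.
  rewrite scaleNr => /eqP; rewrite -subr_eq0 opprK -scalerDl.
  have -> : (4 - s) / 2 + (s - 2) / 2 = 1 by field.
  by rewrite scale1r (negbTE (circle_point_neq0 t)).
- move=> t; rewrite /K/=.
  have [al0 _ _] := alE 0; have [be0 _] := beE 0.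
  by rewrite (al0 ler01) (be0 (ler0n _ 2)) oppr0 !scale0r.
- move=> s; rewrite /K/=.
  by have -> : circle_point (2 * pi) = circle_point 0
    by rewrite /circle_point mulr_natl cos2pi sin2pi cos0 sin0.
- move=> t; rewrite /K/=.
  have [_ _ al3] := alE 3; have [_ be3] := beE 3; have [_ _ mu3] := muE 3.
  have le23 : 2 <= 3 :> R by lra.
  rewrite (al3 le23) (be3 le23) (mu3 le23).
  have -> : circle_point (t + pi) = - circle_point t.
    by apply/plane_eqP; rewrite !mxE/= (cosDpi, sinDpi).
  have -> : (4 - 3) / 2 = (3 - 2) / 2 :> R by lra.
  rewrite !scalerN !scaleNr opprK.
  by split; rewrite !mxE; ring.
Qed.

End InvarianceOfDomain.

(** * Topology of sets homeomorphic to the closed disk *)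

Section ClosedDisks.
Context {R : realType}.
Implicit Types (z w : plane R) (A B : set (plane R)).

Definition open_disk : set (plane R) :=
  [set z | z ord0 ord0 ^+ 2 + z ord0 ord_max ^+ 2 < 1].

Lemma open_disk_sub : open_disk `<=` closed_disk.
Proof. by move=> z; apply: ltW. Qed.

Lemma disk_image_nbhs (h : plane R -> plane R) z0 :
  {within closed_disk, continuous h} ->
  (forall z w, closed_disk z -> closed_disk w -> h z = h w -> z = w) ->
  open_disk z0 -> nbhs (h z0) (h @` closed_disk).
Proof.
move=> ch injh; rewrite /open_disk/=; set q := _ + _ => q1.
(* A small disk about z0 is rescaled so that z0 becomes the centre. With q = |z0|^2, the disk of
   radius r fits because q + 2 r + r^2 <= q + 3 r = 1. *)
pose r := (1 - q) / 3; have r0 : 0 < r by rewrite /r; lra.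
have q0 : 0 <= q by rewrite addr_ge0// sqr_ge0.
have rE : 3 * r = 1 - q by rewrite /r; lra.
have sub z : closed_disk z -> closed_disk (z0 + r *: z).
  rewrite /closed_disk/= !mxE; rewrite /q in q1 q0 rE.
  move: (z0 ord0 ord0) (z0 ord0 ord_max) (z ord0 ord0) (z ord0 ord_max) q1 q0 rE.
  move=> a b x y q1 q0 rE xy.
  have ax : 2 * (a * x + b * y) <= 2.
    have := sqr_ge0 (a - x); have := sqr_ge0 (b - y); nra.
  have -> : (a + r * x) ^+ 2 + (b + r * y) ^+ 2 =
    (a ^+ 2 + b ^+ 2) + r * (2 * (a * x + b * y)) + r ^+ 2 * (x ^+ 2 + y ^+ 2) by ring.
  have h1 : r * (2 * (a * x + b * y)) <= r * 2 by rewrite ler_pM2l.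
  have h2 : r ^+ 2 * (x ^+ 2 + y ^+ 2) <= r ^+ 2 * 1 by rewrite ler_wpM2l// sqr_ge0.
  have h3 : r ^+ 2 <= r by rewrite expr2 ler_piMl//; lra.
  lra.
pose k z := h (z0 + r *: z).
have ck : {within closed_disk, continuous k}.
  apply/subspace_continuousP => z zD Q hQ.
  have := (proj1 (subspace_continuousP _ h) ch) _ (sub _ zD) _ hQ.
  rewrite /within/= => h'.
  have cg : {for z, continuous (fun z : plane R => z0 + r *: z)}.
    apply: (@continuousD _ _ _ (fun=> z0)); first exact: cst_continuous.
    apply: (@continuousZ _ _ _ (fun=> r)); first exact: cst_continuous.
    exact: cvg_id.
  have h2 : nbhs z (fun y => closed_disk (z0 + r *: y) -> Q (k y)) := cg _ h'.
  by apply: (@filterS _ (nbhs z) _ _ _ _ h2) => y yQ /sub/yQ.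
have ik z w : closed_disk z -> closed_disk w -> k z = k w -> z = w.
  move=> zD wD /injh => /(_ (sub _ zD) (sub _ wD))/addrI.
  move=> /(congr1 ( *:%R r^-1)); rewrite !scalerA mulVf ?gt_eqF//.
  by rewrite !scale1r.
have := disk_image_center ck ik.
rewrite /k scaler0 addr0; apply: filterS => _ [z zD <-].
by exists (z0 + r *: z) => //; apply: sub.
Qed.

Lemma open_disk_connected : connected open_disk.
Proof.
have -> : open_disk = \bigcup_(z in open_disk) ((fun t => t *: z) @` `[0, 1]%classic).
  apply/seteqP; split=> [z zD|w [z zD [t]]].
    by exists z => //; exists 1; rewrite ?scale1r//= in_itv/= ler01 lexx.
  rewrite /= in_itv/= => /andP[t0 t1] <-; move: zD; rewrite /open_disk/= !mxE !exprMn.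
  rewrite -mulrDr; apply: le_lt_trans; rewrite ler_piMl ?addr_ge0 ?sqr_ge0//.
  exact: exprn_ile1.
apply: bigcup_connected.
  exists 0 => z zD; exists 0; rewrite ?scale0r//= in_itv/= ler01 lexx//.
move=> z zD; apply: connected_continuous_connected; first exact: segment_connected.
apply: continuous_subspaceT => t.
apply: (@continuousZ _ _ _ id (fun=> z)); first exact: cvg_id.
exact: cst_continuous.
Qed.

Lemma closed_disk_compact : compact (@closed_disk R).
Proof.
apply: bounded_closed_compact.
  exists 1; split => // x x1 z zD; apply: (@le_trans _ _ 1); last exact: ltW.
  apply/plane_norm_leP; move: zD; rewrite /closed_disk/= => zD.
  have := sqr_ge0 (z ord0 ord0); have := sqr_ge0 (z ord0 ord_max) => h1 h0.
  by split; rewrite -(expr_le1 (ltn0Sn 1)) ?normr_ge0// real_normK ?num_real//;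
    lra.
have -> : closed_disk = (fun z : plane R => z ord0 ord0 ^+ 2 + z ord0 ord_max ^+ 2)
   @^-1` [set x | x <= 1] by [].
apply: closed_comp; last exact: closed_le.
move=> z _; have c i : {for z, continuous (fun z : plane R => z ord0 i)}.
  exact: coord_continuous.
apply: (@continuousD _ _ _ (fun z : plane R => z ord0 ord0 ^+ 2)).
  exact: (continuousM (c ord0) (c ord0)).
exact: (continuousM (c ord_max) (c ord_max)).
Qed.

Lemma homeomorphic_disk_compact A : homeomorphic A closed_disk -> compact A.
Proof.
move=> [f [g [cf cg fA [gf fg]]]].
have -> : A = g @` closed_disk.
  rewrite -fA; apply/seteqP; split=> [z zA|_ [_ [z zA <-] <-]].
    by exists (f z); [exists z|exact: gf].
  by rewrite gf.
by apply: continuous_compact => //; exact: closed_disk_compact.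
Qed.

(** C is the image of the open disk: invariance of domain puts it into the interior, and radial
    approach makes it dense. Its connectedness is what later places a whole tile on one side of the
    boundary of an inflated tile. *)
Lemma homeomorphic_disk_core A : homeomorphic A closed_disk ->
  exists C, [/\ connected C, C !=set0, C `<=` A° & A `<=` closure C].
Proof.
move=> [f [g [cf cg fA [gf fg]]]].
have gA : A = g @` closed_disk.
  rewrite -fA; apply/seteqP; split=> [z zA|_ [_ [z zA <-] <-]].
    by exists (f z); [exists z|exact: gf].
  by rewrite gf.
have ig z w : closed_disk z -> closed_disk w -> g z = g w -> z = w.
  by move=> zD wD zw; rewrite -(fg _ zD) -(fg _ wD) zw.
exists (g @` open_disk); split.
- apply: connected_continuous_connected; first exact: open_disk_connected.
  by apply: continuous_subspaceW cg; exact: open_disk_sub.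
- by exists (g 0); exists 0 => //; rewrite /open_disk/= !mxE expr0n/= addr0.
- by move=> _ [z zD <-]; rewrite gA; apply: disk_image_nbhs.
- rewrite gA => _ [z zD <-] Q hQ.
  have := (proj1 (subspace_continuousP _ g) cg) _ zD _ hQ; rewrite /within/= => h'.
  have cz : {for (1 : R), continuous (fun t : R => t *: z)}.
    apply: (@continuousZ _ _ _ id (fun=> z)); first exact: cvg_id.
    exact: cst_continuous.
  have h2 : \forall t \near (1 : R), closed_disk (t *: z) -> Q (g (t *: z)).
    have := cz (fun w => closed_disk w -> Q (g w)); rewrite scale1r; exact.
  have h3 : \forall t \near (1 : R)^'-, closed_disk (t *: z) -> Q (g (t *: z)).
    exact: cvg_within h2.
  suff : \forall t \near (1 : R)^'-, exists w, (g @` open_disk) w /\ Q w.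
    by move=> /filter_ex[t [w [gw Qw]]]; exists w.
  near=> t.
  have t0 : 0 < t by near: t; apply: nbhs_left_gt.
  have t1 : t < 1 by near: t; apply: nbhs_left_lt.
  have tzD : open_disk (t *: z).
    move: zD; rewrite /closed_disk /open_disk/= !mxE !exprMn -mulrDr => zD.
    apply: (@le_lt_trans _ _ (t ^+ 2)); last by rewrite exprn_ilt1// ltW.
    by rewrite -[X in _ <= X]mulr1 ler_wpM2l// sqr_ge0.
  exists (g (t *: z)); split; first by exists (t *: z).
  have tzC := open_disk_sub tzD.
  by move: tzC; near: t.
Unshelve. all: by end_near. Qed.

End ClosedDisks.

(** * Tilings by closed disks *)

Section Affine.
Context {R : realType}.
Implicit Types (z w x : plane R) (A B V : set (plane R)).

Lemma translateE A x z : translate A x z <-> A (z - x).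
Proof.
split=> [[w wA <-]|zA]; first by rewrite addrK.
by exists (z - x) => //; rewrite subrK.
Qed.

Lemma scaleE (a : R) A z : a != 0 -> scale a A z <-> A (a^-1 *: z).
Proof.
move=> a0; split=> [[w wA <-]|zA]; first by rewrite scalerA mulVf// scale1r.
by exists (a^-1 *: z) => //; rewrite scalerA mulfV// scale1r.
Qed.

Lemma affine_continuous (a : R) x : continuous (fun z : plane R => a *: z + x).
Proof.
move=> z; apply: (@continuousD _ _ _ (fun z => a *: z) (fun=> x)); last exact: cst_continuous.
apply: (@continuousZ _ _ _ (fun=> a)); first exact: cst_continuous.
exact: cvg_id.
Qed.

Lemma interior_affine (a : R) x A z : a != 0 ->
  ((fun w => a *: w + x) @^-1` A)° z <-> A° (a *: z + x).
Proof.
move=> a0; split; last exact: (@affine_continuous a x z A).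
rewrite /interior => h.
have h2 : nbhs (a^-1 *: (a *: z + x) - a^-1 *: x) ((fun w => a *: w + x) @^-1` A).
  by rewrite scalerDr scalerA mulVf// scale1r addrK.
have := @affine_continuous a^-1 (- (a^-1 *: x)) (a *: z + x) _ h2.
apply: (@filterS _ (nbhs (a *: z + x))) => w h'.
have : A (a *: (a^-1 *: w - a^-1 *: x) + x) := h'.
by rewrite scalerDr scalerN !scalerA mulfV// !scale1r subrK.
Qed.

Lemma closure_affine (a : R) x A z : a != 0 ->
  closure ((fun w => a *: w + x) @^-1` A) z <-> closure A (a *: z + x).
Proof.
move=> a0; have := interior_affine x (~` A) z a0.
rewrite preimage_setC !interiorC /setC/= => h.
by split; apply: contraPP; rewrite h.
Qed.

Lemma translate_preimage A x : translate A x = (fun w => 1 *: w + (- x)) @^-1` A.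
Proof. by apply/seteqP; split=> z; rewrite translateE/= scale1r. Qed.

Lemma scale_preimage (a : R) A : a != 0 ->
  scale a A = (fun w => a^-1 *: w + 0) @^-1` A.
Proof. by move=> a0; apply/seteqP; split=> z; rewrite scaleE//= addr0. Qed.

Lemma interior_translate A x z : (translate A x)° z <-> A° (z - x).
Proof.
have := interior_affine (- x) A z (oner_neq0 R); rewrite translate_preimage scale1r; exact.
Qed.

Lemma closure_translate A x z : closure (translate A x) z <-> closure A (z - x).
Proof.
have := closure_affine (- x) A z (oner_neq0 R); rewrite translate_preimage scale1r; exact.
Qed.

Lemma interior_scale (a : R) A z : a != 0 ->
  (scale a A)° z <-> A° (a^-1 *: z).
Proof.
move=> a0; have := interior_affine 0 A z (invr_neq0 a0).
rewrite (scale_preimage _ a0) addr0; exact.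
Qed.

Lemma closure_scale (a : R) A z : a != 0 ->
  closure (scale a A) z <-> closure A (a^-1 *: z).
Proof.
move=> a0; have := closure_affine 0 A z (invr_neq0 a0).
rewrite (scale_preimage _ a0) addr0; exact.
Qed.

Lemma closed_translate A x : closed A -> closed (translate A x).
Proof.
by move=> cA z; rewrite closure_translate translateE; apply: cA.
Qed.

Lemma closed_scale (a : R) A : a != 0 -> closed A -> closed (scale a A).
Proof.
by move=> a0 cA z; rewrite closure_scale// scaleE//; apply: cA.
Qed.

Lemma connected_translate A x : connected A -> connected (translate A x).
Proof.
move=> cA; apply: connected_continuous_connected => //.
apply: continuous_subspaceT => z.
have := @affine_continuous 1 x z.
by under [X in continuous_at _ X -> _]funext do rewrite scale1r.
Qed.

Lemma connected_interior_or_exterior A V : connected A -> closed V ->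
  A `&` V° !=set0 -> A `&` frontier V = set0 -> A `<=` V°.
Proof.
move=> cA clV [z [zA zV]] AV.
have sep : separated V° (~` V).
  split; apply/seteqP; split=> // w [].
    by move=> /(closure_subset (@interior_subset _ V))/clV.
  by have := interiorC (~` V); rewrite setCK => ->.
have : A `<=` V° `|` ~` V.
  move=> w wA; have [wV|wV] := pselect (V w); last by right.
  left; apply: contrapT => wV'; have : (A `&` frontier V) w.
    by split => //; split => //; exact: subset_closure.
  by rewrite AV.
move=> /(connected_subset sep)/(_ cA)[//|].
by move=> /(_ _ zA) /(_ (interior_subset zV)).
Qed.

(** Otherwise A would be stable under the translation by x - y, whose iterates carry a point of A
    arbitrarily far away. *)
Lemma bounded_translate_inj A x y : A !=set0 -> bounded_set A ->
  translate A x = translate A y -> x = y.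
Proof.
move=> [z0 z0A] [M [_ hM]] xy.
have hM1 : forall z, A z -> `|z| <= M + 1 by apply: hM; rewrite ltrDl.
have step z : A z -> A (z + (x - y)).
  move=> zA; have : translate A x (z + x) by rewrite translateE addrK.
  by rewrite xy translateE addrA.
have stepn n : A (z0 + (x - y) *+ n).
  elim: n => [|n ih]; first by rewrite mulr0n addr0.
  by rewrite mulrSr addrA; apply: step.
apply/eqP; rewrite -subr_eq0 -normr_le0; apply/ler_addgt0Pr => e e0.
rewrite add0r leNgt; apply/negP => h.
pose n := Num.truncn ((2 * (M + 1)) / e).
have : `|(x - y) *+ n.+1| <= 2 * (M + 1).
  rewrite -[(x - y) *+ _](addKr z0) (le_trans (ler_normD _ _))//.
  by rewrite normrN mulr2n mulrDl mul1r lerD ?hM1.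
apply/negP; rewrite -ltNge normrMn -[_ *+ n.+1]mulr_natl.
apply: (@lt_trans _ _ (n.+1%:R * e)); last by rewrite ltr_pM2l// ltr0n.
by rewrite -ltr_pdivrMr//; apply: truncnS_gt.
Qed.

End Affine.

(** * Counting separated points *)

Section Separated.
Context {R : realType}.

(** Pigeonhole on a grid of mesh 1 / d with d > |c|: two points with the same label in one cell are
    too close to be distinct. Writing the separation as [c * dist < 1] keeps it monotone in c and
    makes sense for c = 0. *)
Lemma bounded_separated_count (I : finType) (c D : R) : exists n : nat,
  forall (z0 : plane R) (s : seq (I * plane R)), uniq s ->
  (forall u v, u \in s -> v \in s -> u.1 = v.1 -> c * `|u.2 - v.2| < 1 -> u = v) ->
  (forall u, u \in s -> `|u.2 - z0| <= D) -> (size s <= n)%N.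
Proof.
pose d := `|c| + 1; have d0 : 0 < d by rewrite ltr_wpDl.
pose m := Num.truncn (2 * D * d).
exists #|{: I * 'I_m.+1 * 'I_m.+1}| => z0 s us sep sD.
pose k (u : I * plane R) i := Num.truncn (((u.2 - z0) ord0 i + D) * d).
pose g u : I * 'I_m.+1 * 'I_m.+1 := (u.1, inord (k u ord0), inord (k u ord_max)).
have coord (u : I * plane R) i : u \in s -> 0 <= (u.2 - z0) ord0 i + D <= 2 * D.
  move=> /sD/plane_norm_leP h.
  have : `|(u.2 - z0) ord0 i| <= D by move: i; apply/forall_ord2.
  by rewrite ler_norml => /andP[h1 h2]; apply/andP; split; lra.
have km u i : u \in s -> (k u i < m.+1)%N.
  move=> us1; have /andP[h1 h2] := coord u i us1; rewrite ltnS; apply: le_truncn.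
  by rewrite ler_wpM2r// ltW.
have close (u v : I * plane R) i : u \in s -> v \in s -> k u i = k v i ->
    `|(u.2 - v.2) ord0 i| < d^-1.
  move=> us1 vs1; rewrite /k => E.
  have /andP[u0 _] := coord u i us1; have /andP[v0 _] := coord v i vs1.
  set a := (u.2 - z0) ord0 i + D in u0 E; set b := (v.2 - z0) ord0 i + D in v0 E.
  have -> : (u.2 - v.2) ord0 i = a - b by rewrite /a /b !mxE; ring.
  have /truncn_itv/andP[a1 a2] : 0 <= a * d by rewrite mulr_ge0// ltW.
  have /truncn_itv/andP[b1 b2] : 0 <= b * d by rewrite mulr_ge0// ltW.
  rewrite E in a1 a2; rewrite -natr1 in a2 b2.
  by rewrite -[d^-1]mul1r ltr_pdivlMr// -(gtr0_norm d0) -normrM mulrBl ltr_norml;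
    apply/andP; split; lra.
have ug : uniq (map g s).
  rewrite map_inj_in_uniq// => u v us1 vs1 [E1 E2 E3].
  apply: sep => //.
  have E (a b : nat) : (a < m.+1)%N -> (b < m.+1)%N -> inord a = inord b :> 'I_m.+1 -> a = b.
    by move=> am bm /(congr1 (@nat_of_ord m.+1)); rewrite !inordK.
  have h : `|u.2 - v.2| < d^-1.
    apply/plane_norm_ltP; first by rewrite invr_gt0.
    by split; apply: close => //; apply: E => //; apply: km.
  apply: (@le_lt_trans _ _ (d * `|u.2 - v.2|)).
    by rewrite ler_wpM2r// (le_trans (ler_norm _))// lerDl.
  by rewrite -(mulfV (lt0r_neq0 d0)) ltr_pM2l.
rewrite -(size_map g); have /card_uniqP <- := ug.
exact: max_card.
Qed.

Lemma finite_set_of_size (U : choiceType) (A : set U) (n : nat) :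
  (forall s : seq U, uniq s -> (forall u, u \in s -> A u) -> (size s <= n)%N) ->
  finite_set A.
Proof.
move=> h; apply: contrapT => /(infinite_set_fset n.+1)[B BA].
apply/negP; rewrite -ltnNge ltnS; apply: h; first exact: fset_uniq.
by move=> u; apply: BA.
Qed.

End Separated.

(** * Packing of tiles and the filling of inflated tiles *)

Section TilingFacts.
Context {R : realType} {P : finType}.
Variables (supp : P -> set (plane R)) (T : set (@tile R P)) (lam : R).
Hypotheses (hP : prototile_set supp) (hT : tiling supp T).
Hypothesis hsim : self_similar supp T lam.
Implicit Types (p q : P) (t u : @tile R P) (x y z d : plane R).

Let lam_gt1 : 1 < lam. Proof. by case: hsim. Qed.
Let lam_gt0 : 0 < lam. Proof. exact: lt_trans lam_gt1. Qed.
Let lam_neq0 : lam != 0. Proof. exact: lt0r_neq0. Qed.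

Lemma supp_closed p : closed (supp p). Proof. by case: (hP p). Qed.

Lemma supp_compact p : compact (supp p).
Proof. by case: (hP p) => _ /homeomorphic_disk_compact. Qed.

Lemma tsupp_closed t : closed (tsupp supp t).
Proof. by apply: closed_translate; apply: supp_closed. Qed.

Lemma supp_bounded : exists2 D : R, 0 <= D & forall p z, supp p z -> `|z| <= D.
Proof.
apply: (@fin_bound R P (fun p D => forall z, supp p z -> `|z| <= D)).
  by move=> p c d c0 cd h z /h/le_trans; apply.
move=> p; have [M [_ hM]] := compact_bounded (@supp_compact p).
exists (`|M| + 1); first by rewrite addr_ge0.
by apply: hM; rewrite (le_lt_trans (ler_norm _))// ltrDl.
Qed.

Lemma supp_interior_nonempty p : (supp p)° !=set0.
Proof.
have [_ /homeomorphic_disk_core[C [_ [z zC] CA _]]] := hP p.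
by exists z; apply: CA.
Qed.

Lemma tile_core t : exists C, [/\ connected C, C !=set0,
  C `<=` (tsupp supp t)° & tsupp supp t `<=` closure C].
Proof.
have [_ /homeomorphic_disk_core[C [cC [z zC] CA AC]]] := hP t.1.
exists (translate C t.2); split.
- exact: connected_translate.
- by exists (z + t.2); rewrite translateE addrK.
- by move=> w; rewrite translateE => /CA; rewrite /tsupp interior_translate.
- by move=> w; rewrite /tsupp translateE => /AC; rewrite closure_translate.
Qed.

(** A tile is in the closure of its core, so an open set meeting the tile already meets its
    interior. *)
Lemma tsupp_interior_disjoint t u : T t -> T u -> t <> u ->
  (tsupp supp t)° `&` tsupp supp u = set0.
Proof.
move=> Tt Tu tu; apply/seteqP; split=> // z [zt zu].
have [C [_ _ Cu uC]] := tile_core u.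
have [|w [wC wt]] := uC z zu (tsupp supp t)°.
  exact: open_nbhs_nbhs (conj (@open_interior _ _) zt).
have [_ _ dis _] := hT; have := dis t u Tt Tu tu.
by move=> /seteqP[/(_ w) h _]; apply: h; split=> //; apply: Cu.
Qed.

Lemma tsupp_interior_tboundary t : T t ->
  (tsupp supp t)° `&` tboundary supp T = set0.
Proof.
move=> Tt; apply/seteqP; split=> // z [zt [u Tu [zu zu']]].
have [E|tu] := pselect (t = u); first by rewrite E in zt.
have := tsupp_interior_disjoint Tt Tu tu; move=> /seteqP[/(_ z) h _].
apply: h; split=> //; exact: (@tsupp_closed u).
Qed.

(** Two copies of p closer than the radius of a ball in its support would put the centre of one ball
    inside both tiles. The form [c * dist < 1] lets [fin_bound] find a common c for all
    prototiles. *)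
Lemma tile_packing : exists2 c : R, 0 <= c &
  forall p x y, T (p, x) -> T (p, y) -> c * `|x - y| < 1 -> x = y.
Proof.
apply: (@fin_bound R P (fun p c => forall x y,
    T (p, x) -> T (p, y) -> c * `|x - y| < 1 -> x = y)) => [|p].
  move=> p c d c0 cd h x y Tx Ty dxy.
  by apply: h => //; rewrite (le_lt_trans _ dxy)// ler_wpM2r.
have [z] := supp_interior_nonempty p.
rewrite /interior => /nbhs_ballP[e /= e0 ze].
exists e^-1; first by rewrite invr_ge0 ltW.
move=> x y Tx Ty xye; apply: contrapT => xy.
have /seteqP[/(_ (z + x)) h _] : (tsupp supp (p, x))° `&` tsupp supp (p, y) = set0.
  by apply: tsupp_interior_disjoint => // -[].
apply: h; split; rewrite /tsupp/=.
  by rewrite interior_translate addrK; apply/nbhs_ballP; exists e.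
rewrite translateE -addrA; apply: ze; rewrite -ball_normE/= opprD addNKr normrN.
by rewrite -[e]mulr1 -ltr_pdivrMl.
Qed.

Lemma tile_count D : exists n : nat, forall z0 (s : seq (@tile R P)), uniq s ->
  (forall t, t \in s -> T t) -> (forall t, t \in s -> `|t.2 - z0| <= D) ->
  (size s <= n)%N.
Proof.
have [c c0 hc] := tile_packing.
have [n hn] := @bounded_separated_count R P c D.
exists n => z0 s us sT sD; apply: (hn z0 s us) => //.
move=> [p x] [q y] /sT Tx /sT Ty /= E; rewrite -E in Ty * => xy.
by rewrite (hc _ _ _ Tx Ty xy).
Qed.

Lemma finite_tiles_near z0 D : finite_set [set t | T t /\ `|t.2 - z0| <= D].
Proof.
have [n hn] := tile_count D.
apply: (@finite_set_of_size _ _ n) => s us hs.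
by apply: (hn z0) => // t /hs[].
Qed.

Lemma finite_enclosed V : bounded_set V -> finite_set (enclosed supp T V).
Proof.
move=> [M [_ hM]]; have [D D0 hD] := supp_bounded.
have {}hM : forall z, V z -> `|z| <= M + 1 by apply: hM; rewrite ltrDl.
apply: sub_finite_set (finite_tiles_near 0 (M + 1 + D)) => t [Tt tV]; split=> //.
have [z /interior_subset zt] := supp_interior_nonempty t.1.
rewrite subr0 -[t.2](addKr z) (le_trans (ler_normD _ _))// addrC lerD//.
  by apply: hM; apply: tV; rewrite /tsupp translateE addrK.
by rewrite normrN; apply: hD zt.
Qed.

Lemma inflated_bounded t : bounded_set (scale lam (tsupp supp t)).
Proof.
have [D D0 hD] := supp_bounded.
exists (lam * (D + `|t.2|)); split; first exact: num_real.
move=> M hM z [_ [w wt <-] <-]; apply/ltW/(le_lt_trans _ hM).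
rewrite normrZ gtr0_norm// ler_pM2l// (le_trans (ler_normD _ _))// lerD2r.
exact: hD wt.
Qed.

(** Suppose z is missed by the enclosed tiles, which form a closed set U. Some tile u then has a
    core point in the interior of V and off U. The core is connected and avoids the frontier of V,
    since that frontier lies in the boundary of T by self-similarity. So u is inside V, hence
    enclosed, a contradiction. *)
Lemma enclosed_fill t : T t ->
  psupp supp (enclosed supp T (scale lam (tsupp supp t))) = scale lam (tsupp supp t).
Proof.
move=> Tt; set V := scale _ _; apply/seteqP; split=> [z [u [Tu]]|z zV]; first exact.
have clV : closed V by apply: closed_scale => //; apply: tsupp_closed.
have [C0 [cC0 [z0 z0C] CV0 VC0]] := tile_core t.
have zC : closure (scale lam C0) z.
  by rewrite closure_scale//; apply: VC0; move: zV; rewrite /V scaleE.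
set U := psupp _ _.
have clU : closed U.
  apply: closed_bigcup; first exact/finite_enclosed/inflated_bounded.
  by move=> u _; apply: tsupp_closed.
apply: contrapT => zU.
have [|w [wC wU]] := zC (~` U).
  by apply: open_nbhs_nbhs; split=> //; rewrite openC.
have wV : V° w by rewrite interior_scale//; apply: CV0; move: wC; rewrite scaleE.
have [_ cov _ _] := hT.
have [u Tu wu] : psupp supp T w by rewrite cov.
have [C [cC [z1 z1C] Cu uC]] := tile_core u.
have [|w' [w'C [w'V w'U]]] := uC w wu (V° `&` ~` U).
  apply: open_nbhs_nbhs; split=> //; apply: openI; first exact: open_interior.
  by rewrite openC.
have CV : C `<=` V°.
  apply: connected_interior_or_exterior => //; first by exists w'.
  apply/seteqP; split=> // v [vC [vV vV']].
  have /seteqP[/(_ v) h _] := tsupp_interior_tboundary Tu.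
  apply: h; split; first exact: Cu.
  have [_ sub _] := hsim; apply: sub; rewrite scaleE//; exists t => //.
  split; first by rewrite -closure_scale.
  by rewrite -interior_scale.
apply: w'U; exists u; last by have := interior_subset (Cu _ w'C).
split=> // v /uC vC; apply: clV; apply: closure_subset vC => v' /CV.
exact: interior_subset.
Qed.

Lemma psupp_pshift (Q : set (@tile R P)) v :
  psupp supp (pshift Q v) = translate (psupp supp Q) v.
Proof.
apply/seteqP; split=> [z [_ [t Qt <-]]|z].
  rewrite /tsupp/= translateE opprD addrA => zt.
  rewrite translateE; exists t => //; rewrite /tsupp translateE.
  by rewrite addrAC.
rewrite translateE => -[t Qt]; rewrite /tsupp translateE => zt.
exists (tshift t v); first by exists t.
by rewrite /tsupp translateE/= opprD addrA addrAC.
Qed.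

(* The enclosed patches fill the inflated tiles, so that two equivalent ones
   differ by the translation between the inflated tiles. *)
Lemma enclosed_shift p x y : T (p, x) -> T (p, y) ->
  enclosed supp T (scale lam (tsupp supp (p, y))) =
  pshift (enclosed supp T (scale lam (tsupp supp (p, x)))) (lam *: (y - x)).
Proof.
move=> Tx Ty; have [_ _ /(_ _ _ _ Tx Ty)[v E]] := hsim.
rewrite E; congr pshift.
have := congr1 (psupp supp) E; rewrite psupp_pshift !enclosed_fill// => E2.
pose W := scale lam (tsupp supp (p, x)).
apply: (@bounded_translate_inj _ W).
- have [z /interior_subset zt] := supp_interior_nonempty p.
  by exists (lam *: (z + x)); exists (z + x) => //; rewrite /tsupp translateE addrK.
- exact: inflated_bounded.
- rewrite /W -E2; apply/seteqP; split=> z.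
    move=> [_ [w wp <-] <-]; rewrite translateE.
    exists (w + x); first by exists w.
    by apply/rowP => i; rewrite !mxE; ring.
  rewrite translateE !scaleE// /tsupp !translateE/=.
  suff -> : lam^-1 *: z - y = lam^-1 *: (z - lam *: (y - x)) - x by [].
  by apply/rowP => i; rewrite !mxE; field.
Qed.

(** The digits are read off one chosen copy of p; [enclosed_shift] makes them valid in every
    copy. *)
Lemma digits_enclosed p q d y : T (p, y) -> digits supp T lam p q d ->
  enclosed supp T (scale lam (tsupp supp (p, y))) (q, d + lam *: y).
Proof.
move=> Ty; rewrite /digits /subst_proto/=; set x := xget _ _.
have Tx : T (p, x).
  have [_ _ _ /(_ p)[y' Ty']] := hT.
  exact: (@xgetI _ 0 [set x | T (p, x)] _ Ty').
move=> [[q' e] eE [<- <-]]; rewrite /= (enclosed_shift Tx Ty).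
exists (q', e) => //; rewrite /tshift/=; congr pair.
by apply/rowP => i; rewrite !mxE; ring.
Qed.

Lemma digits_sub p q d : digits supp T lam p q d ->
  translate (supp q) d `<=` scale lam (supp p).
Proof.
have [_ _ _ /(_ p)[y Ty]] := hT.
move=> /(digits_enclosed Ty)[_]; rewrite /tsupp/= => h z.
rewrite translateE => zd; have := h (z + lam *: y).
rewrite !translateE opprD addrA addrAC addrK => /(_ zd).
by rewrite !scaleE// translateE scalerDr scalerA mulVf// scale1r addrK.
Qed.

Lemma finite_digits p q : finite_set (digits supp T lam p q).
Proof.
have [_ _ _ /(_ p)[y Ty]] := hT.
have := finite_image (fun t => t.2 - lam *: y) (finite_enclosed (@inflated_bounded (p, y))).
apply: sub_finite_set => d /(digits_enclosed Ty) h.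
by exists (q, d + lam *: y) => //=; rewrite addrK.
Qed.

Lemma digits_disjoint p q d q' d' : digits supp T lam p q d ->
  digits supp T lam p q' d' -> (q, d) <> (q', d') ->
  (translate (supp q) d)° `&` translate (supp q') d' = set0.
Proof.
have [_ _ _ /(_ p)[y Ty]] := hT.
move=> /(digits_enclosed Ty)[T1 _] /(digits_enclosed Ty)[T2 _] qd.
have /seteqP[h _] : (tsupp supp (q, d + lam *: y))° `&`
    tsupp supp (q', d' + lam *: y) = set0.
  apply: tsupp_interior_disjoint => // -[E /addIr E']; apply: qd.
  by rewrite E E'.
apply/seteqP; split=> // z [z1 z2]; apply: (h (z + lam *: y)).
have E e : z + lam *: y - (e + lam *: y) = z - e by apply/rowP => i; rewrite !mxE; ring.
split; rewrite /tsupp/=; first by rewrite interior_translate E -interior_translate.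
by rewrite translateE E -translateE.
Qed.

End TilingFacts.

(** * Arcs in the plane *)

Section Arcs.
Context {R : realType}.
Implicit Types (A g : R -> plane R) (I : set R) (C : set (plane R)).

(** Only parameters in [I] are required to be unique, so endpoints outside [I] may coincide and
    loops are covered. *)
Definition arc_inj A I := forall t u, 0 <= t <= 1 -> I u -> A t = A u -> t = u.

Definition unit_itv : set R := [set t | 0 <= t <= 1].
Definition open_unit_itv : set R := [set t | 0 < t < 1].

Lemma unit_itvE : `[0, 1]%classic = unit_itv.
Proof. by apply/seteqP; split=> t /=; rewrite in_itv. Qed.

Lemma open_unit_itv_sub : open_unit_itv `<=` unit_itv.
Proof. by move=> t /andP[t0 t1]; apply/andP; split; apply: ltW. Qed.

Lemma path_image_compact A (e a b : R) : {within `[0, e], continuous A} ->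
  0 <= a -> b <= e -> compact (A @` `[a, b]%classic).
Proof.
move=> cA a0 be; apply: continuous_compact; last exact: segment_compact.
apply: continuous_subspaceW cA => t /=; rewrite !in_itv/= => /andP[t0 t1].
by rewrite (le_trans a0)// (le_trans t1).
Qed.

Lemma path_image_closed A (e a b : R) : {within `[0, e], continuous A} ->
  0 <= a -> b <= e -> closed (A @` `[a, b]%classic).
Proof.
move=> cA a0 b1; apply: compact_closed; last exact: path_image_compact cA a0 b1.
exact: norm_hausdorff.
Qed.

Lemma path_image_connected A (e : R) (J : set R) : {within `[0, e], continuous A} ->
  J `<=` `[0, e]%classic -> is_interval J -> connected (A @` J).
Proof.
move=> cA Je iJ; apply: connected_continuous_connected.
  exact/connected_intervalP.
exact: continuous_subspaceW cA.
Qed.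

Lemma reverse_path_continuous A : {within `[0, 1], continuous A} ->
  {within `[0, 1], continuous (fun t => A (1 - t))}.
Proof.
move=> cA; apply/subspace_continuousP => t /=; rewrite in_itv/= => t01 Q hQ.
have t01' : `[0, 1]%classic (1 - t) by rewrite /= in_itv/=; apply/andP; split; lra.
have := (proj1 (subspace_continuousP _ A) cA) _ t01' _ hQ; rewrite /within/= => h.
have c1 : {for t, continuous (fun t : R => 1 - t)}.
  by apply: cvgB; [exact: cvg_cst|exact: cvg_id].
have h2 : nbhs t (fun u : R => `[0, 1]%classic (1 - u) -> Q (A (1 - u))) := c1 _ h.
apply: (@filterS _ (nbhs t) _ _ _ _ h2) => u uQ; rewrite /= in_itv/= => u01.
by apply: uQ; rewrite /= in_itv/=; apply/andP; split; lra.
Qed.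

Lemma reverse_arc_inj A : arc_inj A open_unit_itv ->
  arc_inj (fun t => A (1 - t)) open_unit_itv.
Proof.
move=> iA t u /andP[t0 t1] /andP[u0 u1] E.
suff : 1 - t = 1 - u by move=> ?; lra.
by apply: iA => //; apply/andP; split; lra.
Qed.

Section OneArc.
Variables (A : R -> plane R) (I : set R).
Hypotheses (cA : {within `[0, 1], continuous A}).
Hypotheses (I01 : I `<=` unit_itv) (iA : arc_inj A I).

Lemma arc_closed_left s : s <= 1 -> closed (A @` [set t | 0 <= t <= s]).
Proof.
move=> s1; have := path_image_closed cA (lexx 0) s1.
by congr closed; apply/seteqP; split=> z [t]/=; rewrite in_itv/=; exists t.
Qed.

Lemma arc_closed_right s : 0 <= s -> closed (A @` [set t | s <= t <= 1]).
Proof.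
move=> s0; have := path_image_closed cA s0 (lexx 1).
by congr closed; apply/seteqP; split=> z [t]/=; rewrite in_itv/=; exists t.
Qed.

(** The two sides of [A s] are separated: each closed subarc is compact, and injectivity keeps its
    points off the other side. *)
Lemma arc_split C s : 0 < s < 1 -> connected C -> C `<=` A @` I -> ~ C (A s) ->
  C `<=` A @` [set t | I t /\ t < s] \/ C `<=` A @` [set t | I t /\ s < t].
Proof.
move=> /andP[s0 s1] cC CI Cs.
have sep : separated (A @` [set t | I t /\ t < s]) (A @` [set t | I t /\ s < t]).
  split; apply/seteqP; split=> // z.
    move=> [zc [u [Iu us] uz]].
    have : (A @` [set t | 0 <= t <= s]) z.
      apply: (arc_closed_left (ltW s1)); apply: closure_subset zc.
      move=> _ [t [It ts] <-]; exists t => //; have /andP[t0 t1] := I01 It.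
      by apply/andP; split=> //; apply: ltW.
    move=> [t /andP[t0 ts] tz]; have : t = u.
      by apply: iA => //; [apply/andP; split=> //; lra|rewrite uz].
    by move=> ?; lra.
  move=> [[u [Iu us] uz] zc].
  have : (A @` [set t | s <= t <= 1]) z.
    apply: (arc_closed_right (ltW s0)); apply: closure_subset zc.
    move=> _ [t [It ts] <-]; exists t => //; have /andP[t0 t1] := I01 It.
    by apply/andP; split=> //; apply: ltW.
  move=> [t /andP[t0 ts] tz]; have : t = u.
    by apply: iA => //; [apply/andP; split=> //; lra|rewrite uz].
  by move=> ?; lra.
apply: (connected_subset sep) => // z zC; have [t It tz] := CI z zC.
have [ts|ts|ts] := ltgtP t s; [by left; exists t|by right; exists t|].
by case: Cs; rewrite -ts tz.
Qed.

Lemma arc_interval C a b s : connected C -> C `<=` A @` I -> I a -> I b ->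
  C (A a) -> C (A b) -> a <= s <= b -> C (A s).
Proof.
move=> cC CI Ia Ib Ca Cb /andP[a_s sb].
have /andP[a0 a1] := I01 Ia; have /andP[b0 b1] := I01 Ib.
have [->//|as'] := eqVneq s a; have [->//|bs'] := eqVneq s b.
have {a_s as'}a_s : a < s by rewrite lt_neqAle eq_sym as'.
have {sb bs'}sb : s < b by rewrite lt_neqAle bs'.
apply: contrapT => Cs; have s01 : 0 < s < 1 by apply/andP; split; lra.
have [h|h] := arc_split s01 cC CI Cs.
  have [t [It ts] E] := h _ Cb; have : t = b by apply: iA => //; apply: I01.
  by move=> ?; lra.
have [t [It ts] E] := h _ Ca; have : t = a by apply: iA => //; apply: I01.
by move=> ?; lra.
Qed.

(** The positive product says that s1 and s2 are on the same side of s0. The nearer of the two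
    parameters gives the common point, because connected subsets of an arc are intervals. This is
    what limits an inner point of an arc to two germs. *)
Lemma arc_same_side C1 C2 s0 s1 s2 :
  connected C1 -> connected C2 -> C1 `<=` A @` I -> C2 `<=` A @` I ->
  I s0 -> I s1 -> I s2 -> C1 (A s0) -> C2 (A s0) -> C1 (A s1) -> C2 (A s2) ->
  0 < (s1 - s0) * (s2 - s0) ->
  exists z, [/\ C1 z, C2 z & z <> A s0].
Proof.
move=> c1 c2 C1I C2I I0 I1 I2 C10 C20 C11 C22 side.
have [s10|s10] := leP s1 s0.
  have s20 : s2 < s0 by nra.
  have {}s10 : s1 < s0 by nra.
  exists (A (Num.max s1 s2)); split.
  - apply: (arc_interval c1 C1I I1 I0) => //.
    by rewrite le_max lexx/= ge_max !ltW.
  - apply: (arc_interval c2 C2I I2 I0) => //.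
    by rewrite le_max lexx orbT/= ge_max !ltW.
  - case: (leP s1 s2) => _ E; first by have := iA (I01 I2) I0 E => ?; lra.
    by have := iA (I01 I1) I0 E => ?; lra.
have s20 : s0 < s2 by nra.
exists (A (Num.min s1 s2)); split.
- apply: (arc_interval c1 C1I I0 I1) => //.
  by rewrite ge_min lexx/= le_min !ltW.
- apply: (arc_interval c2 C2I I0 I2) => //.
  by rewrite ge_min lexx orbT/= le_min !ltW.
- case: (leP s1 s2) => _ E; first by have := iA (I01 I1) I0 E => ?; lra.
  by have := iA (I01 I2) I0 E => ?; lra.
Qed.

Lemma path_near g (e : R) (N : set (plane R)) : 0 < e ->
  {within `[0, e], continuous g} -> nbhs (g 0) N ->
  exists d, 0 < d <= e /\ forall t, 0 <= t <= d -> N (g t).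
Proof.
move=> e0 cg hN.
have h0 : `[0, e]%classic (0 : R) by rewrite /= in_itv/= lexx ltW.
have := (proj1 (subspace_continuousP _ g) cg) _ h0 _ hN.
rewrite /within/= => /nbhs_ballP[d /= d0 hd].
exists (Num.min (d / 2) e); split.
  by rewrite lt_min e0 divr_gt0//= ge_min lexx orbT.
move=> t /andP[t0]; rewrite le_min => /andP[td te].
apply: hd; last by rewrite /= in_itv/= t0.
by rewrite -ball_normE/= sub0r normrN ger0_norm//; lra.
Qed.

(** C is a short initial stretch of g. It reaches a second parameter s because g does not return to
    its starting point; the side of s0 on which s lies is the direction of the germ. *)
Lemma germ_in_arc g (e : R) (N : set (plane R)) s0 : 0 < e -> I s0 ->
  {within `[0, e], continuous g} -> g 0 = A s0 ->
  (forall t, 0 < t <= e -> g t <> g 0) ->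
  nbhs (A s0) N -> (forall t, 0 <= t <= e -> N (g t) -> (A @` I) (g t)) ->
  exists C s, [/\ connected C, C `<=` A @` I, C (A s0) /\ C (A s),
    I s /\ s <> s0 & C `<=` g @` [set t | 0 <= t <= e]].
Proof.
move=> e0 I0 cg g0 gi; rewrite -g0 => hN NI.
have [d [/andP[d0 de] hd]] := path_near e0 cg hN.
have dI t : 0 <= t <= d -> (A @` I) (g t).
  move=> /andP[t0 td]; apply: NI; first by apply/andP; split; lra.
  by apply: hd; apply/andP; split.
have [|s Is sE] := dI d; first by rewrite lexx ltW.
exists (g @` [set t | 0 <= t <= d]), s; split.
- apply: (path_image_connected cg).
    by move=> t /= /andP[t0 td]; rewrite in_itv/=; apply/andP; split; lra.
  move=> x y /= /andP[x0 xd] /andP[y0 yd] z /andP[xz zy].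
  by apply/andP; split; lra.
- by move=> _ [t /dI td <-].
- by split; [exists 0 => //=; rewrite lexx ltW|exists d => //=; rewrite lexx ltW].
- split=> // ss0; apply: (gi d); first by rewrite d0.
  by rewrite -sE ss0.
- move=> _ [t /andP[t0 td] <-]; exists t => //.
  by apply/andP; split; lra.
Qed.

End OneArc.

(** If both sets missed [A s], both would stay to the left of it. Neither could stay within [s0, s],
    because its closure has a point off the open arc. So both would extend to the left of s0 and
    share a second point there. *)
Lemma arc_full_right A C1 C2 s0 s z1 z2 : {within `[0, 1], continuous A} ->
  arc_inj A open_unit_itv -> connected C1 -> connected C2 ->
  C1 `<=` A @` open_unit_itv -> C2 `<=` A @` open_unit_itv ->
  0 < s0 < 1 -> s0 < s < 1 ->
  C1 (A s0) -> C2 (A s0) -> (forall z, C1 z -> C2 z -> z = A s0) ->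
  closure C1 z1 -> ~ (A @` open_unit_itv) z1 ->
  closure C2 z2 -> ~ (A @` open_unit_itv) z2 -> C1 (A s) \/ C2 (A s).
Proof.
move=> cA iA c1 c2 C1I C2I s01 /andP[s0s s1] C10 C20 dis z1C z1N z2C z2N.
have /andP[s0p _] := s01.
apply: contrapT => /not_orP[C1s C2s].
have sI : 0 < s < 1 by apply/andP; split=> //; lra.
have left C z : connected C -> C `<=` A @` open_unit_itv -> ~ C (A s) -> C (A s0) ->
    closure C z -> ~ (A @` open_unit_itv) z ->
    exists u, [/\ open_unit_itv u, u < s0 & C (A u)].
  move=> cC CI Cs Cs0 zC zN.
  have [h|h] := arc_split cA open_unit_itv_sub iA sI cC CI Cs; last first.
    have [t [It ts] E] := h _ Cs0; have := iA _ _ (open_unit_itv_sub It) s01 E.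
    by move=> ?; lra.
  apply: contrapT => noU; apply: zN.
  have : (A @` `[s0, s]%classic) z.
    apply: (path_image_closed cA); [lra|lra|].
    apply: closure_subset zC => w wC; have [t [It ts] E] := h _ wC.
    exists t => //=; rewrite in_itv/=; apply/andP; split; last exact: ltW.
    rewrite leNgt; apply/negP => ts0; apply: noU; exists t; split => //.
    by rewrite E.
  move=> [t]; rewrite /= in_itv/= => /andP[t0 t1] <-; exists t => //.
  by apply/andP; split; lra.
have [u1 [u1I u1s C1u]] := left _ _ c1 C1I C1s C10 z1C z1N.
have [u2 [u2I u2s C2u]] := left _ _ c2 C2I C2s C20 z2C z2N.
have [|z [z1' z2' zN]] := arc_same_side cA open_unit_itv_sub iA c1 c2 C1I C2I
  s01 u1I u2I C10 C20 C1u C2u; first by nra.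
exact/zN/dis.
Qed.

Lemma arc_full A C1 C2 s0 s z1 z2 : {within `[0, 1], continuous A} ->
  arc_inj A open_unit_itv -> connected C1 -> connected C2 ->
  C1 `<=` A @` open_unit_itv -> C2 `<=` A @` open_unit_itv ->
  0 < s0 < 1 -> 0 < s < 1 ->
  C1 (A s0) -> C2 (A s0) -> (forall z, C1 z -> C2 z -> z = A s0) ->
  closure C1 z1 -> ~ (A @` open_unit_itv) z1 ->
  closure C2 z2 -> ~ (A @` open_unit_itv) z2 -> C1 (A s) \/ C2 (A s).
Proof.
move=> cA iA c1 c2 C1I C2I s01 s1 C10 C20 dis z1C z1N z2C z2N.
have [ss0|ss0|->] := ltgtP s s0; last by left.
  have rev : (fun t => A (1 - t)) @` open_unit_itv = A @` open_unit_itv.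
    apply/seteqP; split=> z [t /andP[t0 t1] <-].
      by exists (1 - t) => //; apply/andP; split; lra.
    by exists (1 - t); [apply/andP; split; lra|congr A; lra].
  have E u : 1 - (1 - u) = u :> R by lra.
  have := @arc_full_right (fun t => A (1 - t)) C1 C2 (1 - s0) (1 - s) z1 z2.
  rewrite rev !E => full.
  apply: (full (reverse_path_continuous cA) (reverse_arc_inj iA) c1 c2 C1I C2I _ _
    C10 C20 dis z1C z1N z2C z2N); by apply/andP; split; lra.
by apply: (arc_full_right cA iA c1 c2 C1I C2I s01 _ C10 C20 dis z1C z1N z2C z2N);
  apply/andP; split; lra.
Qed.

End Arcs.

(** * Paths covered by finitely many almost disjoint arcs *)

Section ArcSystem.
Context {R : realType} {I : choiceType}.
Variables (D : set I) (A : I -> R -> plane R).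
Hypotheses (fD : finite_set D).
Hypothesis cA : forall i, D i -> {within `[0, 1], continuous (A i)}.
Hypothesis hA : forall i j s t, D i -> D j -> 0 < s < 1 -> 0 <= t <= 1 ->
  A i s = A j t -> i = j /\ s = t.

Definition open_arc i := A i @` open_unit_itv.
Definition closed_arc i := A i @` unit_itv.

Lemma path_closure (g : R -> plane R) (e a b : R) : {within `[0, e], continuous g} ->
  0 <= a < b -> b <= e -> closure (g @` [set t | a < t <= b]) (g a).
Proof.
move=> cg /andP[a0 ab] be Q hQ.
have ha : `[0, e]%classic a by rewrite /= in_itv/=; apply/andP; split; lra.
have := (proj1 (subspace_continuousP _ g) cg) _ ha _ hQ.
rewrite /within/= => /nbhs_ballP[d /= d0 hd].
have m0 : 0 < Num.min (d / 2) (b - a) by rewrite lt_min divr_gt0//=; lra.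
have m1 : Num.min (d / 2) (b - a) <= d / 2 by rewrite ge_min lexx.
have m2 : Num.min (d / 2) (b - a) <= b - a by rewrite ge_min lexx orbT.
exists (g (a + Num.min (d / 2) (b - a))); split.
  by eexists; last reflexivity; apply/andP; split; lra.
apply: hd; last by rewrite /= in_itv/=; apply/andP; split; lra.
by rewrite -ball_normE/= opprD addNKr normrN gtr0_norm//; lra.
Qed.

Lemma arc_inj_system i : D i -> arc_inj (A i) open_unit_itv.
Proof.
by move=> Di t u t01 u01 E; case: (hA Di Di u01 t01 (esym E)).
Qed.

Lemma closed_arc_closed i : D i -> closed (closed_arc i).
Proof.
by move=> Di; have := path_image_closed (cA Di) (lexx 0) (lexx 1); rewrite unit_itvE.
Qed.

Lemma closed_arc_closure i : D i -> closed_arc i `<=` closure (open_arc i).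
Proof.
move=> Di _ [t /andP[t0 t1] <-].
have [t1'|t1'] := ltP t 1.
  have h : closure (A i @` [set u | t < u <= (t + 1) / 2]) (A i t).
    by apply: (path_closure (cA Di)); [apply/andP; split; lra|lra].
  apply: closure_subset h => _ [u /andP[u0 u1] <-]; exists u => //.
  by apply/andP; split; lra.
have -> : t = 1 by lra.
have h : closure ((fun t => A i (1 - t)) @` [set u | 0 < u <= 1 / 2]) (A i (1 - 0)).
  by apply: (path_closure (reverse_path_continuous (cA Di))); [apply/andP; split; lra|lra].
rewrite subr0 in h; apply: closure_subset h => _ [u /andP[u0 u1] <-].
by exists (1 - u) => //; apply/andP; split; lra.
Qed.

(** The other arcs, finite in number, and the two endpoints of arc i form a closed set that misses
    w. *)
Lemma open_arc_near i w : D i -> open_arc i w ->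
  \forall z \near w, (exists2 j, D j & closed_arc j z) -> open_arc i z.
Proof.
move=> Di [s s01 sw].
pose Z := (\bigcup_(j in D `\ i) closed_arc j) `|` [set A i 0] `|` [set A i 1].
have closed_set1 (z : plane R) : closed [set z].
  by apply/accessible_closed_set1/hausdorff_accessible/norm_hausdorff.
have clZ : closed Z.
  apply: closedU; [apply: closedU|].
  - apply: closed_bigcup; first exact: finite_setD.
    by move=> j [Dj _]; apply: closed_arc_closed.
  - exact: closed_set1.
  - exact: closed_set1.
have : nbhs w (~` Z).
  apply: open_nbhs_nbhs; split; first by rewrite openC.
  move=> [[[j [Dj ji] [t t01 E]]|E]|E].
  - by apply: ji; case: (hA Di Dj s01 t01 _) => //; rewrite sw E.
  - have : s = 0 by case: (@hA i i s 0 Di Di s01 _ _) => //; [rewrite lexx ler01|rewrite sw E].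
    by case/andP: s01; lra.
  - have : s = 1 by case: (@hA i i s 1 Di Di s01 _ _) => //; [rewrite lexx ler01|rewrite sw E].
    by case/andP: s01; lra.
apply: filterS => z zZ [j Dj [t /andP[t0 t1] tz]].
have [ji|ji] := pselect (j = i); last first.
  by case: zZ; left; left; exists j => //; exists t => //; apply/andP.
rewrite ji in tz.
exists t => //; apply/andP; split; rewrite lt_neqAle ?t0 ?t1 andbT.
  by apply/eqP => E; apply: zZ; left; right; rewrite -tz -E.
by apply/eqP => E; apply: zZ; right; rewrite -tz E.
Qed.

(** The time a is the supremum of the times up to t0 at which g is off the open arc; it is attained
    because, within the system, being on the open arc is an open condition. *)
Lemma path_enters (g : R -> plane R) i t0 : {within `[0, 1], continuous g} ->
  (forall t, 0 <= t <= 1 -> exists2 j, D j & closed_arc j (g t)) ->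
  D i -> ~ open_arc i (g 0) -> 0 < t0 < 1 -> open_arc i (g t0) ->
  exists a, [/\ 0 <= a < t0, ~ open_arc i (g a) &
    forall t, a < t <= t0 -> open_arc i (g t)].
Proof.
move=> cg cov Di g0 /andP[t00 t01] gt0.
pose N := [set t | 0 <= t <= t0 /\ ~ open_arc i (g t)].
have N0 : N 0 by split => //; rewrite lexx ltW.
have Nub t : N t -> t <= t0 by case=> /andP[].
have Nsup : has_sup N by split; [exists 0|exists t0 => t /Nub].
have supge t : N t -> t <= sup N by move=> Nt; apply: ub_le_sup => //; case: Nsup.
have a0 : 0 <= sup N by apply: supge.
have at0 : sup N <= t0 by apply: ge_sup => //; exists 0.
have aN : ~ open_arc i (g (sup N)).
  move=> ga.
  have ha : `[0, 1]%classic (sup N) by rewrite /= in_itv/=; apply/andP; split; lra.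
  have := (proj1 (subspace_continuousP _ g) cg) _ ha _ (open_arc_near Di ga).
  rewrite /within/= => /nbhs_ballP[d /= d0 hd].
  have [x Nx xd] := sup_adherent d0 Nsup.
  have [/andP[x0 xt0] gx] := Nx.
  apply: gx; apply: hd.
  - rewrite -ball_normE/= ger0_norm ?subr_ge0 ?supge//.
    by rewrite ltrBlDr -ltrBlDl.
  - by rewrite /= in_itv/=; apply/andP; split; lra.
  - by apply: cov; apply/andP; split; lra.
exists (sup N); split=> //.
  rewrite a0 lt_neqAle at0 andbT; apply/eqP => E.
  by apply: aN; rewrite E.
move=> t /andP[at1 tt0]; apply: contrapT => gt.
have : t <= sup N by apply: supge; split=> //; apply/andP; split; lra.
lra.
Qed.

Section Covered.
Variable g : R -> plane R.
Hypotheses (cg : {within `[0, 1], continuous g}).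
Hypothesis ig : forall s t, 0 < s < 1 -> 0 <= t <= 1 -> g s = g t -> s = t.
Hypothesis cov : forall t, 0 <= t <= 1 -> exists2 j, D j & closed_arc j (g t).
Hypothesis ends : forall i, D i -> ~ open_arc i (g 0) /\ ~ open_arc i (g 1).

(** Follow g from t0 backwards and forwards until it leaves the open arc. Injectivity makes the two
    stretches meet only at g(t0), and both end off the open arc, so by [arc_full] they exhaust
    it. *)
Lemma path_runs_through i t0 : D i -> 0 < t0 < 1 -> open_arc i (g t0) ->
  open_arc i `<=` g @` unit_itv.
Proof.
move=> Di t01 gt0; have [e0 e1] := ends Di; have /andP[t00 t0l] := t01.
have [a [/andP[a0 at0] ga hga]] := path_enters cg cov Di e0 t01 gt0.
have crev := reverse_path_continuous cg.
have [||||b' [/andP[b0 bt0] gb hgb]] := @path_enters (fun t => g (1 - t)) i (1 - t0) crev _ Di.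
- by move=> t /andP[? ?]; apply: cov; apply/andP; split; lra.
- by rewrite subr0.
- by apply/andP; split; lra.
- by have -> : 1 - (1 - t0) = t0 by lra.
pose C1 := g @` [set t | a < t <= t0].
pose C2 := (fun t => g (1 - t)) @` [set t | b' < t <= 1 - t0].
have c1 : connected C1.
  apply: (path_image_connected cg).
    by move=> t /andP[? ?]; rewrite /= in_itv/=; apply/andP; split; lra.
  by move=> x y /andP[? ?] /andP[? ?] z /andP[? ?]; apply/andP; split; lra.
have c2 : connected C2.
  apply: (path_image_connected crev).
    by move=> t /andP[? ?]; rewrite /= in_itv/=; apply/andP; split; lra.
  by move=> x y /andP[? ?] /andP[? ?] z /andP[? ?]; apply/andP; split; lra.
have [s0 s01 s0E] := gt0.
move=> _ [s s1 <-].
have s0E' : A i s0 = g (1 - (1 - t0)) by rewrite s0E; congr g; lra.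
have C1I : C1 `<=` open_arc i by move=> _ [t /hga ? <-].
have C2I : C2 `<=` open_arc i by move=> _ [t /hgb ? <-].
have C10 : C1 (A i s0) by exists t0 => //=; rewrite at0 lexx.
have C20 : C2 (A i s0) by exists (1 - t0) => //=; rewrite bt0 lexx.
have dis z : C1 z -> C2 z -> z = A i s0.
  move=> [t /andP[t1 t2] <-] [u /andP[u1 u2]] /esym E.
  have : t = 1 - u by apply: ig => //; apply/andP; split; lra.
  by move=> ?; rewrite s0E; congr g; lra.
have z1C : closure C1 (g a).
  by apply: (path_closure cg); [apply/andP; split|exact: ltW].
have z2C : closure C2 (g (1 - b')).
  by apply: (path_closure crev); [apply/andP; split|lra].
have := arc_full (cA Di) (arc_inj_system Di) c1 c2 C1I C2I s01 s1 C10 C20 dis z1C ga z2C gb.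
case=> [[t /andP[t1 t2] <-]|[t /andP[t1 t2] <-]].
  by exists t => //; apply/andP; split; lra.
by exists (1 - t) => //; apply/andP; split; lra.
Qed.

(** Off the closed union U of the arcs contained in the path, g can only visit endpoints of arcs.
    These are finite in number, so an injective path cannot stay among them on an interval. *)
Lemma path_covered_by_full_arcs t : 0 <= t <= 1 ->
  exists i, [/\ D i, closed_arc i (g t) & closed_arc i `<=` g @` unit_itv].
Proof.
move=> /andP[t0 t1].
have clg : closed (g @` unit_itv).
  by have := path_image_closed cg (lexx 0) (lexx 1); rewrite unit_itvE.
pose D' := [set i | D i /\ closed_arc i `<=` g @` unit_itv].
pose U := \bigcup_(i in D') closed_arc i.
suff [i [Di iU] ti] : U (g t) by exists i.
have clU : closed U.
  apply: closed_bigcup; first by apply: sub_finite_set fD => i [].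
  by move=> i [Di _]; apply: closed_arc_closed.
apply: contrapT => gtU.
have ht : `[0, 1]%classic t by rewrite /= in_itv/= t0.
have hN : nbhs (g t) (~` U) by apply: open_nbhs_nbhs; split => //; rewrite openC.
have := (proj1 (subspace_continuousP _ g) cg) _ ht _ hN.
rewrite /within/= => /nbhs_ballP[d /= d0 hd].
pose W := \bigcup_(i in D) [set A i 0; A i 1].
have fW : finite_set W by apply: bigcup_finite.
have gW u : 0 < u < 1 -> `|t - u| < d -> W (g u).
  move=> /andP[u0 u1] tu.
  have gu : ~ U (g u) by apply: hd => //; rewrite /= in_itv/= !ltW.
  have [|i Di [s /andP[s0 s1] sE]] := cov (t := u); first by rewrite !ltW.
  have [ui|ui] := pselect (open_arc i (g u)).
    have sub : closed_arc i `<=` g @` unit_itv.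
      move=> z /(closed_arc_closure Di) zc; apply: clg.
      by apply: closure_subset zc; apply: (path_runs_through Di _ ui); rewrite u0.
    by case: gu; exists i => //; exists s => //; rewrite /unit_itv/= s0.
  exists i => //; have [E|sn0] := eqVneq s 0; first by left; rewrite -sE E.
  have [E|sn1] := eqVneq s 1; first by right; rewrite -sE E.
  by case: ui; exists s => //; apply/andP; split; rewrite lt_neqAle ?s0 ?s1 andbT// eq_sym.
pose c := Num.max 0 (t - d); pose e := Num.min 1 (t + d).
have c0 : 0 <= c by rewrite le_max lexx.
have ctd : t - d <= c by rewrite le_max lexx orbT.
have e1 : e <= 1 by rewrite ge_min lexx.
have etd : e <= t + d by rewrite ge_min lexx orbT.
have ce : c < e by rewrite lt_min !gt_max; apply/andP; split; apply/andP; split; lra.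
(* Infinitely many parameters strictly inside (c, e); the denominator starts at 2 so that e itself
   is not hit. *)
pose f (n : nat) := c + (e - c) / n.+2%:R.
have fb n : c < f n < e.
  have h1 : 0 < (e - c) / n.+2%:R by rewrite divr_gt0// subr_gt0.
  have h2 : (e - c) / n.+2%:R < e - c.
    by rewrite ltr_pdivrMr// ltr_pMr ?subr_gt0// ltr1n.
  by rewrite /f; move: (_ / _) h1 h2 => x h1 h2; apply/andP; split; lra.
have f01 n : 0 < f n < 1 by have /andP[? ?] := fb n; apply/andP; split; lra.
apply: infinite_nat.
have : finite_set ((g \o f) @^-1` W).
  apply: finite_preimage => // m n _ _ /= E.
  have /addrI/(mulfI _) : f m = f n.
    by apply: ig => //; apply/andP; have /andP[? ?] := f01 n; split; lra.
  rewrite subr_eq0 gt_eqF// => /(_ isT)/invr_inj/eqP.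
  by rewrite eqr_nat => /eqP[].
apply: sub_finite_set => n _; apply: gW => //.
by have /andP[? ?] := fb n; rewrite ltr_norml; apply/andP; split; lra.
Qed.

End Covered.
End ArcSystem.

(** * Geometric graphs *)

Section GeometricGraphs.
Context {R : realType} {K : cgraph}.
Implicit Types (B C : geom_graph R K) (e : edge K) (v : vert K).

(* (e, false) is the half of e at its source, (e, true) the half at its target. *)
Definition half_edge (L : cgraph) : finType := (edge L * bool)%type.

Definition hsrc (h : half_edge K) : vert K := if h.2 then tgt h.1 else src h.1.

Definition hpath B (h : half_edge K) (t : R) : plane R :=
  epath B h.1 (if h.2 then 1 - t else t).

Lemma degree_half_edges v :
  degree (@src K) (@tgt K) v = #|[pred h : half_edge K | hsrc h == v]|.
Proof.
rewrite /degree -!sum1_card.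
rewrite [RHS](eq_bigl (fun h : half_edge K => true && (hsrc (h.1, h.2) == v))); last by case.
rewrite -(pair_big_dep predT (fun e b => hsrc (e, b) == v) (fun _ _ => 1%N)).
rewrite [X in (X + _)%N]big_mkcond [X in (_ + X)%N]big_mkcond -big_split/=.
by apply: eq_bigr => e _; rewrite big_mkcond big_bool/= addnC.
Qed.

Lemma hpath0 B h : hpath B h 0 = vpos B (hsrc h).
Proof.
rewrite /hpath /hsrc; case: h.2; first by rewrite subr0 epath1.
by rewrite epath0.
Qed.

Lemma hpath1 B h : hpath B h 1 = vpos B (hsrc (h.1, ~~ h.2)).
Proof.
rewrite /hpath /hsrc/=; case: h.2 => /=; first by rewrite subrr epath0.
by rewrite epath1.
Qed.

Lemma hpath_continuous B h : {within `[0, 1], continuous (hpath B h)}.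
Proof.
rewrite /hpath; case: h.2; last exact: epath_continuous.
exact/reverse_path_continuous/epath_continuous.
Qed.

Lemma hpath_eq B h h' t u : 0 < t < 1 -> 0 <= u <= 1 ->
  hpath B h t = hpath B h' u ->
  h.1 = h'.1 /\ (if h.2 then 1 - t else t) = (if h'.2 then 1 - u else u).
Proof.
move=> /andP[t0 t1] /andP[u0 u1]; apply: epath_inj.
  by case: h.2; apply/andP; split; lra.
by case: h'.2; apply/andP; split; lra.
Qed.

Lemma hpath_neq0 B h t : 0 < t < 1 -> hpath B h t <> hpath B h 0.
Proof.
move=> t01 E; have z01 : 0 <= (0 : R) <= 1 by rewrite lexx ler01.
by have [_] := hpath_eq t01 z01 E; case/andP: t01 {E}; case: h.2 => ? ? ?; lra.
Qed.

(** The bound 1/4 keeps the two halves of a single edge apart; only one parameter must be positive,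
    since half-edges may start at the same vertex. *)
Lemma hpath_disjoint B h h' t u : h != h' -> 0 < t <= 1 / 4 -> 0 <= u <= 1 / 4 ->
  hpath B h t <> hpath B h' u.
Proof.
move=> /eqP hh' /andP[t0 t1] /andP[u0 u1] E.
have t01 : 0 < t < 1 by apply/andP; split; lra.
have u01 : 0 <= u <= 1 by apply/andP; split; lra.
have [E1] := hpath_eq t01 u01 E; move: hh'; case: h h' E1 {E} => [e b] [e' b'] /= ->.
by case: b b' => -[] hh E2; (try by apply: hh); lra.
Qed.

(** The embedding axioms compare points of edges only, so v is first written as an end of some edge,
    which exists because its degree is nonzero. *)
Lemma vpos_not_interior B v e (s : R) : 0 < s < 1 -> epath B e s <> vpos B v.
Proof.
move=> s01 E; have : #|[pred h : half_edge K | hsrc h == v]| != 0%N.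
  by rewrite -degree_half_edges degree_neq0.
rewrite -lt0n => /card_gt0P[h]; rewrite inE => /eqP hv.
have E' : hpath B (e, false) s = hpath B h 0 by rewrite hpath0 hv -E.
have u01 : 0 <= (0 : R) <= 1 by rewrite lexx ler01.
have [_ /= h0] := hpath_eq s01 u01 E'.
by move: h0; case: h.2 => ?; case/andP: s01; lra.
Qed.

Lemma earc_closed B e : closed (earc B e).
Proof. exact: (path_image_closed (@epath_continuous _ _ B e) (lexx 0) (lexx 1)). Qed.

Lemma earcE B e : earc B e = epath B e @` unit_itv.
Proof. by rewrite /earc unit_itvE. Qed.

Lemma earc_hpath B h : earc B h.1 = hpath B h @` unit_itv.
Proof.
rewrite earcE /hpath; case: h.2 => //; apply/seteqP; split=> z [t /andP[t0 t1] <-].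
  by exists (1 - t); [apply/andP; split; lra|congr (epath B _ _); lra].
by exists (1 - t) => //; apply/andP; split; lra.
Qed.

(** The coincidences between edge points are dictated by the combinatorial graph; this makes
    [gg_map] independent of the edge and parameter chosen. *)
Lemma epath_eq_end B C e f (s t : R) : 0 <= s <= 1 -> 0 <= t <= 1 ->
  epath B e s = epath B f t -> epath C e s = epath C f t.
Proof.
move=> s01 t01 E.
have [si|si] := boolP (0 < s < 1); first by have [-> ->] := epath_inj si t01 E.
have [ti|ti] := boolP (0 < t < 1).
  by have [-> ->] := epath_inj ti s01 (esym E).
have end_vpos (u : R) : 0 <= u <= 1 -> ~~ (0 < u < 1) -> forall g, exists v,
    forall L : geom_graph R K, epath L g u = vpos L v.
  move=> /andP[u0 u1] ui g; have [u00|u00] := eqVneq u 0.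
    by exists (src g) => L; rewrite u00 epath0.
  have [u11|u11] := eqVneq u 1; first by exists (tgt g) => L; rewrite u11 epath1.
  by case/negP: ui; rewrite !lt_neqAle u0 u1 u11 eq_sym u00.
have [v hv] := end_vpos s s01 si e; have [w hw] := end_vpos t t01 ti f.
by move: E; rewrite !hv !hw => /vpos_inj ->.
Qed.

Lemma gg_map_epath B C e (s : R) : 0 <= s <= 1 ->
  gg_map B C (epath B e s) = epath C e s.
Proof.
move=> s01; rewrite /gg_map.
have : exists w, [set w | exists e' t,
    [/\ 0 <= t <= 1, epath B e s = epath B e' t & w = epath C e' t]] w.
  by exists (epath C e s), e, s.
move=> /(xgetPex (epath B e s))[f [t [t01 E ->]]].
by rewrite (epath_eq_end C s01 t01 E).
Qed.

Lemma gg_map_earc B C e : gg_map B C @` earc B e = earc C e.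
Proof.
rewrite !earcE; apply/seteqP; split=> [_ [_ [s s01 <-] <-]|_ [s s01 <-]].
  by rewrite gg_map_epath//; exists s.
by exists (epath B e s); [exists s|rewrite gg_map_epath].
Qed.

End GeometricGraphs.

Lemma jordan_curve_two_germs (R : realType) (J : set (plane R)) (w : plane R) :
  jordan_curve J -> J w -> exists g1 g2 (e : R), 0 < e /\
  [/\ {within `[0, e], continuous g1}, {within `[0, e], continuous g2},
    g1 0 = w /\ g2 0 = w,
    forall t, 0 <= t <= e -> J (g1 t) /\ J (g2 t) &
    (forall t, 0 < t <= e -> g1 t <> w /\ g2 t <> w) /\
    (forall t u, 0 < t <= e -> 0 < u <= e -> g1 t <> g2 u)].
Proof.
move=> [f [cf f01 fi ->]] [s0]; rewrite /= in_itv/= => /andP[s00 s01] sw.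
have [s0i|s0i] := boolP (0 < s0 < 1).
  have /andP[a0 a1] := s0i.
  pose e := Num.min s0 (1 - s0) / 2.
  have m0 : 0 < Num.min s0 (1 - s0) by rewrite lt_min a0; lra.
  have m1 : Num.min s0 (1 - s0) <= s0 by rewrite ge_min lexx.
  have m2 : Num.min s0 (1 - s0) <= 1 - s0 by rewrite ge_min lexx orbT.
  have e0 : 0 < e by rewrite /e; lra.
  have ea : e < s0 by rewrite /e; lra.
  have eb : e < 1 - s0 by rewrite /e; lra.
  have cg (a : R) : a = 1 \/ a = -1 -> {within `[0, e], continuous (fun t => f (s0 + a * t))}.
    move=> ha; apply/subspace_continuousP => t; rewrite /= in_itv/= => /andP[t0 t1] Q hQ.
    have hs (u : R) : 0 <= u <= e -> `[0, 1]%classic (s0 + a * u).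
      move=> /andP[? ?]; rewrite /= in_itv/=.
      by case: ha => ->; apply/andP; split; lra.
    have := (proj1 (subspace_continuousP _ f) cf) _ (hs t _) _ hQ.
    rewrite t0 t1 /within/= => /(_ isT) h.
    have c1 : {for t, continuous (fun t : R => s0 + a * t)}.
      by apply: cvgD; [exact: cvg_cst|apply: cvgM; [exact: cvg_cst|exact: cvg_id]].
    have h2 : nbhs t (fun u : R => `[0, 1]%classic (s0 + a * u) -> Q (f (s0 + a * u))) := c1 _ h.
    apply: (@filterS _ (nbhs t) _ _ _ _ h2) => u uQ; rewrite /= in_itv/= => u01.
    by apply: uQ; apply: hs.
  exists (fun t => f (s0 + 1 * t)), (fun t => f (s0 + -1 * t)), e; split; [exact: e0|split].
  - by apply: cg; left.
  - by apply: cg; right.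
  - by rewrite !mulr0 addr0.
  - move=> t /andP[t0 t1]; split.
      by exists (s0 + 1 * t) => //; rewrite /= in_itv/=; apply/andP; split; lra.
    by exists (s0 + -1 * t) => //; rewrite /= in_itv/=; apply/andP; split; lra.
  split.
    move=> t /andP[t0 t1]; rewrite -sw; split=> E.
      suff : s0 + 1 * t = s0 by lra.
      by apply: fi => //; apply/andP; split; lra.
    suff : s0 + -1 * t = s0 by lra.
    by apply: fi => //; apply/andP; split; lra.
  move=> t u /andP[t0 t1] /andP[u0 u1] E.
  suff : s0 + 1 * t = s0 + -1 * u by lra.
  by apply: fi => //; apply/andP; split; lra.
(* At the base point of the loop, one germ is the start of f and the other its end run backwards;
   quarters of the parameter interval keep them apart. *)
have f0w : f 0 = w.
  have [s00'|s00'] := eqVneq s0 0; first by rewrite -sw s00'.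
  have [s11|s11] := eqVneq s0 1; first by rewrite f01 -sw s11.
  by case/negP: s0i; rewrite !lt_neqAle s00 s01 s11 eq_sym s00'.
have sub : `[0, 1 / 4]%classic `<=` `[0, 1 : R]%classic.
  by move=> t; rewrite /= !in_itv/= => /andP[? ?]; apply/andP; split; lra.
exists f, (fun t => f (1 - t)), (1 / 4); split; first lra.
split.
- exact: continuous_subspaceW cf.
- exact: continuous_subspaceW (reverse_path_continuous cf).
- by rewrite subr0 -f01.
- move=> t /andP[t0 t1]; split.
    by exists t => //; rewrite /= in_itv/=; apply/andP; split; lra.
  by exists (1 - t) => //; rewrite /= in_itv/=; apply/andP; split; lra.
split.
  move=> t /andP[t0 t1]; rewrite -f0w; split=> E.
    suff : t = 0 by lra.
    by apply: fi => //; apply/andP; split; lra.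
  suff : 1 - t = 0 by lra.
  by apply: fi => //; apply/andP; split; lra.
move=> t u /andP[t0 t1] /andP[u0 u1] E.
suff : t = 1 - u by lra.
by apply: fi => //; apply/andP; split; lra.
Qed.

(** * Edges of S as unions of whole edges of R(G) *)

Section GraphsInTiling.
Context {R : realType} {P : finType}.
Variables (supp : P -> set (plane R)) (T : set (@tile R P)) (lam : R).
Variable K : P -> cgraph.
Variables G S : forall p, geom_graph R (K p).
Hypotheses (hP : prototile_set supp) (hT : tiling supp T).
Hypothesis hsim : self_similar supp T lam.
Hypothesis hGS : recurrent_pair supp T lam G S.
Hypothesis hTG : bounds_tiling T G.

Let lam_gt1 : 1 < lam. Proof. by case: hsim. Qed.
Let lam_gt0 : 0 < lam. Proof. exact: lt_trans lam_gt1. Qed.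
Let lam_neq0 : lam != 0. Proof. exact: lt0r_neq0. Qed.

Let G_on : graph_on supp G. Proof. by case: hGS => -[]. Qed.

Lemma not_boundary_vertex_interior (B : forall p, geom_graph R (K p)) p v :
  graph_on supp B -> ~ boundary_vertex supp B v -> (supp p)° (vpos (B p) v).
Proof.
move=> Bon nb; apply: contrapT => ni; apply: nb; split=> //.
apply: subset_closure; apply: Bon.
have : degree (@src (K p)) (@tgt (K p)) v != 0%N by apply: degree_neq0.
rewrite degree_half_edges -lt0n => /card_gt0P[h]; rewrite inE => /eqP hv.
exists h.1 => //; rewrite earc_hpath; exists 0; last by rewrite hpath0 hv.
by rewrite /unit_itv/= lexx ler01.
Qed.

Lemma edge_interior p (e : edge (K p)) (s : R) : 0 < s < 1 ->
  (supp p)° (epath (G p) e s).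
Proof.
move=> s01; have [[_ [Gcons _]] _ _ _] := hGS.
have eG : gsupp (G p) (epath (G p) e s).
  exists e => //; rewrite earcE; exists s => //.
  exact: open_unit_itv_sub.
apply: contrapT => ni.
have [|v _ E] := Gcons p _ eG.
  by split => //; apply: subset_closure; apply: G_on.
exact: (vpos_not_interior s01 E).
Qed.

Lemma Gamma_near p x z : T (p, x) -> (supp p)° (z - x) ->
  \forall w \near z, Gamma T G w -> gsupp (G p) (w - x).
Proof.
move=> Tx zp; have : nbhs z (tsupp supp (p, x))°.
  by apply: open_nbhs_nbhs; split; [exact: open_interior|rewrite interior_translate].
apply: filterS => w wp [u Tu]; rewrite translateE => wu.
have [E|pxu] := pselect ((p, x) = u); first by rewrite -E in wu.
have /seteqP[/(_ w) h _] := tsupp_interior_disjoint hP hT Tx Tu pxu.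
case: h; split=> //; rewrite /tsupp translateE; exact: G_on.
Qed.

(* A vertex of degree one inside a tile could not lie on a Jordan curve. *)
Lemma interior_vertex_degree p (v : vert (K p)) : ~ boundary_vertex supp G v ->
  degree (@src (K p)) (@tgt (K p)) v != 1%N.
Proof.
move=> nb; apply/negP; rewrite degree_half_edges => /eqP d1.
have [h hE] : exists h, [pred h : half_edge (K p) | hsrc h == v] =i pred1 h.
  by apply/card1P/eqP.
have hv : hsrc h = v by apply/eqP; have := hE h; rewrite !inE eqxx => ->.
have huniq h' : hsrc h' = v -> h' = h.
  by move=> h'v; apply/eqP; have := hE h'; rewrite !inE h'v eqxx => <-.
have [_ _ _ /(_ p)[x Tx]] := hT.
have [J [Jc JG _]] := hTG Tx h.1; set w := vpos (G p) v + x => eJ.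
have wJ : J w.
  apply: eJ; rewrite translateE/= addrK earc_hpath; exists 0.
    by rewrite /unit_itv/= lexx ler01.
  by rewrite hpath0 hv.
have [g1 [g2 [e [e0 [cg1 cg2 [g10 g20] gJ [gw g12]]]]]] := jordan_curve_two_germs Jc wJ.
pose A t := hpath (G p) h t + x.
have tE (t u : R) : 0 <= t <= 1 -> 0 <= u < 1 -> hpath (G p) h t = hpath (G p) h u -> t = u.
  move=> t01 /andP[u0 u1] E.
  have [ui|ui] := boolP (0 < u < 1).
    by have [_] := hpath_eq ui t01 (esym E); case: h.2 => ?; lra.
  have u00 : u = 0 by apply/eqP; move: ui; rewrite u1 andbT lt_neqAle u0 andbT negbK eq_sym.
  have [ti|ti] := boolP (0 < t < 1).
    have u01 : 0 <= u <= 1 by rewrite u0 ltW.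
    by have [_] := hpath_eq ti u01 E; case: h.2 => ?; lra.
  have [//|tn0] := eqVneq t 0; first by move=> ->.
  have t1 : t = 1.
    apply/eqP; apply: contraR ti => tn1; move/andP: t01 => [t0 t1].
    by rewrite !lt_neqAle t0 t1 tn1 eq_sym tn0.
  move: E; rewrite t1 u00 hpath0 hpath1 => /vpos_inj E.
  (* If both ends of the edge were v, its other half would be a second half-edge at v. *)
  have := huniq (h.1, ~~ h.2); rewrite E hv => /(_ erefl)/(congr1 snd)/=.
  by case: h.2.
(* The parameter 0 must be included, as the germs start at v; the far end is left out because other
   edges may meet there. *)
pose I := [set t : R | 0 <= t < 1].
have I01 : I `<=` unit_itv by move=> t /andP[t0 t1]; rewrite /unit_itv/= t0 ltW.
have iA : arc_inj A I by move=> t u t01 uI /addIr; apply: tE.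
have cA : {within `[0, 1], continuous A}.
  apply: (@within_continuous_comp _ _ _ _ (hpath (G p) h) (fun z => z + x)).
    move=> z _; have := @affine_continuous R 1 x z.
    by under [X in continuous_at _ X -> _]funext do rewrite scale1r.
  exact: hpath_continuous.
pose N z := Gamma T G z -> (A @` I) z.
have hN : nbhs (A 0) N.
  pose Z := (\bigcup_(f in [set f | f != h.1]) earc (G p) f) `|` [set hpath (G p) h 1].
  have clZ : closed Z.
    apply: closedU; last by apply/accessible_closed_set1/hausdorff_accessible/norm_hausdorff.
    apply: closed_bigcup; first exact: finite_finset.
    by move=> f _; apply: earc_closed.
  have nZ : ~ Z (hpath (G p) h 0).
    rewrite hpath0 hv => -[[f fh]|].
      rewrite earcE => -[s /andP[s0 s1] sE].
      have [si|si] := boolP (0 < s < 1); first exact: vpos_not_interior si sE.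
      have [s00|sn0] := eqVneq s 0.
        move: sE; rewrite s00 epath0 => /vpos_inj fv.
        by move/negP: fh; apply; rewrite -(huniq (f, false) fv).
      have s11 : s = 1.
        apply/eqP; apply: contraR si => sn1.
        by rewrite !lt_neqAle s0 s1 sn1 eq_sym sn0.
      move: sE; rewrite s11 epath1 => /vpos_inj fv.
      by move/negP: fh; apply; rewrite -(huniq (f, true) fv).
    rewrite /= -hv -hpath0 => E.
    have E10 : 1 = 0 :> R by apply: tE (esym E); rewrite ?lexx ?ler01 ?ltr01.
    by have := oner_neq0 R; rewrite E10 eqxx.
  have n1 : \forall z \near A 0, ~ Z (z - x).
    apply: open_nbhs_nbhs; split; last by rewrite /A addrK.
    have := @closed_translate _ _ x clZ; rewrite -openC; congr open.
    by apply/seteqP; split=> z; rewrite /setC/= translateE.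
  have n2 : \forall z \near A 0, Gamma T G z -> gsupp (G p) (z - x).
    apply: Gamma_near => //; rewrite /A addrK hpath0 hv.
    exact: not_boundary_vertex_interior.
  apply: filterS2 n1 n2 => z nz hz /hz[f _ fz].
  have fh : f = h.1.
    by apply/eqP; apply/negPn/negP => fh; apply: nz; left; exists f.
  rewrite fh earc_hpath in fz; have [t /andP[t0 t1] tz] := fz.
  exists t; last by rewrite /A tz subrK.
  rewrite /I/= t0 lt_neqAle t1 andbT; apply/eqP => t11; apply: nz; right.
  by rewrite -t11 tz.
have I0 : I 0 by rewrite /I/= lexx ltr01.
have A0 : A 0 = w by rewrite /A hpath0 hv.
have [|||C1 [s1 [c1 C1I [C10 C1s] [I1 s10] C1g]]] :=
  @germ_in_arc R A I g1 e N 0 e0 I0 cg1 _ _ hN.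
- by rewrite A0.
- by rewrite g10 => t /gw[].
- by move=> t /gJ[/JG ? _]; apply.
have [|||C2 [s2 [c2 C2I [C20 C2s] [I2 s20] C2g]]] :=
  @germ_in_arc R A I g2 e N 0 e0 I0 cg2 _ _ hN.
- by rewrite A0.
- by rewrite g20 => t /gw[].
- by move=> t /gJ[_ /JG ?]; apply.
have [|z [z1 z2 zw]] := arc_same_side cA I01 iA c1 c2 C1I C2I I0 I1 I2 C10 C20 C1s C2s.
  rewrite !subr0 mulr_gt0// lt_neqAle.
    by case/andP: I1 => -> _; rewrite andbT; apply/eqP/nesym.
  by case/andP: I2 => -> _; rewrite andbT; apply/eqP/nesym.
have [t /andP[t0 te] tz] := C1g _ z1; have [u /andP[u0 ue] uz] := C2g _ z2.
rewrite A0 in zw.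
apply: (g12 t u); last by rewrite tz uz.
- rewrite te andbT lt_neqAle t0 andbT; apply/eqP => t00.
  by apply: zw; rewrite -tz -t00.
- rewrite ue andbT lt_neqAle u0 andbT; apply/eqP => u00.
  by apply: zw; rewrite -uz -u00.
Qed.


Definition piece : choiceType := (gedge K * plane R)%type.

(** A pair (f, d) stands for the edge lam^-1 (f + d) of R(G)_p. *)
Definition pieces (p : P) : set piece := [set i | digits supp T lam p (tag i.1) i.2].

Definition piece_path (i : piece) (t : R) : plane R :=
  lam^-1 *: (epath (G (tag i.1)) (tagged i.1) t + i.2).

Lemma finite_pieces p : finite_set (pieces p).
Proof.
have : finite_set (\bigcup_(f in [set: gedge K])
    [set (f, d) | d in digits supp T lam p (tag f)]).
  apply: bigcup_finite; first exact: finite_finset.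
  by move=> f _; apply: finite_image; apply: finite_digits.
by apply: sub_finite_set => -[f d] fd; exists f => //; exists d.
Qed.

Lemma piece_path_continuous i : {within `[0, 1], continuous (piece_path i)}.
Proof.
apply: (@within_continuous_comp _ _ _ _ (epath (G (tag i.1)) (tagged i.1))
  (fun z => lam^-1 *: (z + i.2))); last exact: epath_continuous.
move=> z _; have := @affine_continuous R lam^-1 (lam^-1 *: i.2) z.
by under [X in continuous_at _ X -> _]funext do rewrite -scalerDr.
Qed.

Lemma closed_arc_piece i :
  closed_arc piece_path i = scale lam^-1 (translate (earc (G (tag i.1)) (tagged i.1)) i.2).
Proof.
rewrite /closed_arc earcE; apply/seteqP; split=> z.
  move=> [t t01 <-]; exists (epath (G (tag i.1)) (tagged i.1) t + i.2) => //.
  by exists (epath (G (tag i.1)) (tagged i.1) t) => //; exists t.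
by move=> [_ [_ [t t01 <-] <-] <-]; exists t.
Qed.

(** In two different subtiles, an inner point of one edge is interior to its subtile, which the
    other subtile avoids; in a single subtile this is the embedding property of G. *)
Lemma pieces_disjoint p i j (s t : R) : pieces p i -> pieces p j ->
  0 < s < 1 -> 0 <= t <= 1 -> piece_path i s = piece_path j t -> i = j /\ s = t.
Proof.
move=> Di Dj s01 t01 /(congr1 ( *:%R lam)).
rewrite !scalerA mulfV// !scale1r => E.
have [qd|qd] := pselect ((tag i.1, i.2) = (tag j.1, j.2)).
  case: i j Di Dj E qd => [[q e] d] [[q' f] d'] /= Di Dj E [qq dd].
  case: q' / qq in f Dj E *; rewrite -dd in E *.
  by move/addIr: E => /(epath_inj s01 t01)[-> ->].
have /seteqP[/(_ (epath (G (tag i.1)) (tagged i.1) s + i.2)) h _] :=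
  digits_disjoint hP hT hsim Di Dj qd.
case: h; split; first by rewrite interior_translate addrK; apply: edge_interior.
rewrite E translateE addrK; apply: G_on; exists (tagged j.1) => //.
by rewrite earcE; exists t.
Qed.

Lemma open_piece_interior p i z : pieces p i -> open_arc piece_path i z ->
  (supp p)° z.
Proof.
move=> Di [s s01 <-].
have sub := digits_sub hP hT hsim Di.
have : (translate (supp (tag i.1)) i.2)° (lam *: piece_path i s).
  rewrite /piece_path scalerA mulfV// scale1r interior_translate addrK.
  exact: edge_interior.
move=> /(interiorS sub)/(interior_scale _ _ lam_neq0); rewrite scalerA (mulVf lam_neq0) scale1r.
exact.
Qed.

Lemma pieces_cover p z : gsupp (S p) z ->
  exists2 i, pieces p i & closed_arc piece_path i z.
Proof.
have [_ _ Ssub _] := hGS.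
move=> zS; have [q _ [d dd [_ [y [e _ ey] <-] <-]]] := Ssub p z zS.
exists (existT (fun p => edge (K p)) q e, d) => //.
rewrite closed_arc_piece/=; exists (y + d) => //; by exists y.
Qed.

(** Near an inner point of a piece, S_p can only run along that piece. Once the boundary and degree
    one are excluded, three half-edges at v would give three germs in an arc with two sides. *)
Lemma vertex_not_in_open_piece p (v : vert (K p)) i : pieces p i ->
  ~ open_arc piece_path i (vpos (S p) v).
Proof.
move=> Di vi; have vint := open_piece_interior Di vi.
have nbS : ~ boundary_vertex supp S v by case.
have nbG : ~ boundary_vertex supp G v.
  by have [_ _ _ /(_ p v)[h _]] := hGS; rewrite h.
have d1 := interior_vertex_degree nbG.
have d0 := degree_neq0 v; have d2 := degree_neq2 v.
have : (2 < #|[pred h : half_edge (K p) | hsrc h == v]|)%N.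
  rewrite -degree_half_edges; move: d0 d1 d2.
  by case: (degree _ _ _) => [|[|[|n]]].
move=> /card_gt2P[h1 [h2 [h3 [[]]]]].
rewrite !inE => /eqP h1v /eqP h2v /eqP h3v [h12 h23 h31].
have [s0 s01 s0E] := vi.
pose A := piece_path i.
have cA : {within `[0, 1], continuous A} by exact: piece_path_continuous.
have iA : arc_inj A open_unit_itv.
  by move=> t u t01 u01 E; case: (pieces_disjoint Di Di u01 t01 (esym E)).
pose N z := (exists2 j, pieces p j & closed_arc piece_path j z) -> open_arc piece_path i z.
have hN : nbhs (A s0) N.
  rewrite /A s0E; apply: (open_arc_near (@finite_pieces p)); [| |exact: Di|exact: vi].
    by move=> j _; apply: piece_path_continuous.
  by move=> j k s t Dj Dk; apply: pieces_disjoint Dj Dk.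
have germ h : hsrc h = v -> exists C s, [/\ connected C, C `<=` A @` open_unit_itv,
    C (A s0) /\ C (A s), open_unit_itv s /\ s <> s0 &
    C `<=` hpath (S p) h @` [set t | 0 <= t <= 1 / 4]].
  move=> hv; have e0 : 0 < 1 / 4 :> R by lra.
  apply: (germ_in_arc e0 s01 _ _ _ hN).
  - apply: continuous_subspaceW (@hpath_continuous _ _ (S p) h).
    by move=> t; rewrite /= !in_itv/= => /andP[? ?]; apply/andP; split; lra.
  - by rewrite hpath0 hv /A s0E.
  - move=> t /andP[t0 t1] E.
    by apply: (hpath_neq0 _ E); apply/andP; split; lra.
  - move=> t /andP[t0 t1]; apply; apply: pieces_cover.
    exists h.1 => //; rewrite earc_hpath; exists t => //.
    by apply/andP; split; lra.
have vE h : hsrc h = v -> hpath (S p) h 0 = A s0 by move=> hv; rewrite hpath0 hv /A s0E.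
have clash h h' C C' s s' : h != h' -> hsrc h = v -> hsrc h' = v ->
    connected C -> connected C' ->
    C `<=` A @` open_unit_itv -> C' `<=` A @` open_unit_itv ->
    C (A s0) -> C' (A s0) -> C (A s) -> C' (A s') ->
    open_unit_itv s -> open_unit_itv s' ->
    C `<=` hpath (S p) h @` [set t | 0 <= t <= 1 / 4] ->
    C' `<=` hpath (S p) h' @` [set t | 0 <= t <= 1 / 4] ->
    0 < (s - s0) * (s' - s0) -> False.
  move=> hh' hv h'v cC cC' CI C'I C0 C0' Cs Cs' sI s'I Ch C'h side.
  have [z [zC zC' zn]] := arc_same_side cA open_unit_itv_sub iA cC cC' CI C'I
    s01 sI s'I C0 C0' Cs Cs' side.
  have [t /andP[t0 t1] tz] := Ch _ zC; have [u /andP[u0 u1] uz] := C'h _ zC'.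
  apply: (hpath_disjoint hh' _ _ (etrans tz (esym uz))); last by rewrite u0.
  rewrite t1 andbT lt_neqAle t0 andbT; apply/eqP => t00; apply: zn.
  by rewrite -tz -t00 vE.
have [C1 [s1 [c1 C1I [C10 C1s] [I1 n1] C1h]]] := germ _ h1v.
have [C2 [s2 [c2 C2I [C20 C2s] [I2 n2] C2h]]] := germ _ h2v.
have [C3 [s3 [c3 C3I [C30 C3s] [I3 n3] C3h]]] := germ _ h3v.
(* Among three nonzero reals two have the same sign, so two germs leave on the same side. *)
have nz (x y z : R) : x != 0 -> y != 0 -> z != 0 ->
    [\/ 0 < x * y, 0 < y * z | 0 < z * x].
  move=> /lt_total/orP[x0|x0] /lt_total/orP[y0|y0] /lt_total/orP[z0|z0].
  - by apply: Or31; nra.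
  - by apply: Or31; nra.
  - by apply: Or33; nra.
  - by apply: Or32; nra.
  - by apply: Or32; nra.
  - by apply: Or33; nra.
  - by apply: Or31; nra.
  - by apply: Or31; nra.
have sn s : s <> s0 -> s - s0 != 0 by move=> /eqP; rewrite subr_eq0.
have [side|side|side] := nz _ _ _ (sn _ n1) (sn _ n2) (sn _ n3).
- exact: (clash h1 h2 C1 C2 s1 s2).
- exact: (clash h2 h3 C2 C3 s2 s3).
- exact: (clash h3 h1 C3 C1 s3 s1).
Qed.

Lemma edge_decomposition p (e : edge (K p)) z : earc (S p) e z ->
  exists i, [/\ pieces p i, closed_arc piece_path i z &
    closed_arc piece_path i `<=` earc (S p) e].
Proof.
rewrite earcE => -[t t01 <-].
apply: (path_covered_by_full_arcs (@finite_pieces p)) t01.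
- by move=> i _; apply: piece_path_continuous.
- by move=> i j s t' Di Dj; apply: pieces_disjoint Di Dj.
- exact: epath_continuous.
- by move=> s t' s01 t01 /(epath_inj s01 t01)[].
- by move=> u u01; apply: pieces_cover; exists e => //; rewrite earcE; exists u.
- by move=> i Di; rewrite epath0 epath1; split; apply: vertex_not_in_open_piece.
Qed.


End GraphsInTiling.

(** * The limit of the iterates of psi *)

Section GeometricConvergence.
Context {R : realType}.

(** With C = B / (1 - q), the tail of the series after n is C q^n, so a_n - C q^n increases while
    a_n + C q^n decreases. *)
Lemma geometric_cvg_real (a : nat -> R) (B q : R) : 0 < q < 1 ->
  (forall n, `|a n.+1 - a n| <= B * q ^+ n) ->
  exists2 l, a n @[n --> \oo] --> l & `|l - a 0%N| <= B / (1 - q).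
Proof.
move=> /andP[q0 q1] ha; pose C := B / (1 - q).
have q10 : 1 - q != 0 by apply: lt0r_neq0; lra.
have BE : B = C * (1 - q) by rewrite /C divfK.
have B0 : 0 <= B by have := ha 0%N; rewrite expr0 mulr1; apply: le_trans.
have C0 : 0 <= C by rewrite divr_ge0//; lra.
pose c n := a n - C * q ^+ n.
have qn n : 0 <= q ^+ n by rewrite exprn_ge0// ltW.
have step n : c n <= c n.+1 /\ a n.+1 + C * q ^+ n.+1 <= a n + C * q ^+ n.
  have := ha n; rewrite ler_norml /c exprS BE.
  by move: (q ^+ n) (a n) (a n.+1) => x y z /andP[h1 h2]; split; nra.
have up n : a n + C * q ^+ n <= a 0%N + C.
  elim: n => [|n ih]; first by rewrite expr0 mulr1.
  exact: le_trans (proj2 (step n)) ih.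
have cub n : c n <= a 0%N + C.
  apply: le_trans (up n); rewrite /c; have := mulr_ge0 C0 (qn n); lra.
have cnd : nondecreasing_seq c by apply/nondecreasing_seqP => n; case: (step n).
have cl : cvgn c by apply: nondecreasing_is_cvgn => //; exists (a 0%N + C) => _ [n _ <-].
have aE : a = (fun n => c n + C * q ^+ n) by apply/funext => n; rewrite /c subrK.
exists (limn c).
  rewrite aE -[X in _ --> X]addr0 -[X in _ + X](mulr0 C).
  apply: cvgD; first exact: cl.
  apply: cvgM; first exact: cvg_cst.
  by apply: cvg_expr; rewrite ger0_norm// ltW.
rewrite -/C ler_norml; apply/andP; split.
  have : c 0%N <= limn c by apply: nondecreasing_cvgn_le.
  by rewrite /c expr0 mulr1; lra.
suff : limn c <= a 0%N + C by lra.
by apply: limr_le => //; apply: nearW.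
Qed.

Lemma geometric_cvg (u : nat -> plane R) (B q : R) : 0 < q < 1 ->
  (forall n, `|u n.+1 - u n| <= B * q ^+ n) ->
  exists2 l : plane R, u n @[n --> \oo] --> l & `|l - u 0%N| <= B / (1 - q).
Proof.
move=> q01 hu.
have hi i n : `|u n.+1 ord0 i - u n ord0 i| <= B * q ^+ n.
  have /plane_norm_leP h := hu n.
  have : `|(u n.+1 - u n) ord0 i| <= B * q ^+ n by move: i; apply/forall_ord2.
  by rewrite !mxE.
have [l0 c0 b0] := geometric_cvg_real q01 (hi ord0).
have [l1 c1 b1] := geometric_cvg_real q01 (hi ord_max).
exists (point2 l0 l1); first by apply: cvg_planeP; rewrite mxE.
by apply/plane_norm_leP; rewrite !mxE.
Qed.

End GeometricConvergence.

(** * Lines of descent in an abstract system of expanding arcs *)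

Section Dynamics.
Context {R : realType} {X : eqType}.
Variables (lam : R) (psi : plane R -> plane R).
Variables (V : X -> Prop) (N : X -> set (plane R)) (ch : X -> seq X) (B D : R).
Hypothesis lam_gt1 : 1 < lam.

Let F (w : plane R) := lam *: psi w.

Hypothesis ch_valid : forall x c, V x -> c \in ch x -> V c.
Hypothesis ch_cover : forall x z, V x -> N x z -> exists2 c, c \in ch x & N c (F z).
Hypothesis ch_sub : forall x c, V x -> c \in ch x -> N c `<=` F @` N x.
Hypothesis psi_near : forall x z, V x -> N x z -> `|psi z - z| <= B.
Hypothesis N_bounded : forall x z w, V x -> N x z -> N x w -> `|z - w| <= D.

Let lam_gt0 : 0 < lam. Proof. exact: lt_trans lam_gt1. Qed.
Let lam_neq0 : lam != 0. Proof. exact: lt0r_neq0. Qed.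
Let q01 : 0 < lam^-1 < 1. Proof. by rewrite invr_gt0 lam_gt0 invf_lt1. Qed.

(** The sum of the displacements B lam^-n, hence a bound for the distance between a point and its
    limit. *)
Definition drift : R := B / (1 - lam^-1).

Lemma iter_node x z n : V x -> N x z -> exists2 y, V y & N y (iter n F z).
Proof.
move=> Vx Nz; elim: n => [|n [y Vy Ny]]; first by exists x.
by have [c cy Nc] := ch_cover Vy Ny; exists c => //; apply: ch_valid Vy cy.
Qed.

Lemma psi_iterS n z : psi_iter lam psi n.+1 z = lam^-1 *: psi_iter lam psi n (F z).
Proof. by rewrite /psi_iter iterSr scalerA exprS invfM. Qed.

Lemma psi_limit_cvg x z : V x -> N x z ->
  psi_iter lam psi n z @[n --> \oo] --> psi_limit lam psi z /\
  `|psi_limit lam psi z - z| <= drift.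
Proof.
move=> Vx Nz; have [|l ul bl] := @geometric_cvg R (fun n => psi_iter lam psi n z) B lam^-1 q01.
  move=> n; rewrite /psi_iter iterS -/F; have [y Vy Ny] := iter_node n Vx Nz.
  have -> : lam ^- n.+1 *: F (iter n F z) - lam ^- n *: iter n F z =
      lam ^- n *: (psi (iter n F z) - iter n F z).
    by rewrite /F scalerA exprSr invfM mulfVK// scalerBr.
  rewrite normrZ mulrC exprVn ger0_norm; last by rewrite invr_ge0 exprn_ge0// ltW.
  by rewrite ler_wpM2r ?(psi_near Vy)// invr_ge0 exprn_ge0// ltW.
have -> : psi_limit lam psi z = l by exact: (cvg_lim (@norm_hausdorff _ _) ul).
split=> //; suff <- : psi_iter lam psi 0 z = z by [].
by rewrite /psi_iter expr0 invr1 scale1r.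
Qed.

(** The limit map conjugates F to multiplication by lam; this is why limit images of nodes, scaled
    by powers of lam, are covered by those of their descendants. *)
Lemma psi_limit_step x z : V x -> N x z ->
  psi_limit lam psi z = lam^-1 *: psi_limit lam psi (F z).
Proof.
move=> Vx Nz; have [c cx Nc] := ch_cover Vx Nz.
have [h1 _] := psi_limit_cvg Vx Nz.
have [h2 _] := psi_limit_cvg (ch_valid Vx cx) Nc.
have h3 : psi_iter lam psi n.+1 z @[n --> \oo] --> psi_limit lam psi z.
  by rewrite (cvg_shiftS (fun n => psi_iter lam psi n z)).
have h4 : psi_iter lam psi n.+1 z @[n --> \oo] --> lam^-1 *: psi_limit lam psi (F z).
  rewrite (_ : (fun n => _) = fun n => lam^-1 *: psi_iter lam psi n (F z)).
    by apply: cvgZ; [exact: cvg_cst|exact: h2].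
  by apply/funext => n; exact: psi_iterS.
exact: (cvg_unique (@norm_hausdorff _ _) h3 h4).
Qed.

Definition limit_image x : set (plane R) := psi_limit lam psi @` N x.

Fixpoint desc n x : seq X :=
  if n is n'.+1 then flatten [seq desc n' c | c <- ch x] else [:: x].

Lemma desc_valid n x y : V x -> y \in desc n x -> V y.
Proof.
elim: n x => [|n ih] x Vx /=; first by rewrite inE => /eqP ->.
by move=> /flatten_mapP[c cx]; apply: ih; apply: ch_valid Vx cx.
Qed.

Lemma limit_image_desc n x z : V x -> limit_image x z ->
  exists2 y, y \in desc n x & limit_image y (lam ^+ n *: z).
Proof.
elim: n x z => [|n ih] x z Vx.
  by exists x; rewrite ?inE// expr0 scale1r.
move=> [w Nw <-] /=; have [c cx Nc] := ch_cover Vx Nw.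
rewrite (psi_limit_step Vx Nw) scalerA exprSr mulfK//.
have [|y yc iy] := ih c (psi_limit lam psi (F w)) (ch_valid Vx cx); first by exists (F w).
by exists y => //; apply/flatten_mapP; exists c.
Qed.

Lemma limit_image_near x z : V x -> limit_image x z -> exists2 w, N x w & `|z - w| <= drift.
Proof. by move=> Vx [w Nw <-]; exists w => //; case: (psi_limit_cvg Vx Nw). Qed.

Lemma limit_image_bounded x z w : V x -> limit_image x z -> limit_image x w ->
  `|z - w| <= D + 2 * drift.
Proof.
move=> Vx /(limit_image_near Vx)[z' Nz zz'] /(limit_image_near Vx)[w' Nw ww'].
have -> : z - w = (z - z') + (z' - w') - (w - w') by apply/rowP => i; rewrite !mxE; ring.
rewrite (le_trans (ler_normB _ _))// (le_trans (lerD (ler_normD _ _) ww'))//.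
by rewrite (le_trans (lerD (lerD zz' (N_bounded Vx Nz Nw)) (lexx _)))//; lra.
Qed.

Hypothesis N_preim_compact : forall x C, V x -> closed C -> compact [set z | N x z /\ C (F z)].

(** [Q k m] collects the points of the arc of [f k] whose next m images under F follow the branch.
    These sets are compact, nonempty because each child arc is covered by the image of its parent,
    and decreasing in m; a point common to all [Q 0 m] follows the whole branch. *)
Lemma descent_point (f : nat -> X) : V (f 0%N) -> (forall n, f n.+1 \in ch (f n)) ->
  (forall n, N (f n) !=set0) ->
  exists2 z, limit_image (f 0%N) z & forall n, limit_image (f n) (lam ^+ n *: z).
Proof.
move=> V0 fch Nn0.
have Vf n : V (f n) by elim: n => [//|n ih]; apply: ch_valid ih (fch n).
pose Q := fix Q k m : set (plane R) := if m is m'.+1 then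
  [set z | N (f k) z /\ Q k.+1 m' (F z)] else N (f k).
have cQ m k : compact (Q k m).
  elim: m k => [|m ih] k /=.
    have := N_preim_compact (Vf k) closedT; congr compact.
    by apply/seteqP; split=> z; [case|].
  apply: N_preim_compact => //; apply: compact_closed (ih _).
  exact: norm_hausdorff.
have Qne m k : Q k m !=set0.
  elim: m k => [|m ih] k /=; first exact: Nn0.
  have [w Qw] := ih k.+1.
  have Nw : N (f k.+1) w by case: (m) Qw => [|m'] //= [].
  have [z Nz zw] := ch_sub (Vf k) (fch k) Nw.
  by exists z; split=> //; rewrite zw.
have Qdec m k z : Q k m.+1 z -> Q k m z.
  elim: m k z => [|m ih] k z /=; first by case.
  by move=> [Nz [Nz' h]]; split=> //; apply: ih.
have Qle m m' k z : (m <= m')%N -> Q k m' z -> Q k m z.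
  elim: m' => [|m' ih]; first by rewrite leqn0 => /eqP ->.
  by rewrite leq_eqVlt ltnS => /predU1P[->//|mm'] /Qdec; apply: ih.
have [z0 hz0] : {z0 : nat -> plane R & forall m, Q 0%N m (z0 m)}.
  apply: (@choice nat (plane R) (fun m z => Q 0%N m z)) => m.
  by have [z] := Qne m 0%N; exists z.
(* The common point is a cluster point of points chosen in the sets [Q 0 m]. *)
have [|z [Qz zc]] := cQ 0%N 0%N (z0 @ \oo) _.
  by exists 0%N => // m _; apply: (Qle 0%N m).
have Qz' m : Q 0%N m z.
  have /closure_id -> : closed (Q 0%N m).
    by apply: compact_closed (cQ _ _); exact: norm_hausdorff.
  move=> U hU; apply: (zc (Q 0%N m) U) => //.
  by exists m => // m' mm'; apply: Qle (hz0 m').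
have orbit m k w : Q k m w -> N (f (k + m)%N) (iter m F w).
  elim: m k w => [|m ih] k w /=; first by rewrite addn0.
  by move=> [_ /ih]; rewrite addSnnS -iterS iterSr.
exists (psi_limit lam psi z); first by exists z.
move=> n; exists (iter n F z); first by have := orbit n 0%N z (Qz' n).
elim: n => [|n ih]; first by rewrite expr0 scale1r.
have Nn := orbit n 0%N z (Qz' n).
rewrite exprS -scalerA -ih (psi_limit_step (Vf n) Nn) scalerA mulfV// scale1r.
by [].
Qed.

End Dynamics.

(** * Hausdorff measure *)

(* mathcomp-analysis has another [edist]. *)
Local Notation edist := Pilot.Defs.edist.

Section HausdorffMeasure.
Context {R : realType}.
Implicit Types (A : set (plane R)) (s d e : R).

Lemma edist_ge0 (x y : plane R) : 0 <= edist x y.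
Proof. exact: sqrtr_ge0. Qed.

Lemma edist_sum (x y : plane R) : \sum_(i < 2) (x ord0 i - y ord0 i) ^+ 2 =
  (x - y) ord0 ord0 ^+ 2 + (x - y) ord0 ord_max ^+ 2.
Proof.
rewrite big_ord_recl big_ord_recl big_ord0 addr0 !mxE.
by have -> : lift ord0 ord0 = ord_max :> 'I_2 by apply: val_inj.
Qed.

Lemma norm_le_edist (x y : plane R) : `|x - y| <= edist x y.
Proof.
rewrite /edist edist_sum; apply/plane_norm_leP.
have h0 := sqr_ge0 ((x - y) ord0 ord0); have h1 := sqr_ge0 ((x - y) ord0 ord_max).
by split; rewrite -sqrtr_sqr ler_wsqrtr//; lra.
Qed.

Lemma edist_le_norm (x y : plane R) : edist x y <= 2 * `|x - y|.
Proof.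
have n0 : 0 <= `|x - y| by [].
have [h0 h1] := (plane_norm_leP (x - y) `|x - y|).1 (lexx _).
rewrite /edist edist_sum -[leRHS]ger0_norm; last by rewrite mulr_ge0.
rewrite -sqrtr_sqr ler_wsqrtr//.
move: h0 h1 n0; rewrite !ler_norml.
move: `|x - y| ((x - y) ord0 ord0) ((x - y) ord0 ord_max) => n a b.
move=> /andP[a1 a2] /andP[b1 b2] n0.
have a3 : 0 <= (n - a) * (n + a) by rewrite mulr_ge0//; lra.
have b3 : 0 <= (n - b) * (n + b) by rewrite mulr_ge0//; lra.
by have := sqr_ge0 n; lra.
Qed.

Lemma ediam_le A d : 0 <= d -> diam_le d A -> ediam A <= d.
Proof.
move=> d0 Ad; rewrite /ediam; set E := (X in sup X).
have [[z Ez]|E0] := pselect (E !=set0).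
  by apply: ge_sup; [exists z|move=> _ [x Ax [y Ay <-]]; apply: Ad].
suff -> : E = set0 by rewrite sup0.
by apply/seteqP; split=> // z Ez; apply: E0; exists z.
Qed.

Lemma edist_le_ediam A d (x y : plane R) : diam_le d A -> A x -> A y -> edist x y <= ediam A.
Proof.
move=> Ad Ax Ay; apply: ub_le_sup; last by exists x => //; exists y.
by exists d => _ [x' Ax' [y' Ay' <-]]; apply: Ad.
Qed.

Lemma ediam_ge0 A d : diam_le d A -> 0 <= ediam A.
Proof.
move=> Ad; have [[z Az]|A0] := pselect (A !=set0).
  exact: le_trans (edist_ge0 z z) (edist_le_ediam Ad Az Az).
suff -> : A = set0.
  rewrite /ediam (_ : [set _ | x in _ & y in _] = set0) ?sup0//.
  by apply/seteqP; split=> // z [x []].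
by apply/seteqP; split=> // z Az; apply: A0; exists z.
Qed.

Lemma diam_le_set0 d : diam_le d (set0 : set (plane R)).
Proof. by move=> x y []. Qed.

Lemma ediam_set0 : ediam (set0 : set (plane R)) = 0.
Proof.
apply/eqP; rewrite eq_le (ediam_ge0 (@diam_le_set0 0)) andbT.
exact: ediam_le (@diam_le_set0 0).
Qed.

Lemma hausdorff_premeasure_ge0 s d A : (0 <= hausdorff_premeasure s d A)%E.
Proof.
apply: le_ereal_inf_tmp => _ [U _ <-]; apply: nneseries_ge0 => i _ _.
by rewrite lee_fin powR_ge0.
Qed.

Lemma hausdorff_measure_eq0 s A :
  (forall d e, 0 < d -> 0 < e -> exists U : nat -> set (plane R),
    [/\ A `<=` \bigcup_i U i, forall i, diam_le d (U i) &
      forall n, \sum_(i < n) ediam (U i) `^ s <= e]) ->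
  hausdorff_measure s A = 0%E.
Proof.
move=> h; apply/eqP; rewrite eq_le; apply/andP; split; last first.
  apply: le_trans (hausdorff_premeasure_ge0 s 1 A) _.
  by apply: ereal_sup_ubound; exists 1 => //=.
apply: ge_ereal_sup => _ [d /= d0 <-].
apply/lee_addgt0Pr => e e0; rewrite add0e.
have [U [AU Ud Ue]] := h d e d0 e0.
apply: (@le_trans _ _ (\sum_(0 <= i <oo) (ediam (U i) `^ s)%:E)%E).
  by apply: ereal_inf_lbound; exists U.
apply: lime_le; first by apply: is_cvg_nneseries => i _ _; rewrite lee_fin powR_ge0.
by apply: nearW => n; rewrite sumEFin lee_fin big_mkord.
Qed.

Lemma hausdorff_measure_eq0_cover s A e : hausdorff_measure s A = 0%E -> 0 < e ->
  exists U : nat -> set (plane R),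
    [/\ A `<=` \bigcup_i U i, forall i, diam_le 1 (U i) &
      forall n, \sum_(i < n) ediam (U i) `^ s <= e].
Proof.
move=> A0 e0.
have p0 : hausdorff_premeasure s 1 A = 0%E.
  apply/eqP; rewrite eq_le hausdorff_premeasure_ge0 andbT -A0.
  by apply: ereal_sup_ubound; exists 1 => //=.
have [|_ [U [AU Ud] <-] Ue] := @lb_ereal_inf_adherent R _ e e0 (_ :
    hausdorff_premeasure s 1 A \is a fin_num); first by rewrite p0.
exists U; split=> // n; rewrite -lee_fin -sumEFin.
have := @nneseries_lim_ge R (fun i => (ediam (U i) `^ s)%:E) xpredT 0%N n.
rewrite big_mkord => /(_ _)/le_trans; apply; first by move=> i _ _; rewrite lee_fin powR_ge0.
move: Ue; rewrite -/(hausdorff_premeasure s 1 A) p0 add0e; exact: ltW.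
Qed.

(** Premeasures use a single sequence of sets, whereas the natural covers are sequences of finite
    lists. As the lists are nonempty, the first i + 1 of them contain an entry of index i, which
    does not change when more lists are appended. *)
Lemma concat_cover (f : set (plane R) -> R) (L : nat -> seq (set (plane R))) (e : R) :
  (forall A, 0 <= f A) -> (forall k, L k != [::]) ->
  (forall n, \sum_(k < n) \sum_(A <- L k) f A <= e) ->
  exists U : nat -> set (plane R), [/\ forall k A, A \in L k -> exists i, U i = A,
    forall i, exists k, U i \in L k & forall n, \sum_(i < n) f (U i) <= e].
Proof.
move=> f0 L0 Le; pose Q n := flatten (mkseq L n).
have QS n : Q n.+1 = Q n ++ L n by rewrite /Q mkseqS flatten_rcons.
have sQ n : (n <= size (Q n))%N.
  elim: n => [//|n ih]; rewrite QS size_cat -addn1 leq_add//.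
  by have := L0 n; case: (L n).
have nthQ m n i : (m <= n)%N -> (i < size (Q m))%N -> nth set0 (Q n) i = nth set0 (Q m) i.
  move=> mn im; have sm : forall k, (size (Q m) <= size (Q (m + k)))%N.
    elim=> [|k ih]; first by rewrite addn0.
    by rewrite addnS QS size_cat (leq_trans ih)// leq_addr.
  rewrite -(subnKC mn); elim: (n - m)%N => [|k ih]; first by rewrite addn0.
  by rewrite addnS QS nth_cat (leq_trans im (sm k)) ih.
exists (fun i => nth set0 (Q i.+1) i); split.
- move=> k A Ak; exists (size (Q k) + index A (L k))%N.
  have lt : (size (Q k) + index A (L k) < size (Q k.+1))%N.
    by rewrite QS size_cat ltn_add2l index_mem.
  rewrite (nthQ k.+1)//; last by rewrite ltnS (leq_trans (sQ k))// leq_addr.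
  by rewrite QS nth_cat ltnNge leq_addr/= addKn nth_index.
- move=> i; have : nth set0 (Q i.+1) i \in Q i.+1 by apply: mem_nth; apply: sQ.
  by move=> /flatten_mapP[k _ hk]; exists k.
- move=> n; apply: le_trans (Le n).
  rewrite (eq_bigr (fun i : 'I_n => f (nth set0 (Q n) i))); last first.
    by move=> i _; rewrite -(nthQ i.+1 n).
  have -> : \sum_(k < n) \sum_(A <- L k) f A = \sum_(A <- Q n) f A.
    elim: n => [|n ih]; first by rewrite big_ord0 /Q big_nil.
    by rewrite QS big_cat big_ord_recr ih.
  rewrite (big_nth set0) -(big_mkord xpredT (fun i => f (nth set0 (Q n) i))).
  rewrite (big_cat_nat (leq0n n) (sQ n))/= lerDl.
  by apply: sumr_ge0.
Qed.

End HausdorffMeasure.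

(** * Upper and lower estimates of the Hausdorff measure *)

Section DimensionBounds.
Context {R : realType}.

Lemma geometric_small (q C e : R) : 0 <= q < 1 -> 0 < e ->
  exists n0, forall n, (n0 <= n)%N -> C * q ^+ n <= e.
Proof.
move=> /andP[q0 q1] e0.
have : (fun n => C * q ^+ n) @ \oo --> 0.
  by apply: cvg_geometric; rewrite ger0_norm.
move=> /cvgrPdist_le/(_ _ e0)[n0 _ hn]; exists n0 => n n0n.
have := hn n n0n; rewrite /= sub0r normrN => /(le_trans (ler_norm _)).
exact.
Qed.

Lemma powR_exprn (x s : R) n : 0 <= x -> (x ^+ n) `^ s = (x `^ s) ^+ n.
Proof.
by move=> x0; rewrite -(powR_mulrn _ x0) -(powR_mulrn _ (powR_ge0 x s)) powRAC.
Qed.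

Lemma powR_invr (x s : R) : 0 <= x -> (x^-1) `^ s = (x `^ s)^-1.
Proof. by move=> x0; rewrite -powR_inv1// powRAC powR_inv1// powR_ge0. Qed.

Context {X : choiceType}.
Variables (lam : R) (psi : plane R -> plane R).
Variables (V : X -> Prop) (N : X -> set (plane R)) (ch : X -> seq X) (B D : R).
Hypothesis lam_gt1 : 1 < lam.
Let F (w : plane R) := lam *: psi w.
Hypothesis ch_valid : forall x c, V x -> c \in ch x -> V c.
Hypothesis ch_cover : forall x z, V x -> N x z -> exists2 c, c \in ch x & N c (F z).
Hypothesis ch_sub : forall x c, V x -> c \in ch x -> N c `<=` F @` N x.
Hypothesis psi_near : forall x z, V x -> N x z -> `|psi z - z| <= B.
Hypothesis N_bounded : forall x z w, V x -> N x z -> N x w -> `|z - w| <= D.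
Hypothesis N_preim_compact : forall x C, V x -> closed C -> compact [set z | N x z /\ C (F z)].

Let lam_gt0 : 0 < lam. Proof. exact: lt_trans lam_gt1. Qed.
Let lam_neq0 : lam != 0. Proof. exact: lt0r_neq0. Qed.

Local Notation limit_image := (limit_image lam psi N).
Local Notation desc := (desc ch).
Local Notation drift := (drift lam B).

(** There are countably many starting nodes. Each is covered at a level of its own, so deep that
    node number k contributes at most e 2^-(k+1); such levels exist because r / lam^s < 1. *)
Lemma hausdorff_measure_limit_images_eq0 s r c : 0 < s -> 0 < r -> r < lam `^ s -> 0 <= c ->
  (forall n x, V x -> (size (desc n x))%:R <= c * r ^+ n) ->
  countable [set x | V x] -> hausdorff_measure s (\bigcup_(x in [set x | V x]) limit_image x) = 0%E.
Proof.
move=> s0 r0 rs c0 hsize /countable_injP[code code_inj].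
apply: hausdorff_measure_eq0 => d e d0 e0.
(* The factor 2 compares the Euclidean distance with the sup norm; adding 1 makes the constant
   positive. *)
pose Dm := `|2 * (D + 2 * drift)| + 1.
have Dm0 : 0 < Dm by rewrite ltr_wpDl.
have ls0 : 0 < lam `^ s by apply: powR_gt0.
have q01 : 0 <= r / lam `^ s < 1.
  by rewrite divr_ge0 ?ltW//= ltr_pdivrMr// mul1r.
have li01 : 0 <= lam^-1 < 1 by rewrite invr_ge0 ltW//= invf_lt1.
have level (k : nat) : exists n, Dm * (lam^-1) ^+ n <= d /\
    c * Dm `^ s * (r / lam `^ s) ^+ n <= e * (1 / 2) ^+ k.+1.
  have ek : 0 < e * (1 / 2) ^+ k.+1 by rewrite mulr_gt0// exprn_gt0.
  have [n1 h1] := geometric_small Dm li01 d0.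
  have [n2 h2] := geometric_small (c * Dm `^ s) q01 ek.
  by exists (maxn n1 n2); split; [apply/h1/leq_maxl|apply/h2/leq_maxr].
have [lev hlev] := choice level.
pose piece_of n y : set (plane R) := [set z | limit_image y (lam ^+ n *: z)].
have piece_diam n y : V y -> diam_le (Dm * lam^-1 ^+ n) (piece_of n y).
  move=> Vy z w iz iw; apply: le_trans (edist_le_norm _ _) _.
  have h := limit_image_bounded lam_gt1 ch_valid ch_cover psi_near N_bounded Vy iz iw.
  rewrite -scalerBr normrZ ger0_norm in h; last by rewrite exprn_ge0// ltW.
  rewrite exprVn ler_pdivlMr ?exprn_gt0// -mulrA mulrC (mulrC `|_|).
  rewrite (le_trans (_ : _ <= 2 * (D + 2 * drift)))//.
    by rewrite mulrC ler_pM2l.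
  by rewrite /Dm (le_trans (ler_norm _))// lerDl.
have point k : {x : option X | forall x', V x' -> code x' = k -> x = Some x'} .
  have [ex|nex] := pselect (exists x, V x /\ code x = k); last first.
    by exists None => x' Vx' xk; case: nex; exists x'.
  have [x [Vx xk]] := cid ex; exists (Some x) => x' Vx' x'k; congr Some.
  by apply: code_inj; rewrite ?inE// xk x'k.
(* The empty set makes every list nonempty, also for a k that codes no node, and it costs nothing
   because s > 0. *)
pose L k := set0 :: if sval (point k) is Some x then
   if `[< V x >] then [seq piece_of (lev k) y | y <- desc (lev k) x] else [::] else [::].
have LP k A : A \in L k -> A = set0 \/ exists x y, [/\ V x, y \in desc (lev k) x &
    A = piece_of (lev k) y].
  rewrite /L inE => /predU1P[->|]; first by left.
  case: (sval (point k)) => // x; case: asboolP => // Vx /mapP[y yx ->].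
  by right; exists x, y.
have Ld k A : A \in L k -> diam_le d A.
  move=> /LP[->|[x [y [Vx yx ->]]]]; first exact: diam_le_set0.
  have Vy := desc_valid ch_valid Vx yx.
  move=> z w iz iw; apply: le_trans (piece_diam _ _ Vy z w iz iw) _.
  by have [] := hlev k.
have [||n|U [LU UL Ue]] := @concat_cover R (fun A => ediam A `^ s) L e.
- by move=> A; apply: powR_ge0.
- by [].
- have bound k : \sum_(A <- L k) ediam A `^ s <= e * (1 / 2) ^+ k.+1.
    have [_] := hlev k; apply: le_trans.
    rewrite /L big_cons ediam_set0 powR0 ?gt_eqF// add0r.
    have rhs0 : 0 <= c * Dm `^ s * (r / lam `^ s) ^+ lev k.
      rewrite mulr_ge0// ?mulr_ge0 ?powR_ge0// exprn_ge0//.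
      by case/andP: q01.
    case: (sval (point k)) => [x|]; last by rewrite big_nil.
    case: asboolP => Vx; last by rewrite big_nil.
    rewrite big_map big_seq.
    apply: (@le_trans _ _ (\sum_(y <- desc (lev k) x | y \in desc (lev k) x)
        (Dm `^ s * (lam `^ s)^-1 ^+ lev k))).
      apply: ler_sum => y yx; have Vy := desc_valid ch_valid Vx yx.
      have Dl0 : 0 <= Dm * lam^-1 ^+ lev k.
        by rewrite mulr_ge0 ?exprn_ge0 ?invr_ge0 ?ltW.
      have -> : Dm `^ s * (lam `^ s)^-1 ^+ lev k = (Dm * lam^-1 ^+ lev k) `^ s.
        rewrite powRM ?powR_exprn ?powR_invr//.
        - exact: ltW.
        - by rewrite invr_ge0 ltW.
        - exact: ltW.
        - by rewrite exprn_ge0// invr_ge0 ltW.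
      apply: ge0_ler_powR; rewrite ?nnegrE//; first exact: ltW.
        exact: ediam_ge0 (piece_diam _ _ Vy).
      exact: ediam_le Dl0 (piece_diam _ _ Vy).
    rewrite -big_seq big_const_seq count_predT iter_addr_0 -[_ *+ _]mulr_natl.
    rewrite (le_trans (ler_wpM2r _ (hsize _ _ Vx)))//.
      by rewrite mulr_ge0 ?powR_ge0// exprn_ge0// invr_ge0 ltW.
    by rewrite expr_div_n exprVn le_eqVlt; apply/orP; left; apply/eqP; ring.
  apply: (@le_trans _ _ (\sum_(k < n) e * (1 / 2) ^+ k.+1)); first by apply: ler_sum.
  have -> : \sum_(k < n) e * (1 / 2) ^+ k.+1 = e * (1 - (1 / 2) ^+ n).
    elim: n => [|n ih]; first by rewrite big_ord0 expr0 subrr mulr0.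
    by rewrite big_ord_recr ih/= !exprS; field.
  rewrite -[leRHS]mulr1 ler_pM2l// lerBlDr lerDl exprn_ge0//.
exists U; split=> //.
- move=> z [x Vx xz].
  have [y yx yz] := limit_image_desc lam_gt1 ch_valid ch_cover psi_near (lev (code x)) Vx xz.
  have [|i Ui] := LU (code x) (piece_of (lev (code x)) y).
    rewrite /L inE; apply/orP; right.
    rewrite (svalP (point (code x)) x Vx erefl); case: asboolP => // _.
    by apply/mapP; exists y.
  by exists i => //; rewrite Ui.
- by move=> i; have [k] := UL i; apply: Ld.
Qed.


Lemma seq_uniform_bound (Y : eqType) (l : seq Y) (Q : Y -> nat -> Prop) :
  (forall c n n', (n <= n')%N -> Q c n -> Q c n') ->
  (forall c, c \in l -> exists n, Q c n) -> exists n, forall c, c \in l -> Q c n.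
Proof.
move=> mono; elim: l => [|c l ih] h; first by exists 0%N.
have [|n hn] := ih; first by move=> c' c'l; apply: h; rewrite inE c'l orbT.
have [|n' hn'] := h c; first by rewrite inE eqxx.
exists (maxn n n') => c'; rewrite inE => /predU1P[->|/hn].
  by apply: mono hn'; apply: leq_maxr.
by apply: mono; apply: leq_maxl.
Qed.

(** The level n is the one with lam^-(n+1) < diam U <= lam^-n, so that a^-n = a a^-(n+1) <= a (diam
    U)^s. A set of diameter 0 has no such level; the summand e then pays for a sufficiently deep
    one. *)
Lemma covering_level s a (U : set (plane R)) e : 0 < s -> 1 < a -> lam `^ s <= a ->
  diam_le 1 U -> 0 < e -> exists n, diam_le (lam ^- n) U /\
    a ^- n <= a * ediam U `^ s + e.
Proof.
move=> s0 a1 la U1 e0; have a0 : 0 < a by apply: lt_trans a1.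
have ai01 : 0 <= a^-1 < 1 by rewrite invr_ge0 ltW//= invf_lt1.
have li01 : 0 <= lam^-1 < 1 by rewrite invr_ge0 ltW//= invf_lt1.
have dU := ediam_ge0 U1.
have [Up|Up] := ltP 0 (ediam U); last first.
  have [n hn] := geometric_small 1 ai01 e0; exists n; split.
    move=> x y Ux Uy; apply: le_trans (edist_le_ediam U1 Ux Uy) _.
    by apply: le_trans Up _; rewrite invr_ge0 exprn_ge0// ltW.
  have := hn n (leqnn n); rewrite mul1r exprVn => /le_trans; apply.
  by rewrite lerDr mulr_ge0 ?powR_ge0// ltW.
have ex : exists n, lam ^- n.+1 < ediam U.
  have e2 : 0 < ediam U / 2 by rewrite divr_gt0.
  have [n hn] := geometric_small 1 li01 e2; exists n.
  have := hn n.+1 (leqnSn n); rewrite mul1r exprVn; lra.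
pose n := ex_minn ex; have [nP nmin] : lam ^- n.+1 < ediam U /\
    forall m, lam ^- m.+1 < ediam U -> (n <= m)%N by rewrite /n; case: ex_minnP.
have Un : ediam U <= lam ^- n.
  case: n nP nmin => [|m] nP nmin; first by rewrite expr0 invr1; apply: ediam_le.
  rewrite leNgt; apply/negP => /nmin; by rewrite ltnn.
exists n; split.
  by move=> x y Ux Uy; apply: le_trans (edist_le_ediam U1 Ux Uy) Un.
apply: (@le_trans _ _ (a * ediam U `^ s)); last by rewrite lerDl ltW.
rewrite -ler_pdivrMl// -invfM -exprS.
apply: (@le_trans _ _ ((lam ^- n.+1) `^ s)).
  rewrite -[lam ^- _]exprVn powR_exprn; last by rewrite invr_ge0 ltW.
  rewrite powR_invr; last exact: ltW.
  rewrite exprVn lef_pV2 ?posrE ?exprn_gt0 ?powR_gt0//.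
  by rewrite lerXn2r// nnegrE ?powR_ge0// ltW.
apply: ge0_ler_powR; rewrite ?nnegrE; [exact: ltW| |exact: dU|exact: ltW].
by rewrite invr_ge0 exprn_ge0// ltW.
Qed.

(** A mass distribution argument on the tree: each set of a cheap cover charges the weights of the
    descendants that it meets at its own level, and the total is too small to pay for the weight of
    x0. The deficit passes from a node to some child, and following it yields a point outside the
    cover. *)
Lemma hausdorff_measure_neq0 s a (u : X -> R) (um : R) (k : nat) x0 A :
  0 < s -> 1 < a -> lam `^ s <= a ->
  (forall x, V x -> N x !=set0) ->
  (forall x, V x -> 0 <= u x <= um) ->
  (forall x, V x -> a * u x <= \sum_(c <- ch x) u c) ->
  V x0 -> 0 < u x0 -> (forall n, uniq (desc n x0)) ->
  (forall w l, uniq l -> (forall y, y \in l -> V y /\ exists2 z, N y z & `|z - w| <= 1 + drift) ->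
     (size l <= k)%N) ->
  limit_image x0 `<=` A -> hausdorff_measure s A <> 0%E.
Proof.
move=> s0 a1 la N0 ub usub V0 u0 uniqd hk x0A A0.
have a0 : 0 < a by apply: lt_trans a1.
have um0 : 0 <= um by have /andP[h1 h2] := ub _ V0; apply: le_trans h2.
(* At most k nodes of weight at most um are met by one set at its level. The e below is chosen so
   that the total charge, at most C (a e + e), is less than u x0. *)
pose C := k%:R * um; have C0 : 0 <= C by rewrite mulr_ge0.
have Ca0 : 0 <= C * (a + 1) by rewrite mulr_ge0//; lra.
pose e := u x0 / (C * (a + 1) + 1).
have e0 : 0 < e by rewrite divr_gt0//; lra.
have eE : C * (a * e + e) < u x0.
  have -> : C * (a * e + e) = u x0 * (C * (a + 1)) / (C * (a + 1) + 1).
    by rewrite /e; field; apply/eqP; lra.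
  by rewrite ltr_pdivrMr ?ltr_pM2l//; lra.
have [U [AU Ud Ue]] := hausdorff_measure_eq0_cover A0 e0.
have level (i : nat) : exists n, diam_le (lam ^- n) (U i) /\
    a ^- n <= a * ediam (U i) `^ s + e * (1 / 2) ^+ i.+1.
  by apply: covering_level => //; rewrite mulr_gt0// exprn_gt0.
have [lev hlev] := choice level.
pose meets i y := `[< exists2 z, U i z & limit_image y (lam ^+ lev i *: z) >].
(* The charge of [U i] on a node x of level m. It is 0 beyond [lev i], where [U i] has already been
   accounted for. *)
pose mu i m x := if (m <= lev i)%N then
  \sum_(y <- desc (lev i - m) x | meets i y) a ^- lev i * u y else 0.
have mu_ge0 i m x : V x -> 0 <= mu i m x.
  move=> Vx; rewrite /mu; case: ifP => // _; rewrite big_seq_cond sumr_ge0// => y.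
  move=> /andP[/(desc_valid ch_valid Vx)/ub/andP[uy _] _].
  by rewrite mulr_ge0// invr_ge0 exprn_ge0// ltW.
have mu_ch i m x : V x -> \sum_(c <- ch x) mu i m.+1 c <= mu i m x.
  move=> Vx; have [ml|lm] := ltnP m (lev i).
    rewrite /mu ml (ltnW ml) -[(lev i - m)%N]prednK ?subn_gt0// -subnS /=.
    by rewrite big_flatten big_map.
  rewrite big1 ?mu_ge0// => c _; by rewrite /mu ltnNge lm.
(* A bad node is one whose weight no finite number of charges pays for. Weights of children add up
   to at least that of the parent and charges to at most the parent's, so some child is bad again.
   At level [lev i], meeting [U i] would charge the full weight. *)
pose bad m x := V x /\ forall I : nat, \sum_(i < I) mu i m x < a ^- m * u x.
have bad_child m x : bad m x -> exists c, c \in ch x /\ bad m.+1 c.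
  move=> [Vx bx]; apply: contrapT => nb.
  (* A node has finitely many children; were none bad, one index [I] would serve them all. *)
  have [|c cx|I hI] := @seq_uniform_bound X (ch x)
      (fun c I => V c -> a ^- m.+1 * u c <= \sum_(i < I) mu i m.+1 c).
  - move=> c n n' nn' h Vc; apply: le_trans (h Vc) _.
    rewrite -!(big_mkord xpredT (fun i => mu i m.+1 c)) (big_cat_nat (leq0n n) nn')/= lerDl.
    by apply: sumr_ge0 => i _; apply: mu_ge0.
  - apply: contrapT => nI; apply: nb; exists c; split => //.
    split; first exact: ch_valid cx.
    by move=> I; rewrite ltNge; apply/negP => hI; apply: nI; exists I.
  have := bx I; apply/negP; rewrite -leNgt.
  apply: (@le_trans _ _ (\sum_(c <- ch x) a ^- m.+1 * u c)).
    have -> : a ^- m * u x = a ^- m.+1 * (a * u x).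
      have am0 : a ^+ m != 0 by rewrite expf_neq0// gt_eqF.
      by have an0 := lt0r_neq0 a0; rewrite exprS; field; rewrite am0.
    by rewrite -mulr_sumr ler_wpM2l ?usub// invr_ge0 exprn_ge0// ltW.
  apply: (@le_trans _ _ (\sum_(c <- ch x) \sum_(i < I) mu i m.+1 c)).
    by rewrite big_seq [leRHS]big_seq ler_sum// => c cx; apply: hI => //; apply: ch_valid cx.
  by rewrite exchange_big ler_sum// => i _; apply: mu_ch.
have bad_free m x i : bad m x -> lev i = m -> ~~ meets i x.
  move=> [Vx bx] im; apply/negP => ix; have := bx i.+1.
  apply/negP; rewrite -leNgt big_ord_recr/= {2}/mu im leqnn subnn/= big_cons big_nil.
  by rewrite ix addr0 lerDr sumr_ge0// => j _; apply: mu_ge0.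
have bad0 : bad 0%N x0.
  split=> // I; rewrite expr0 invr1 mul1r; apply: le_lt_trans eE.
  apply: (@le_trans _ _ (\sum_(i < I) C * (a * ediam (U i) `^ s + e * (1 / 2) ^+ i.+1))).
    apply: ler_sum => i _; have [dU aU] := hlev i.
    apply: (@le_trans _ _ (C * a ^- lev i)); last by rewrite ler_wpM2l.
    rewrite /mu leq0n subn0 -big_filter big_seq.
    apply: (@le_trans _ _ (\sum_(y <- [seq y <- desc (lev i) x0 | meets i y] |
        y \in [seq y <- desc (lev i) x0 | meets i y]) a ^- lev i * um)).
      apply: ler_sum => y; rewrite mem_filter => /andP[_ /(desc_valid ch_valid V0)/ub/andP[_ uy]].
      by rewrite ler_wpM2l// invr_ge0 exprn_ge0// ltW.
    rewrite -big_seq big_const_seq count_predT iter_addr_0 -mulr_natl.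
    rewrite (_ : C * _ = k%:R * (a ^- lev i * um)); last by rewrite /C; ring.
    rewrite ler_wpM2r//; first by rewrite mulr_ge0// invr_ge0 exprn_ge0// ltW.
    rewrite ler_nat.
    have [[w Uw]|Ui0] := pselect (U i !=set0); last first.
      rewrite (@eq_in_filter _ _ pred0) ?filter_pred0// => y _.
      by apply/negbTE/negP => /asboolP[z Uz _]; apply: Ui0; exists z.
    (* Scaled by lam^(lev i), the set [U i] has diameter at most 1, and the arc of a node is within
       [drift] of its limit image. *)
    apply: (hk (lam ^+ lev i *: w)); first exact: filter_uniq.
    move=> y; rewrite mem_filter => /andP[/asboolP[z Uz yz] yd].
    have Vy := desc_valid ch_valid V0 yd; split=> //.
    have [z' Nz' zz'] := limit_image_near lam_gt1 ch_valid ch_cover psi_near Vy yz.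
    exists z' => //.
    have -> : z' - lam ^+ lev i *: w = lam ^+ lev i *: (z - w) - (lam ^+ lev i *: z - z').
      by apply/rowP => j; rewrite !mxE; ring.
    apply: le_trans (ler_normB _ _) _; apply: lerD => //.
    rewrite normrZ ger0_norm; last by rewrite exprn_ge0// ltW.
    rewrite mulrC -ler_pdivlMr ?exprn_gt0// div1r.
    exact: le_trans (norm_le_edist z w) (dU _ _ Uz Uw).
  rewrite -mulr_sumr ler_wpM2l// big_split/= lerD//.
    by rewrite -mulr_sumr ler_pM2l ?Ue.
  have -> : \sum_(i < I) e * (1 / 2) ^+ i.+1 = e * (1 - (1 / 2) ^+ I).
    elim: I => [|n ih]; first by rewrite big_ord0 expr0 subrr mulr0.
    by rewrite big_ord_recr ih/= !exprS; field.
  by rewrite -[leRHS]mulr1 ler_pM2l// lerBlDr lerDl exprn_ge0.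
pose f := fix f n := if n is n'.+1 then
  xget x0 [set c | c \in ch (f n') /\ bad n'.+1 c] else x0.
have fbad n : bad n (f n).
  elim: n => [//|n ih] /=; have [c hc] := bad_child _ _ ih.
  by have [] := xgetI x0 (hc : [set c | c \in ch (f n) /\ bad n.+1 c] c).
have fch n : f n.+1 \in ch (f n).
  have [c hc] := bad_child _ _ (fbad n).
  by have [] := xgetI x0 (hc : [set c | c \in ch (f n) /\ bad n.+1 c] c).
have [|n|z zx hz] := descent_point lam_gt1 ch_valid ch_cover ch_sub psi_near
    N_preim_compact (f := f) _ fch.
- exact: V0.
- by apply: N0; case: (fbad n).
have [i _ Uz] := AU _ (x0A _ zx).
have /negP := bad_free _ _ i (fbad (lev i)) erefl; apply.
by apply/asboolP; exists z.
Qed.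

End DimensionBounds.

(** * The system of edges *)

Lemma uniq_flatten_map (Y Z : eqType) (f : Y -> seq Z) (l : seq Y) : uniq l ->
  (forall c, c \in l -> uniq (f c)) ->
  (forall c c' y, c \in l -> c' \in l -> y \in f c -> y \in f c' -> c = c') ->
  uniq (flatten [seq f c | c <- l]).
Proof.
elim: l => [//|c l ih] /= /andP[cl ul] uf disj; rewrite cat_uniq uf ?inE ?eqxx//=.
apply/andP; split.
  apply/hasPn => y /flatten_mapP[c' c'l yc']; apply/negP => yc.
  have E : c = c' by apply: disj yc yc'; rewrite inE ?eqxx// c'l orbT.
  by rewrite E c'l in cl.
apply: ih => // [c' c'l|c1 c2 y h1 h2]; first by apply: uf; rewrite inE c'l orbT.
by apply: disj; rewrite inE ?h1 ?h2 orbT.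
Qed.

Lemma within_preimage_compact (R : realType) (A : R -> plane R) (g : R -> plane R) C :
  {within `[0, 1], continuous A} -> {within `[0, 1], continuous g} -> closed C ->
  compact (A @` [set s | 0 <= s <= 1 /\ C (g s)]).
Proof.
move=> cA cg clC; apply: continuous_compact.
  by apply: continuous_subspaceW cA => s [s01 _]; rewrite /= in_itv.
suff clE : closed [set s | 0 <= s <= 1 /\ C (g s)].
  apply: (subclosed_compact clE (@segment_compact R 0 1)).
  by move=> s [s01 _]; rewrite /= in_itv.
move=> t tc.
have t01 : `[0, 1]%classic t.
  have cl : closed `[0, 1 : R]%classic.
    by apply: compact_closed; [exact: norm_hausdorff|exact: segment_compact].
  apply: cl; apply: closure_subset tc.
  by move=> s [s01 _]; rewrite /= in_itv.
split; first by move: t01; rewrite /= in_itv.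
apply: contrapT => nC.
have hN : nbhs (g t) (~` C) by apply: open_nbhs_nbhs; split=> //; rewrite openC.
have := (proj1 (subspace_continuousP _ g) cg) _ t01 _ hN.
rewrite /within/= => h; have [s [[s01 Cs] hs]] := tc _ h.
by apply: hs => //; rewrite /= in_itv.
Qed.

Lemma quarters_neq (R : realType) :
  [/\ 1 / 4 <> 1 / 2 :> R, 1 / 4 <> 3 / 4 :> R & 1 / 2 <> 3 / 4 :> R].
Proof. by split=> ?; lra. Qed.

Section TilingSystem.
Context {R : realType} {P : finType}.
Variables (supp : P -> set (plane R)) (T : set (@tile R P)) (lam : R).
Variable K : P -> cgraph.
Variables (G S : forall p, geom_graph R (K p)) (psi : plane R -> plane R).
Hypotheses (hP : prototile_set supp) (hT : tiling supp T).
Hypothesis hsim : self_similar supp T lam.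
Hypothesis hGS : recurrent_pair supp T lam G S.
Hypothesis hTG : bounds_tiling T G.
Hypothesis hpsi : induced_map supp T G S psi.

Let lam_gt1 : 1 < lam. Proof. by case: hsim. Qed.
Let lam_gt0 : 0 < lam. Proof. exact: lt_trans lam_gt1. Qed.
Let lam_neq0 : lam != 0. Proof. exact: lt0r_neq0. Qed.
Let G_on : graph_on supp G. Proof. by case: hGS => -[]. Qed.
Let S_on : graph_on supp S. Proof. by case: hGS => _ []. Qed.

Let F (w : plane R) := lam *: psi w.

(* A piece (f, x) stands for the copy of the edge f in the tile at x. *)
Local Notation node := (@piece R P K).

Definition node_valid (i : node) : Prop := T (tag i.1, i.2).

Definition node_arc (i : node) : set (plane R) :=
  translate (earc (G (tag i.1)) (tagged i.1)) i.2.

Definition edge_digits (e f : gedge K) : set (plane R) :=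
  [set d | digits supp T lam (tag e) (tag f) d /\
     scale lam^-1 (translate (earc (G (tag f)) (tagged f)) d) `<=`
     gg_map (G (tag e)) (S (tag e)) @` earc (G (tag e)) (tagged e)].

(** Digits refer to the prototile at the origin, so in the tile at [i.2] they are shifted by
    [lam *: i.2]. The number of children of a given type is an entry of the edge substitution
    matrix. *)
Definition node_children (i : node) : seq node :=
  flatten [seq [seq (f, d + lam *: i.2) | d <- fset_set (edge_digits i.1 f)] |
    f <- enum (gedge K)].

Lemma finite_edge_digits e f : finite_set (edge_digits e f).
Proof. by apply: sub_finite_set (finite_digits hP hT hsim (tag e) (tag f)) => d []. Qed.

Lemma node_childrenP i c :
  c \in node_children i <-> edge_digits i.1 c.1 (c.2 - lam *: i.2).
Proof.
split=> [/flatten_mapP[f _ /mapP[d]]|ic].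
  rewrite in_fset_set; last exact: finite_edge_digits.
  by rewrite inE => dd -> /=; rewrite addrK.
apply/flatten_mapP; exists c.1; first by rewrite mem_enum.
apply/mapP; exists (c.2 - lam *: i.2); last by rewrite subrK; case: c ic.
rewrite in_fset_set; last exact: finite_edge_digits.
by rewrite inE.
Qed.

Lemma edge_digitsP e f d : edge_digits e f d <-> pieces supp T lam (tag e) (f, d) /\
  closed_arc (piece_path lam G) (f, d) `<=` earc (S (tag e)) (tagged e).
Proof. by rewrite /edge_digits/= gg_map_earc closed_arc_piece. Qed.

Lemma sum_children (W : nmodType) (h : gedge K -> W) i :
  \sum_(c <- node_children i) h c.1 =
  \sum_f h f *+ edge_count supp T lam G S i.1 f.
Proof.
rewrite big_flatten big_map enumT; apply: eq_bigr => f _.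
by rewrite big_map /= big_const_seq count_predT iter_addr_0.
Qed.

Lemma node_arcE i z : node_arc i z <->
  exists2 s, 0 <= s <= 1 & z = epath (G (tag i.1)) (tagged i.1) s + i.2.
Proof.
rewrite /node_arc earcE; split=> [[_ [s s01 <-] <-]|[s s01 ->]]; first by exists s.
by exists (epath (G (tag i.1)) (tagged i.1) s) => //; exists s.
Qed.

Lemma psi_epath i s : node_valid i -> 0 <= s <= 1 ->
  psi (epath (G (tag i.1)) (tagged i.1) s + i.2) =
  epath (S (tag i.1)) (tagged i.1) s + i.2.
Proof.
move=> Vi s01; have eG : gsupp (G (tag i.1)) (epath (G (tag i.1)) (tagged i.1) s).
  by exists (tagged i.1) => //; rewrite earcE; exists s.
rewrite (hpsi Vi) /= ?addrK ?gg_map_epath//.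
  by exists (tag i.1, i.2) => //; rewrite translateE addrK.
by rewrite /tsupp translateE addrK; apply: G_on.
Qed.

Lemma node_children_valid i c : node_valid i -> c \in node_children i -> node_valid c.
Proof.
move=> Vi /node_childrenP[dc _].
by have [] := digits_enclosed hP hT hsim Vi dc; rewrite subrK.
Qed.

Lemma node_children_cover i z : node_valid i -> node_arc i z ->
  exists2 c, c \in node_children i & node_arc c (F z).
Proof.
move=> Vi /node_arcE[s s01 ->].
have eS : earc (S (tag i.1)) (tagged i.1) (epath (S (tag i.1)) (tagged i.1) s).
  by rewrite earcE; exists s.
have [[f d] [pd zd sub]] := edge_decomposition hP hT hsim hGS hTG eS.
exists (f, d + lam *: i.2); first by apply/node_childrenP; rewrite /= addrK; apply/edge_digitsP.
have [t t01 tE] := zd; apply/node_arcE; exists t => //=.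
rewrite /F psi_epath// -tE /piece_path/= scalerDr scalerA mulfV// scale1r.
by rewrite addrA.
Qed.

Lemma node_children_sub i c : node_valid i -> c \in node_children i ->
  node_arc c `<=` F @` node_arc i.
Proof.
move=> Vi /node_childrenP/edge_digitsP[pd sub] z /node_arcE[t t01 ->].
have [] := sub (piece_path lam G (c.1, c.2 - lam *: i.2) t); first by exists t.
move=> s; rewrite unit_itvE => s01 sE.
exists (epath (G (tag i.1)) (tagged i.1) s + i.2); first by apply/node_arcE; exists s.
rewrite /F psi_epath// sE /piece_path/= scalerDr scalerA mulfV// scale1r.
by apply/rowP => j; rewrite !mxE; ring.
Qed.

Lemma node_arc_nonempty i : node_arc i !=set0.
Proof. by eexists; apply/node_arcE; exists 0; rewrite ?lexx ?ler01. Qed.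

Lemma node_preim_compact i C : node_valid i -> closed C ->
  compact [set z | node_arc i z /\ C (F z)].
Proof.
move=> Vi clC; pose A s := epath (G (tag i.1)) (tagged i.1) s + i.2.
pose g s := lam *: (epath (S (tag i.1)) (tagged i.1) s + i.2).
have cA : {within `[0, 1], continuous A}.
  apply: (@within_continuous_comp _ _ _ _ (epath (G (tag i.1)) (tagged i.1)) (fun z => z + i.2)).
    move=> z _; have := @affine_continuous R 1 i.2 z.
    by under [X in continuous_at _ X -> _]funext do rewrite scale1r.
  exact: epath_continuous.
have cg : {within `[0, 1], continuous g}.
  apply: (@within_continuous_comp _ _ _ _ (epath (S (tag i.1)) (tagged i.1))
    (fun z => lam *: (z + i.2))); last exact: epath_continuous.
  move=> z _; have := @affine_continuous R lam (lam *: i.2) z.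
  by under [X in continuous_at _ X -> _]funext do rewrite -scalerDr.
have := within_preimage_compact cA cg clC; congr compact.
apply/seteqP; split=> [_ [s [s01 Cs] <-]|z [/node_arcE[s s01 ->] Cs]].
  split; first by apply/node_arcE; exists s.
  by rewrite /F psi_epath.
by exists s => //; split=> //; move: Cs; rewrite /F psi_epath.
Qed.

Lemma node_displacement : exists B, forall i z, node_valid i -> node_arc i z -> `|psi z - z| <= B.
Proof.
have [D D0 hD] := supp_bounded hP; exists (D + D) => i z Vi /node_arcE[s s01 ->].
rewrite psi_epath// opprD addrACA subrr addr0 (le_trans (ler_normB _ _))//.
apply: lerD; apply: (hD (tag i.1)); [apply: S_on|apply: G_on];
  by exists (tagged i.1) => //; rewrite earcE; exists s.
Qed.

Lemma node_supp i z : node_arc i z -> supp (tag i.1) (z - i.2).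
Proof. by rewrite /node_arc translateE => zi; apply: G_on; exists (tagged i.1). Qed.

Lemma node_bounded : exists D, forall i z w, node_valid i ->
  node_arc i z -> node_arc i w -> `|z - w| <= D.
Proof.
have [D D0 hD] := supp_bounded hP; exists (D + D) => i z w Vi /node_supp/hD h1 /node_supp/hD h2.
have -> : z - w = (z - i.2) - (w - i.2) by rewrite opprB addrA subrK.
by rewrite (le_trans (ler_normB _ _))// lerD.
Qed.

(** An arc lies in its tile, so the positions of these nodes are within D0 + D of w, and
    [tile_packing] separates nodes that carry the same edge. *)
Lemma node_count D : exists k, forall (w : plane R) (l : seq node), uniq l ->
  (forall y, y \in l -> node_valid y /\ exists2 z, node_arc y z & `|z - w| <= D) ->
  (size l <= k)%N.
Proof.
have [D0 _ hD] := supp_bounded hP; have [c c0 hc] := tile_packing hP hT.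
have [k hk] := @bounded_separated_count R (gedge K) c (D0 + D).
exists k => w l ul hl; apply: (hk w l ul).
  move=> [f x] [f' y] /hl[Vx _] /hl[Vy _] /= E; rewrite -E in Vy *.
  by move=> xy; congr pair; exact: (hc _ _ _ Vx Vy xy).
move=> y /hl[_ [z /node_supp/hD yz zw]].
have -> : y.2 - w = (z - w) - (z - y.2) by apply/rowP => j; rewrite !mxE; ring.
by rewrite (le_trans (ler_normB _ _))// addrC lerD.
Qed.

Lemma countable_nodes : countable [set i | node_valid i].
Proof.
have [/countable_injP[code code_inj] _ _ _] := hT.
apply/countable_injP.
exists (fun i : node => CodeSeq.code [:: (enum_rank i.1 : nat); code (tag i.1, i.2)]).
move=> [f x] [f' y]; rewrite !inE => Vx Vy /(can_inj CodeSeq.codeK) [/ord_inj/enum_rank_inj E].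
rewrite -E in Vy * => E2; congr pair.
by have /= := code_inj (tag f, x) (tag f, y) (mem_set Vx) (mem_set Vy) E2 => -[].
Qed.

Lemma node_children_uniq i : uniq (node_children i).
Proof.
apply: uniq_flatten_map; first exact: enum_uniq.
  by move=> f _; rewrite map_inj_uniq ?fset_uniq// => d d' [/addIr].
by move=> f f' c _ _ /mapP[d _ ->] /mapP[d' _ []].
Qed.

(** For different parent tiles, the tile of c would lie in both inflated tiles. For different edges
    in one tile, the piece would consist of common points of two edges of S_p, hence of the two ends
    of e, while its points at 1/4, 1/2 and 3/4 are distinct. *)
Lemma node_children_disjoint i i' c : node_valid i -> node_valid i' ->
  c \in node_children i -> c \in node_children i' -> i = i'.
Proof.
move=> Vi Vi' /node_childrenP/edge_digitsP[dc sub] /node_childrenP/edge_digitsP[dc' sub'].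
have [tt|tt] := pselect ((tag i.1, i.2) = (tag i'.1, i'.2)); last first.
  have [_ s1] := digits_enclosed hP hT hsim Vi dc.
  have [_ s2] := digits_enclosed hP hT hsim Vi' dc'.
  rewrite /= !subrK in s1 s2.
  have [z zi] := supp_interior_nonempty hP (tag c.1).
  have z1 : (tsupp supp (tag c.1, c.2))° (z + c.2) by rewrite /tsupp/= interior_translate addrK.
  have /seteqP[/(_ (lam^-1 *: (z + c.2))) h _] := tsupp_interior_disjoint hP hT Vi Vi' tt.
  case: h; split.
    by rewrite -(interior_scale _ _ lam_neq0); apply: interiorS s1 _ z1.
  by rewrite -(scaleE _ _ lam_neq0); apply: s2; apply: interior_subset.
case: i i' Vi Vi' dc dc' sub sub' tt => [[p e] x] [[p' e'] x'] /= Vi Vi' dc dc' sub sub' [pp xx].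
case: p' / pp in e' Vi' dc' sub' *; rewrite -xx in dc' sub' *.
have [-> //|ee'] := pselect (e = e').
set j := (c.1, c.2 - lam *: x) in sub sub'.
have ends t : 0 < t < 1 -> piece_path lam G j t = vpos (S p) (src e) \/
    piece_path lam G j t = vpos (S p) (tgt e).
  move=> /open_unit_itv_sub t01.
  have [] : earc (S p) e (piece_path lam G j t) by apply: sub; exists t.
  move=> s; rewrite unit_itvE => s01 sE.
  have [] : earc (S p) e' (piece_path lam G j t) by apply: sub'; exists t.
  move=> s'; rewrite unit_itvE => s01' sE'.
  have [si|si] := boolP (0 < s < 1).
    by case: ee'; have [] := epath_inj si s01' (etrans sE (esym sE')).
  have [s0|s0] := eqVneq s 0; first by left; rewrite -sE s0 epath0.
  have [s1|s1] := eqVneq s 1; first by right; rewrite -sE s1 epath1.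
  by case/negP: si; move/andP: s01 => [h0 h1]; rewrite !lt_neqAle h0 h1 s1 eq_sym s0.
have pneq t t' : 0 < t < 1 -> 0 < t' < 1 -> t <> t' ->
    piece_path lam G j t <> piece_path lam G j t'.
  move=> t01 t01' tt' E; apply: tt'.
  by have [] := pieces_disjoint hP hT hsim hGS dc dc t01 (open_unit_itv_sub t01') E.
have t1 : 0 < (1 / 4 : R) < 1 by apply/andP; split; lra.
have t2 : 0 < (1 / 2 : R) < 1 by apply/andP; split; lra.
have t3 : 0 < (3 / 4 : R) < 1 by apply/andP; split; lra.
have [n12 n13 n23] := quarters_neq R.
have [E1|E1] := ends _ t1; have [E2|E2] := ends _ t2; have [E3|E3] := ends _ t3.
- by case: (pneq _ _ t1 t2 n12); rewrite E1 E2.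
- by case: (pneq _ _ t1 t2 n12); rewrite E1 E2.
- by case: (pneq _ _ t1 t3 n13); rewrite E1 E3.
- by case: (pneq _ _ t2 t3 n23); rewrite E2 E3.
- by case: (pneq _ _ t2 t3 n23); rewrite E2 E3.
- by case: (pneq _ _ t1 t3 n13); rewrite E1 E3.
- by case: (pneq _ _ t1 t2 n12); rewrite E1 E2.
- by case: (pneq _ _ t1 t2 n12); rewrite E1 E2.
Qed.

Lemma desc_inj n i i' y : node_valid i -> node_valid i' ->
  y \in desc node_children n i -> y \in desc node_children n i' -> i = i'.
Proof.
elim: n i i' => [|n ih] i i' Vi Vi' /=; first by rewrite !inE => /eqP <- /eqP <-.
move=> /flatten_mapP[c ci yc] /flatten_mapP[c' c'i yc'].
have E := ih _ _ (node_children_valid Vi ci) (node_children_valid Vi' c'i) yc yc'.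
by rewrite -E in c'i; apply: node_children_disjoint ci c'i.
Qed.

Lemma desc_uniq n i : node_valid i -> uniq (desc node_children n i).
Proof.
elim: n i => [//|n ih] i Vi /=; apply: uniq_flatten_map.
- exact: node_children_uniq.
- by move=> c ci; apply: ih; apply: node_children_valid ci.
- move=> c c' y ci c'i; apply: desc_inj; exact: node_children_valid Vi _.
Qed.

Local Notation M := (edge_subst_matrix supp T lam G S).

(** The size depends on the edge of the node only, not on the tile that carries it. *)
Lemma size_desc n i :
  size (desc node_children n i) = path_count M n (enum_rank i.1).
Proof.
elim: n i => [//|n ih] i /=; rewrite size_flatten /shape -map_comp sumnE big_map.
rewrite (eq_bigr (fun c => path_count M n (enum_rank c.1))) => [|c _]; last exact: ih.
rewrite (sum_children (fun f => path_count M n (enum_rank f))).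
rewrite (reindex_onto enum_val enum_rank) => [|f _]; last exact: enum_rankK.
rewrite (eq_bigl xpredT) => [|j]; last by rewrite enum_valK eqxx.
by apply: eq_bigr => j _; rewrite mxE enum_rankK enum_valK -mulr_natl natn.
Qed.

Lemma limit_boundaryE :
  limit_boundary T lam G psi = \bigcup_(i in [set i | node_valid i]) limit_image lam psi node_arc i.
Proof.
apply/seteqP; split=> [_ [z [t Tt [y [e _ ye] <-]] <-]|_ [i Vi [z zi <-]]].
  exists (existT (fun p => edge (K p)) t.1 e, t.2).
    by rewrite /node_valid/=; case: t Tt {y ye e}.
  by exists (y + t.2) => //; exists y.
exists z => //; exists (tag i.1, i.2) => //; move: zi; rewrite /node_arc translateE => zi.
by rewrite translateE; exists (tagged i.1).
Qed.

End TilingSystem.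

(** * The dimension formula *)

Theorem theorem7p2 (R : realType) (P : finType) (supp : P -> set (plane R))
  (T : set (@tile R P)) (lam : R)
  (K : P -> cgraph) (G S : forall p, geom_graph R (K p))
  (psi : plane R -> plane R) (lamE : R) (N : nat)
  (hP : prototile_set supp)
  (hT : tiling supp T)
  (hflc : finite_local_complexity supp T)
  (hsim : self_similar supp T lam)
  (hprim : primitive_mx (subst_matrix supp T lam))
  (hGS : recurrent_pair supp T lam G S)
  (hTG : bounds_tiling T G)
  (hinj : injectivity_conditions supp T lam S N)
  (hpsi : induced_map supp T G S psi)
  (hlamE : largest_eigenvalue (edge_subst_matrix supp T lam G S) lamE) :
  hausdorff_dim (limit_boundary T lam G psi) = (ln lamE / ln lam)%:E.
Proof.
have lam_gt1 : 1 < lam by case: hsim.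
have lam_gt0 : 0 < lam by apply: lt_trans lam_gt1.
have lnlam : 0 < ln lam by rewrite ln_gt0.
have chV := node_children_valid hP hT hsim (G := G) (S := S).
have chC := node_children_cover hP hT hsim hGS hTG hpsi.
have chS := node_children_sub hP hT hsim hGS hpsi.
have [B hB] := node_displacement hP hGS hpsi.
have [D hD] := node_bounded hP hGS.
have cpt := node_preim_compact hGS hpsi.
rewrite limit_boundaryE.
set s0 := ln lamE / ln lam.
have [u0 u0sub [i0 u0pos]] := subeigenvector hlamE.
have [_ _ _ /(_ (tag (enum_val i0)))[x0 Tx0]] := hT.
(* The root of the lower bound: an edge of positive weight, placed in a tile that T is known to
   contain. *)
pose r0 : @piece R P K := (enum_val i0, x0).
have V0 : node_valid T r0 by [].
(* If lamE < 1, the path counts would tend to 0, although every node has at least one descendant at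
   each level. *)
have lamE1 : 1 <= lamE.
  rewrite leNgt; apply/negP => lt1.
  pose r := (lamE + 1) / 2.
  have rE : lamE < r by rewrite /r; lra.
  have [c c0 hc] := path_count_bound hlamE rE.
  have [||n hn] := @geometric_small R r c (1 / 2).
  - by apply/andP; have := largest_eigenvalue_ge0 hlamE; rewrite /r; split; lra.
  - lra.
  have := le_trans (hc n i0) (hn n (leqnn n)).
  have [z zr] := node_arc_nonempty G r0.
  have [y yn _] := limit_image_desc lam_gt1 chV chC hB n V0 (ex_intro2 _ _ z zr erefl).
  have : (0 < path_count (edge_subst_matrix supp T lam G S) n (enum_rank r0.1))%N.
    by rewrite -(size_desc supp T lam G S); case: (desc _ _ _) yn.
  by rewrite /r0/= enum_valK -(ler_nat R) => h1 h2; lra.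
have lamE0 : 0 < lamE by apply: lt_le_trans lamE1.
have powE s : lam `^ s = expR (s * ln lam) by rewrite /powR gt_eqF.
apply/eqP; rewrite eq_le; apply/andP; split.
  apply/lee_addgt0Pr => e e0; rewrite -EFinD; apply: ereal_inf_lbound.
  have s00 : 0 <= s0 by rewrite divr_ge0 ?ln_ge0// ltW.
  exists (s0 + e) => //; split; first lra.
  have lt : lamE < lam `^ (s0 + e).
    rewrite powE mulrDl divfK ?gt_eqF// -[X in X < _](lnK lamE0) ltr_expR ltrDl.
    exact: mulr_gt0.
  (* The count of descendants needs r > lamE, the covers need r < lam^(s0 + e). *)
  pose r := (lamE + lam `^ (s0 + e)) / 2.
  have rE : lamE < r by rewrite /r; lra.
  have [c c0 hc] := path_count_bound hlamE rE.
  apply: (hausdorff_measure_limit_images_eq0 lam_gt1 chV chC hB hD (r := r) _ _ _ c0).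
  - lra.
  - exact: lt_trans lamE0 rE.
  - by rewrite /r; lra.
  - by move=> n x Vx; rewrite (size_desc supp T lam G S).
  - exact: (countable_nodes K hT).
apply: le_ereal_inf_tmp => _ [s [s_gt0 sA] <-]; rewrite lee_fin leNgt; apply/negP => ss0.
have lns : s * ln lam < ln lamE by rewrite -ltr_pdivlMr.
(* A dimension s strictly between 0 and s0 forces ln lamE > 0; when lamE = 1 there is nothing to
   exclude. *)
have a1 : 1 < lamE.
  rewrite ltNge; apply/negP => /ln_le0 ln0.
  by have := mulr_gt0 s_gt0 lnlam; lra.
have la : lam `^ s <= lamE by rewrite powE -[leRHS](lnK lamE0) ler_expR ltW.
have [k hk] := node_count hP hT hGS (1 + drift lam B).
pose u (x : @piece R P K) := u0 (enum_rank x.1).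
apply: (hausdorff_measure_neq0 lam_gt1 chV chC chS hB cpt (u := u)
  (um := \sum_j u0 j) (x0 := r0) (a := lamE) s_gt0 a1 la _ _ _ V0 _ _ hk _ sA).
- by move=> x _; apply: node_arc_nonempty.
- move=> x _; have [h _] := u0sub (enum_rank x.1); rewrite h/= /u.
  by rewrite (bigD1 (enum_rank x.1))//= lerDl sumr_ge0// => j _; case: (u0sub j).
- move=> x _; have [_ h] := u0sub (enum_rank x.1); apply: le_trans h _.
  rewrite le_eqVlt; apply/orP; left; apply/eqP.
  rewrite /u (sum_children supp T lam G S (fun f => u0 (enum_rank f))).
  rewrite [RHS](reindex_onto enum_val enum_rank) => [|f _]; last exact: enum_rankK.
  rewrite [RHS](eq_bigl xpredT) => [|j]; last by rewrite /= enum_valK eqxx.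
  by apply: eq_bigr => j _; rewrite mxE enum_rankK enum_valK mulr_natl.
- by rewrite /u /r0/= enum_valK.
- by move=> n; apply: (desc_uniq hP hT hsim hGS).
- by move=> z zr; exists r0.
Qed.
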